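(* Let $k$ be a perfect field containing $\mathbb{F}_2$. Let $X$ be the base change to $k$ of the blowup of $\mathbb{P}^2_{\mathbb{F}_2}$ at its $7$ $\mathbb{F}_2$-rational points, let $f:X\to\mathbb{P}^2_k$ be the induced morphism, let $E_1,\dots,E_7$ be the exceptional curves of $f$ on $X$, let $H$ be the hyperplane divisor on $\mathbb{P}^2_k$, and let $$B:=5f^*H-2\sum_{i=1}^{7}E_i .$$ Then $$H^1(X,W\mathcal{O}_X(-B))\otimes_{\mathbb{Z}}\mathbb{Q}\neq 0.$$
   Context: For a divisor $E$ on $X$, with function field $K(X)$ (characteristic $p=2$), $W\mathcal{O}_X(E)$ is the sheaf with $W\mathcal{O}_X(E)(U)=\{(a_0,a_1,\dots)\in W(K(X)) : (\operatorname{div}(a_i)+p^iE)|_U\ge 0 \text{ for all } i\ge 0\}$ (with $a_i=0$ always allowed), where $W(K(X))$ denotes the ring of $p$-typical Witt vectors. *)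

(* Defs.v *)
From HB Require Import structures.
From mathcomp Require Import all_boot all_order all_algebra finmap.
From mathcomp Require Import boolp classical_sets topology generic_quotient ring_quotient.
From mathcomp.multinomials Require Import monalg.
From mathcomp Require Import ring zify.
Set Implicit Arguments.
Unset Strict Implicit.
Unset Printing Implicit Defensive.
Import GRing.Theory.
Local Open Scope ring_scope.
Local Open Scope quotient_scope.
Local Open Scope classical_set_scope.

(* Integer polynomials in variables indexed by an arbitrary choiceType. *)
Notation ipoly I := {malg int[{cmonom I}]}.

Section IntegerPolynomials.
Variable I : choiceType.

Definition ivar (i : I) : ipoly I := << ucm i >>.

Definition cmeval (A : comNzRingType) (a : I -> A) (m : {cmonom I}) : A :=
  \prod_(i <- finsupp m) a i ^+ m i.

Definition ieval (A : comNzRingType) (a : I -> A) (P : ipoly I) : A :=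
  mmap intr (cmeval a) P.

Lemma cmevalw (A : comNzRingType) (a : I -> A) (m : {cmonom I}) (d : {fset I}) :
  (finsupp m `<=` d)%fset -> cmeval a m = \prod_(i <- d) a i ^+ m i.
Proof.
move=> le; rewrite /cmeval (big_fset_incl _ le) //= => i _.
by rewrite -cmE_eq0 => /eqP ->.
Qed.

Lemma cmeval_is_mmorphism (A : comNzRingType) (a : I -> A) :
  mmorphism (cmeval a).
Proof.
split=> [m1 m2|]; last by rewrite /cmeval mdom1 big_seq_fset0.
rewrite [LHS]/cmeval mdomD (cmevalw a (fsubsetUl (finsupp m1) (finsupp m2))).
rewrite (cmevalw a (fsubsetUr (finsupp m1) (finsupp m2))) -big_split /=.
by apply: eq_bigr => i _; rewrite cmM exprD.
Qed.

HB.instance Definition _ (A : comNzRingType) (a : I -> A) :=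
  isMultiplicative.Build {cmonom I} A (cmeval a) (cmeval_is_mmorphism a).

HB.instance Definition _ (A : comNzRingType) (a : I -> A) :=
  GRing.RMorphism.copy (ieval a) (mmap (intr : int -> A) (cmeval a)).

Lemma ieval_var (A : comNzRingType) (a : I -> A) i : ieval a (ivar i) = a i.
Proof.
by rewrite /ieval mmapU /= mulr1z mul1r /cmeval mdomU big_seq_fset1 cmUU expr1.
Qed.

Lemma ipoly_ind (P : ipoly I -> Prop) :
  P 1 -> (forall i, P (ivar i)) -> (forall x y, P x -> P y -> P (x - y)) ->
  (forall x y, P x -> P y -> P (x * y)) -> forall x, P x.
Proof.
move=> P1 Pv PB PM.
have P0 : P 0 by rewrite -(subrr 1); exact: PB.
have PN x : P x -> P (- x) by move=> Px; rewrite -sub0r; exact: PB.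
have PD x y : P x -> P y -> P (x + y).
  by move=> Px Py; rewrite -[y]opprK; apply/PB/PN.
have Pn n : P n%:R by elim: n => [|n IH]; [exact: P0 | by rewrite -natr1; exact: PD].
have Pm (m : {cmonom I}) : P << m >>.
  move: {2}(mdeg m).+1 (ltnSn (mdeg m)) => n; elim: n m => [|n IH] m le_m.
    by exfalso; rewrite ltn0 in le_m.
  have [/eqP -> |/negP m_neq1] := boolP (m == mone); first exact: P1.
  have /fset0Pn[i mi] : finsupp m != fset0.
    apply/negP => /eqP m0; apply: m_neq1; apply/cmP => j.
    by rewrite cm1; apply/eqP; rewrite cmE_eq0 m0.
  have Em : m = mmul (ucm i) (divcm m (ucm i)).
    apply/eqP/cmP => j; rewrite cmM divcmE subnKC //.
    by rewrite cmU; case: eqP => [<-|] //; rewrite lt0n cmE_neq0.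
  have -> : << m >> = ivar i * << divcm m (ucm i) >> :> ipoly I.
    by rewrite malgM_def /ivar fgmulUU mulr1 -Em.
  apply: PM; first exact: Pv.
  by apply: IH; move: le_m; rewrite Em mdegM mdegU add1n ltnS -Em.
move=> x; rewrite [x]monalgE; apply: big_ind; [exact: P0 | exact: PD |].
move=> m _; have -> : << x@_m *g m >> = << m >> *~ x@_m.
  rewrite -[in LHS](intz x@_m).
  case: (x@_m) => k; first by rewrite monalgUMn.
  by rewrite NegzE mulrNz monalgUN monalgUMn.
have H k : P (<< m >> *+ k).
  by rewrite -mulr_natr; apply: PM; [exact: Pm | exact: Pn].
by case: (x@_m) => k; [exact: H | rewrite NegzE mulrNz; apply: PN; exact: H].
Qed.

Lemma ipoly_tfree (x : ipoly I) n : (0 < n)%N -> x *+ n = 0 -> x = 0.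
Proof.
move=> n_gt0 xn0; apply/malgP => m; rewrite mcoeff0.
move/(congr1 (mcoeff m)): xn0; rewrite mcoeffMn mcoeff0 => /eqP.
by rewrite -mulr_natr mulf_eq0 Num.Theory.pnatr_eq0 eqn0Ngt n_gt0 orbF => /eqP.
Qed.

End IntegerPolynomials.

Lemma rmorph_ieval (I : choiceType) (A B : comNzRingType)
  (f : {rmorphism A -> B}) (a : I -> A) P :
  f (ieval a P) = ieval (f \o a) P.
Proof.
rewrite /ieval /mmap rmorph_sum; apply: eq_bigr => m _.
rewrite rmorphM rmorph_int; congr (_ * _).
by rewrite /cmeval rmorph_prod; apply: eq_bigr => i _; rewrite rmorphXn.
Qed.

Section Dwork.
Variable p : nat.
Hypothesis p_pr : prime p.
Variables (R : comNzRingType) (phi : {rmorphism R -> R}).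
Hypothesis phiP : forall x, exists y, phi x = x ^+ p + y *+ p.

Definition ghost (A : comNzRingType) (n : nat) (a : nat -> A) : A :=
  \sum_(i < n.+1) a i ^+ (p ^ (n - i)) *+ (p ^ i).

Let cong n (x y : R) := exists z, x = y + z *+ n.

Lemma congX n m (x y : R) : (0 < n)%N -> cong (p ^ n) x y ->
  cong (p ^ (n + m)) (x ^+ (p ^ m)) (y ^+ (p ^ m)).
Proof.
move=> n_gt0 xy; elim: m => [|m [z Hz]]; first by rewrite addn0 !expr1.
rewrite !expnSr !exprM Hz.
have hd : (0 < p)%N by exact: prime_gt0.
set u := y ^+ _; rewrite exprDn.
rewrite (eq_bigr (fun i : 'I_p.+1 =>
   (u ^+ (p - i) * z ^+ i) *+ ((p ^ (n + m)) ^ i * 'C(p, i)))); last first.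
  by move=> i _; rewrite exprMn_n mulrnAr -mulrnA.
rewrite big_ord_recl /= subn0 expr0 mulr1 expn0 bin0 muln1.
suff : forall i : 'I_p,
    (p ^ (n + m.+1) %| (p ^ (n + m)) ^ (lift ord0 i) * 'C(p, lift ord0 i))%N.
  move=> dv.
  exists (\sum_(i < p) (u ^+ (p - lift ord0 i) * z ^+ (lift ord0 i)) *+
     ((p ^ (n + m)) ^ (lift ord0 i) * 'C(p, lift ord0 i) %/ p ^ (n + m.+1))).
  congr (_ + _); rewrite -sumrMnl; apply: eq_bigr => i _.
  by rewrite -mulrnA divnK.
move=> i; rewrite lift0.
have [ip|] := ltnP i.+1 p.
  rewrite addnS expnS [X in (_ %| X)%N]mulnC dvdn_mul //.
    by rewrite prime_dvd_bin.
  by rewrite expnS dvdn_mulr.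
move=> le; have {le} -> : i.+1 = p by apply/eqP; rewrite eqn_leq le ltn_ord.
rewrite binn muln1 -expnM dvdn_exp2l // addnS.
apply: (@leq_trans ((n + m) * 2)); last by rewrite leq_mul2l prime_gt1 ?orbT.
by rewrite muln2 -addnn -addn1 leq_add2l addn_gt0 n_gt0.
Qed.

(* dwork g is the sequence s determined recursively by ghost n s = g n, each step
   dividing by p ^ n; xget returns the junk value 0 where this is impossible
   (dworkP gives a criterion under which it never is). *)
Fixpoint dwork_seq (A : comNzRingType) (g : nat -> A) (n : nat) : seq A :=
  if n is n'.+1 then
    let s := dwork_seq g n' in
    rcons s (xget 0 [set y | g n' =
      \sum_(i < n') s`_i ^+ (p ^ (n' - i)) *+ (p ^ i) + y *+ (p ^ n')])
  else [::].

Definition dwork (A : comNzRingType) (g : nat -> A) (n : nat) : A :=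
  (dwork_seq g n.+1)`_n.

Lemma size_dwork_seq (A : comNzRingType) (g : nat -> A) n :
  size (dwork_seq g n) = n.
Proof. by elim: n => //= n IH; rewrite size_rcons IH. Qed.

Lemma nth_dwork_seq (A : comNzRingType) (g : nat -> A) n i :
  (i < n)%N -> (dwork_seq g n)`_i = dwork g i.
Proof.
elim: n => // n IH; rewrite ltnS leq_eqVlt => /orP[/eqP -> //|lt_in].
by rewrite -IH //= nth_rcons size_dwork_seq lt_in.
Qed.

Lemma dworkP (g : nat -> R) :
  (forall n, exists z, g n.+1 = phi (g n) + z *+ (p ^ n.+1)) ->
  forall n, ghost n (dwork g) = g n.
Proof.
move=> Hg n.
pose S m := \sum_(i < m) dwork g i ^+ (p ^ (m - i)) *+ (p ^ i).
have E m : (exists y, g m = S m + y *+ (p ^ m)) -> ghost m (dwork g) = g m.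
  move=> [y Hy]; rewrite /ghost big_ord_recr /= subnn expr1 -/(S m).
  rewrite {1}/dwork /= nth_rcons size_dwork_seq ltnn eqxx.
  have -> : \sum_(i < m) (dwork_seq g m)`_i ^+ (p ^ (m - i)) *+ p ^ i = S m.
    by apply: eq_bigr => i _; rewrite nth_dwork_seq.
  rewrite [RHS](_ : _ = S m + y *+ p ^ m) //.
  have := @xgetPex _ 0 [set z | g m = S m + z *+ p ^ m] (ex_intro _ y Hy).
  by rewrite /= Hy => <-.
elim: n => [|n IH]; apply: E.
  by exists (g 0%N); rewrite /S big_ord0 add0r.
have [z ->] := Hg n; rewrite -IH rmorph_sum /=.
suff [w Hw] : exists w, \sum_(i < n.+1) phi (dwork g i ^+ (p ^ (n - i)) *+ (p ^ i)) =
    S n.+1 + w *+ (p ^ n.+1).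
  by exists (w + z); rewrite Hw mulrnDl addrA.
rewrite /S; elim/big_ind2: _ => [|x1 x2 y1 y2 [w1 ->] [w2 ->]|i _].
- by exists 0; rewrite mul0rn addr0.
- by exists (w1 + w2); rewrite mulrnDl addrACA.
have [y Hy] := phiP (dwork g i).
have [w Hw] : cong (p ^ (1 + (n - i))) (phi (dwork g i) ^+ (p ^ (n - i)))
                ((dwork g i ^+ p) ^+ (p ^ (n - i))).
  by apply: congX => //; exists y; rewrite Hy expn1.
exists w; rewrite rmorphMn rmorphXn Hw mulrnDl -exprM -expnS.
have le_in : (i <= n)%N by rewrite -ltnS.
rewrite subSn // -mulrnA -expnD; congr (_ + w *+ (p ^ _)).
by rewrite add1n addSn subnK.
Qed.

End Dwork.

Section WittPolynomials.
Variables (p : nat) (p_pr : prime p).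

Definition frob_lift (I : choiceType) : {rmorphism ipoly I -> ipoly I} :=
  ieval (fun i => ivar i ^+ p).

Lemma exp_primeD (R : comNzRingType) (x1 x2 : R) :
  exists y, (x1 + x2) ^+ p = x1 ^+ p + x2 ^+ p + y *+ p.
Proof.
have [p' Ep] : exists p', p = p'.+1.
  by exists p.-1; rewrite prednK // prime_gt0.
rewrite exprDn Ep big_ord_recl big_ord_recr /= -Ep subn0 expr0 mulr1 bin0.
rewrite /bump /= add1n -Ep subnn expr0 mul1r binn !mulr1n.
exists (\sum_(i < p') (x1 ^+ (p - i.+1) * x2 ^+ i.+1) *+ ('C(p, i.+1) %/ p)).
rewrite [RHS]addrAC -[RHS]addrA -sumrMnl; congr (_ + (_ + _)).
apply: eq_bigr => i _; rewrite add1n -mulrnA divnK // prime_dvd_bin //=.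
by rewrite Ep ltnS.
Qed.

Lemma exp_primeB (R : comNzRingType) (x1 x2 y1 y2 : R) :
  exists y, x1 ^+ p + y1 *+ p - (x2 ^+ p + y2 *+ p) = (x1 - x2) ^+ p + y *+ p.
Proof.
have [z1 Ez1] := exp_primeD x1 (- x2); have [z2 Ez2] := exp_primeD x2 (- x2).
exists (y1 - y2 - z1 + z2); rewrite Ez1.
move: Ez2; rewrite subrr expr0n gtn_eqF ?prime_gt0 //= => Ez2.
rewrite !(mulrnDl, mulNrn).
have -> : (- x2) ^+ p = - x2 ^+ p - z2 *+ p.
  move: Ez2; set u := z2 *+ p; set v := (- x2) ^+ p; set w := x2 ^+ p => Ez2.
  have -> : v = w + v + u - w - u by ring.
  by rewrite -Ez2 sub0r.
by ring.
Qed.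

Lemma exp_primeM (R : comNzRingType) (x1 x2 y1 y2 : R) :
  exists y, (x1 ^+ p + y1 *+ p) * (x2 ^+ p + y2 *+ p) = (x1 * x2) ^+ p + y *+ p.
Proof.
exists (x1 ^+ p * y2 + y1 * x2 ^+ p + y1 * y2 *+ p).
rewrite exprMn mulrDl !mulrDr -!addrA; congr (_ + _).
by rewrite !mulrnDl !mulrnAl !mulrnAr addrA.
Qed.

Lemma frob_liftP (I : choiceType) (x : ipoly I) :
  exists y, frob_lift I x = x ^+ p + y *+ p.
Proof.
move: x; apply: ipoly_ind => [|i|x1 x2 [y1 E1] [y2 E2]|x1 x2 [y1 E1] [y2 E2]].
- by exists 0; rewrite rmorph1 expr1n mul0rn addr0.
- by exists 0; rewrite [LHS]ieval_var mul0rn addr0.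
- by have [y E] := exp_primeB x1 x2 y1 y2; exists y; rewrite rmorphB E1 E2.
- by have [y E] := exp_primeM x1 x2 y1 y2; exists y; rewrite rmorphM E1 E2.
Qed.

(* The Witt addition and negation polynomials, characterised by wsumP and
   wnegP. *)
Definition wsum (n : nat) : ipoly (bool * nat)%type :=
  dwork p (fun n => ghost p n (fun i => ivar (false, i))
                  + ghost p n (fun i => ivar (true, i))) n.

Definition wneg (n : nat) : ipoly nat :=
  dwork p (fun n => - ghost p n (fun i => ivar i)) n.

Lemma rmorph_ghost (A B : comNzRingType) (f : {rmorphism A -> B}) n a :
  f (ghost p n a) = ghost p n (f \o a).
Proof.
by rewrite rmorph_sum; apply: eq_bigr => i _; rewrite rmorphMn rmorphXn.
Qed.

Lemma ghost_frob (R : comNzRingType) (phi : {rmorphism R -> R}) (v : nat -> R) n :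
  (forall i, phi (v i) = v i ^+ p) ->
  ghost p n.+1 v = phi (ghost p n v) + v n.+1 *+ p ^ n.+1.
Proof.
move=> Hv; rewrite rmorph_ghost /ghost big_ord_recr /= subnn expr1.
congr (_ + _); apply: eq_bigr => i _ /=; rewrite Hv -exprM -expnS.
by rewrite subSn // -ltnS.
Qed.

Lemma ghost_frobD (R : comNzRingType) (phi : {rmorphism R -> R})
    (u v : nat -> R) n :
  (forall i, phi (u i) = u i ^+ p) -> (forall i, phi (v i) = v i ^+ p) ->
  exists z, ghost p n.+1 u + ghost p n.+1 v =
    phi (ghost p n u + ghost p n v) + z *+ p ^ n.+1.
Proof.
move=> Hu Hv; rewrite (ghost_frob _ Hu) (ghost_frob _ Hv) rmorphD addrACA.
by rewrite -mulrnDl; eexists.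
Qed.

Lemma ghost_frobN (R : comNzRingType) (phi : {rmorphism R -> R})
    (u : nat -> R) n :
  (forall i, phi (u i) = u i ^+ p) ->
  exists z, - ghost p n.+1 u = phi (- ghost p n u) + z *+ p ^ n.+1.
Proof.
by move=> Hu; rewrite (ghost_frob _ Hu) rmorphN opprD -mulNrn; eexists.
Qed.

Lemma wsumP n : ghost p n wsum =
  ghost p n (fun i => ivar (false, i)) + ghost p n (fun i => ivar (true, i)).
Proof.
apply: (dworkP p_pr (@frob_liftP _)) => m.
by apply: ghost_frobD => i; exact: ieval_var.
Qed.

Lemma wnegP n : ghost p n wneg = - ghost p n (fun i => ivar i).
Proof.
apply: (dworkP p_pr (@frob_liftP _)) => m.
by apply: ghost_frobN => i; exact: ieval_var.
Qed.

Definition wadd (A : comNzRingType) (a b : nat -> A) (n : nat) : A :=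
  ieval (fun i => (if i.1 then b else a) i.2) (wsum n).

Definition wopp (A : comNzRingType) (a : nat -> A) (n : nat) : A :=
  ieval a (wneg n).

Lemma rmorph_ghostD (A B : comNzRingType) (f : {rmorphism A -> B}) n s u v :
  ghost p n s = ghost p n u + ghost p n v ->
  ghost p n (f \o s) = ghost p n (f \o u) + ghost p n (f \o v).
Proof. by move=> E; rewrite -!rmorph_ghost E rmorphD. Qed.

Lemma rmorph_ghostN (A B : comNzRingType) (f : {rmorphism A -> B}) n s u :
  ghost p n s = - ghost p n u -> ghost p n (f \o s) = - ghost p n (f \o u).
Proof. by move=> E; rewrite -!rmorph_ghost E rmorphN. Qed.

Lemma ghost_wadd (A : comNzRingType) (a b : nat -> A) n :
  ghost p n (wadd a b) = ghost p n a + ghost p n b.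
Proof.
pose f : bool * nat -> A := fun i => (if i.1 then b else a) i.2.
have Ea : ieval f \o (fun i => ivar (false, i)) = a.
  by apply: funext => i; exact: ieval_var.
have Eb : ieval f \o (fun i => ivar (true, i)) = b.
  by apply: funext => i; exact: ieval_var.
rewrite -[wadd a b]/(ieval f \o wsum).
apply: etrans (rmorph_ghostD (ieval f) (wsumP n)) _.
exact: (congr2 +%R (congr1 (ghost p n) Ea) (congr1 (ghost p n) Eb)).
Qed.

Lemma ghost_wopp (A : comNzRingType) (a : nat -> A) n :
  ghost p n (wopp a) = - ghost p n a.
Proof.
have Ea : ieval a \o (fun i => ivar i) = a.
  by apply: funext => i; exact: ieval_var.
rewrite -[wopp a]/(ieval a \o wneg).
apply: etrans (rmorph_ghostN (ieval a) (wnegP n)) _.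
exact: (congr1 (fun u => - ghost p n u) Ea).
Qed.

Lemma rmorph_wadd (A B : comNzRingType) (f : {rmorphism A -> B}) a b n :
  f (wadd a b n) = wadd (f \o a) (f \o b) n.
Proof.
by rewrite rmorph_ieval; congr (ieval _ _); apply: funext => -[[] i].
Qed.

Lemma rmorph_wopp (A B : comNzRingType) (f : {rmorphism A -> B}) a n :
  f (wopp a n) = wopp (f \o a) n.
Proof. by rewrite rmorph_ieval. Qed.

Lemma ghost0 (A : comNzRingType) n : ghost p n (fun=> 0 : A) = 0.
Proof.
rewrite /ghost big1 // => i _.
by rewrite expr0n gtn_eqF ?mul0rn // expn_gt0 prime_gt0.
Qed.

(* Multiplication by the Teichmueller representative of c. *)
Definition wscale (A : comNzRingType) (c : A) (a : nat -> A) (n : nat) : A :=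
  c ^+ (p ^ n) * a n.

Lemma ghost_wscale (A : comNzRingType) (c : A) a n :
  ghost p n (wscale c a) = c ^+ (p ^ n) * ghost p n a.
Proof.
rewrite /ghost mulr_sumr; apply: eq_bigr => i _.
by rewrite /wscale exprMn -exprM -expnD subnKC ?leq_ord // mulrnAr.
Qed.

Section TorsionFree.
Variable R : comNzRingType.
Hypothesis tf : forall (x : R) n, (0 < n)%N -> x *+ n = 0 -> x = 0.
Implicit Types (a b c : nat -> R).

Lemma ghost_inj a b : (forall n, ghost p n a = ghost p n b) -> a = b.
Proof.
move=> gab; apply: funext => n; elim/ltn_ind: n => n IH.
have := gab n; rewrite /ghost !big_ord_recr /= subnn !expr1.
rewrite (eq_bigr (fun i : 'I_n => b i ^+ (p ^ (n - i)) *+ p ^ i)) => [|i _].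
  move/addrI/eqP; rewrite -subr_eq0 -mulrnBl => /eqP/tf H.
  by apply/eqP; rewrite -subr_eq0 H // expn_gt0 prime_gt0.
by rewrite IH.
Qed.

Lemma tf_waddC a b : wadd a b = wadd b a.
Proof. by apply: ghost_inj => n; rewrite !ghost_wadd addrC. Qed.

Lemma tf_waddA a b c : wadd a (wadd b c) = wadd (wadd a b) c.
Proof. by apply: ghost_inj => n; rewrite !ghost_wadd addrA. Qed.

Lemma tf_wadd0 a : wadd (fun=> 0) a = a.
Proof. by apply: ghost_inj => n; rewrite ghost_wadd ghost0 add0r. Qed.

Lemma tf_waddN a : wadd (wopp a) a = (fun=> 0).
Proof.
by apply: ghost_inj => n; rewrite ghost_wadd ghost_wopp ghost0 addNr.
Qed.

Lemma tf_wscaleD x a b :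
  wscale x (wadd a b) = wadd (wscale x a) (wscale x b).
Proof.
by apply: ghost_inj => n; rewrite ghost_wadd !ghost_wscale ghost_wadd mulrDr.
Qed.

Lemma tf_wscaleN x a : wscale x (wopp a) = wopp (wscale x a).
Proof.
by apply: ghost_inj => n; rewrite ghost_wopp !ghost_wscale ghost_wopp mulrN.
Qed.

Variables (A : comNzRingType) (f : {rmorphism R -> A}).

Lemma comp_wadd a b : f \o wadd a b = wadd (f \o a) (f \o b).
Proof. by apply: funext => n; exact: rmorph_wadd. Qed.

Lemma comp_wopp a : f \o wopp a = wopp (f \o a).
Proof. by apply: funext => n; exact: rmorph_wopp. Qed.

Lemma comp_wscale x a : f \o wscale x a = wscale (f x) (f \o a).
Proof. by apply: funext => n; rewrite /= /wscale rmorphM rmorphXn. Qed.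

Lemma comp_zero : f \o (fun _ : nat => 0) = (fun=> 0).
Proof. by apply: funext => n; exact: rmorph0. Qed.

Variable g : A -> R.
Hypothesis fgK : cancel g f.

Let K (u : nat -> A) : f \o (g \o u) = u.
Proof. by apply: funext => n; exact: fgK. Qed.

Lemma im_waddC (u v : nat -> A) : wadd u v = wadd v u.
Proof. by rewrite -[u]K -[v]K -!comp_wadd tf_waddC. Qed.

Lemma im_waddA (u v w : nat -> A) : wadd u (wadd v w) = wadd (wadd u v) w.
Proof. by rewrite -[u]K -[v]K -[w]K -!comp_wadd tf_waddA. Qed.

Lemma im_wadd0 (u : nat -> A) : wadd (fun=> 0) u = u.
Proof. by rewrite -[u]K -comp_zero -comp_wadd tf_wadd0. Qed.

Lemma im_waddN (u : nat -> A) : wadd (wopp u) u = (fun=> 0).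
Proof. by rewrite -[u]K -comp_wopp -comp_wadd tf_waddN comp_zero. Qed.

Lemma im_wscaleD x (u v : nat -> A) :
  wscale x (wadd u v) = wadd (wscale x u) (wscale x v).
Proof.
by rewrite -[u]K -[v]K -[x]fgK -comp_wadd -!comp_wscale tf_wscaleD comp_wadd.
Qed.

Lemma im_wscaleN x (u : nat -> A) : wscale x (wopp u) = wopp (wscale x u).
Proof.
by rewrite -[u]K -[x]fgK -comp_wopp -!comp_wscale tf_wscaleN comp_wopp.
Qed.

End TorsionFree.

Section AnyRing.
Variable A : comNzRingType.
Implicit Types (a b c : nat -> A).

Let f : {rmorphism ipoly A -> A} := ieval (id : A -> A).
Let fK : cancel (@ivar A) f. Proof. by move=> x; exact: ieval_var. Qed.

Lemma waddC a b : wadd a b = wadd b a.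
Proof. exact: (im_waddC (@ipoly_tfree A) fK). Qed.

Lemma waddA a b c : wadd a (wadd b c) = wadd (wadd a b) c.
Proof. exact: (im_waddA (@ipoly_tfree A) fK). Qed.

Lemma wadd0 a : wadd (fun=> 0) a = a.
Proof. exact: (im_wadd0 (@ipoly_tfree A) fK). Qed.

Lemma waddN a : wadd (wopp a) a = (fun=> 0).
Proof. exact: (im_waddN (@ipoly_tfree A) fK). Qed.

Lemma wscaleD x a b : wscale x (wadd a b) = wadd (wscale x a) (wscale x b).
Proof. exact: (im_wscaleD (@ipoly_tfree A) fK). Qed.

Lemma wscaleN x a : wscale x (wopp a) = wopp (wscale x a).
Proof. exact: (im_wscaleN (@ipoly_tfree A) fK). Qed.

End AnyRing.

End WittPolynomials.

(* A record and not an alias: nat -> A already carries the pointwise group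
   structure. Only the additive group of the ring of Witt vectors is built. *)
Record witt (p : nat) (p_pr : prime p) (A : comNzRingType) :=
  Witt { wcoord :> nat -> A }.

Section WittGroup.
Variables (p : nat) (p_pr : prime p) (A : comNzRingType).
Local Notation W := (witt p_pr A).

Lemma wcoord_inj : injective (@wcoord p p_pr A).
Proof. by case=> a [b] /= ->. Qed.

HB.instance Definition _ := gen_eqMixin W.
HB.instance Definition _ := gen_choiceMixin W.

Let W0 : W := Witt p_pr (fun=> 0).
Let Wopp (a : W) : W := Witt p_pr (wopp p a).
Let Wadd (a b : W) : W := Witt p_pr (wadd p a b).

Let WaddA : associative Wadd.
Proof. by move=> a b c; apply: wcoord_inj; rewrite /= waddA. Qed.
Let WaddC : commutative Wadd.
Proof. by move=> a b; apply: wcoord_inj; rewrite /= waddC. Qed.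
Let Wadd0 : left_id W0 Wadd.
Proof. by move=> a; apply: wcoord_inj; rewrite /= wadd0. Qed.
Let WaddN : left_inverse W0 Wopp Wadd.
Proof. by move=> a; apply: wcoord_inj; rewrite /= waddN. Qed.

HB.instance Definition _ := GRing.isZmodule.Build W WaddA WaddC Wadd0 WaddN.

End WittGroup.

Record opens (T : topologicalType) := Opens {
  oset :> set T;
  oset_open : open oset }.

Record sheaf (T : topologicalType) := Sheaf {
  sect :> opens T -> zmodType;
  res : forall U V : opens T, V `<=` U -> sect U -> sect V;
  res_zmod : forall (U V : opens T) (VU : V `<=` U), zmod_morphism (res VU);
  res_id : forall (U : opens T) (UU : U `<=` U) s, res UU s = s;
  res_res : forall (U V W : opens T) (VU : V `<=` U) (WV : W `<=` V)
    (WU : W `<=` U) s, res WV (res VU s) = res WU s;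
  sheaf_separated : forall (U : opens T) (C : set (opens T)) (s : sect U),
    (U : set T) = \bigcup_(V in C) V ->
    (forall (V : opens T) (VU : V `<=` U), C V -> res VU s = 0) -> s = 0;
  sheaf_glue : forall (U : opens T) (C : set (opens T))
    (s : forall V : opens T, sect V),
    (U : set T) = \bigcup_(V in C) V ->
    (forall (V V' W : opens T) (WV : W `<=` V) (WV' : W `<=` V'),
       C V -> C V' -> res WV (s V) = res WV' (s V')) ->
    exists t : sect U, forall (V : opens T) (VU : V `<=` U), C V -> res VU t = s V }.

Record sheaf_hom (T : topologicalType) (F G : sheaf T) := SheafHom {
  hom_sect :> forall U : opens T, F U -> G U;
  hom_zmod : forall U : opens T, zmod_morphism (@hom_sect U);
  hom_res : forall (U V : opens T) (VU : V `<=` U) (s : F U),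
    hom_sect (res VU s) = res VU (hom_sect s) }.

Arguments hom_sect {T F G} f U s : rename.

Section Cohomology.
Variable T : topologicalType.
Implicit Types F G H J : sheaf T.

HB.instance Definition _ F G (f : sheaf_hom F G) U :=
  GRing.isZmodMorphism.Build (F U) (G U) (f U) (@hom_zmod _ _ _ f U).

Definition sheaf_mono F G (f : sheaf_hom F G) :=
  forall U (s : F U), f U s = 0 -> s = 0.

Definition sheaf_exact F G H (f : sheaf_hom F G) (g : sheaf_hom G H) :=
  forall U (s : G U), g U s = 0 <->
    forall x, oset U x -> exists (V : opens T) (VU : V `<=` U),
      oset V x /\ exists t : F V, f V t = res VU s.

(* Injective object of the category of sheaves of abelian groups on T. *)
Definition injective_sheaf J :=
  forall F G (i : sheaf_hom F G) (f : sheaf_hom F J), sheaf_mono i ->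
    exists h : sheaf_hom G J, forall U s, h U (i U s) = f U s.

Record injective_resolution F := InjectiveResolution {
  ires :> nat -> sheaf T;
  ires_inj : forall n, injective_sheaf (ires n);
  iaug : sheaf_hom F (ires 0);
  idiff : forall n, sheaf_hom (ires n) (ires n.+1);
  iaug_mono : sheaf_mono iaug;
  iaug_exact : sheaf_exact iaug (idiff 0);
  idiff_exact : forall n, sheaf_exact (idiff n) (idiff n.+1) }.

End Cohomology.

Section Homology.
Variables (A B C : zmodType) (f : {additive A -> B}) (g : {additive B -> C}).

Definition ker_pred : {pred B} := fun b => g b == 0.

Lemma ker_zmod_closed : zmod_closed ker_pred.
Proof.
split=> [|x y]; rewrite !unfold_in /ker_pred ?raddf0 //.
by rewrite raddfB => /eqP -> /eqP ->; rewrite subrr.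
Qed.

HB.instance Definition _ := GRing.isZmodClosed.Build B ker_pred ker_zmod_closed.

Record cycles := Cycle { cycle_val :> B; _ : cycle_val \in ker_pred }.

HB.instance Definition _ := [isSub for cycle_val].
HB.instance Definition _ := [Choice of cycles by <:].
HB.instance Definition _ := [SubChoice_isSubZmodule of cycles by <:].

Definition boundary_pred : {pred cycles} :=
  fun z => `[< exists a, f a = z :> B >].

Lemma boundary_zmod_closed : zmod_closed boundary_pred.
Proof.
split; first by apply/asboolP; exists 0; rewrite !raddf0.
move=> x y /asboolP[a ax] /asboolP[b bx]; apply/asboolP; exists (a - b).
by rewrite raddfB ax bx.
Qed.

HB.instance Definition _ :=
  GRing.isZmodClosed.Build cycles boundary_pred boundary_zmod_closed.

Definition homology : zmodType := Quotient.quot boundary_pred.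

End Homology.

Definition setTo (T : topologicalType) : opens T := Opens (@openT T).

(* H^1 is the first right derived functor of global sections. It is computed by
   any injective resolution J, so J is kept as a parameter. *)
Definition sheaf_H1 (T : topologicalType) (F : sheaf T)
    (J : injective_resolution F) : zmodType :=
  homology (idiff J 0 (setTo T)) (idiff J 1 (setTo T)).

(* The tensor product over the integers: the free abelian group on M * N modulo
   the bilinearity relations. *)
Section Tensor.
Variables M N : zmodType.

Definition subgroup (V : zmodType) : set (set V) :=
  [set S | S 0 /\ forall x y, S x -> S y -> S (x - y)].

Definition tensor_rels : set {malg int[(M * N)%type]} :=
  [set r | (exists m m' n, r = << (m + m', n) >> - << (m, n) >> - << (m', n) >>)
        \/ (exists m n n', r = << (m, n + n') >> - << (m, n) >> - << (m, n') >>)].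

Definition tensor_pred : {pred {malg int[(M * N)%type]}} :=
  fun t => `[< smallest (@subgroup _) tensor_rels t >].

Lemma tensor_zmod_closed : zmod_closed tensor_pred.
Proof.
split; first by apply/asboolP => S [[]].
move=> x y /asboolP Hx /asboolP Hy; apply/asboolP => S HS.
by case: (HS) => -[_ SB] _; apply: SB; [exact: Hx | exact: Hy].
Qed.

HB.instance Definition _ := GRing.isZmodClosed.Build _ tensor_pred tensor_zmod_closed.

Definition tensorZ : zmodType := Quotient.quot tensor_pred.

End Tensor.

(* An integral separated scheme with function field K is given, as in Zariski's
   models, by its local rings inside K: its points are the localizations at
   primes of the affine coordinate rings (charts), two points being equal iff
   their local rings are, and its topology is glued from the spectra of the
   charts. Subrings, ideals and local rings are subsets of K. *)
Section Models.
Variable K : fieldType.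
Implicit Types (A C P R S : set K).

Definition is_subring : set (set K) :=
  [set A | [/\ A 1, forall x y, A x -> A y -> A (x - y)
             & forall x y, A x -> A y -> A (x * y)]].

Definition is_ideal A : set (set K) :=
  [set P | [/\ P `<=` A, P 0, forall x y, P x -> P y -> P (x - y)
             & forall a x, A a -> P x -> P (a * x)]].

Definition is_prime A : set (set K) :=
  [set P | [/\ is_ideal A P, ~ P 1
             & forall x y, A x -> A y -> P (x * y) -> P x \/ P y]].

Definition localization A P : set K :=
  [set z | exists a s, [/\ A a, A s, ~ P s & z = a / s]].

Definition dominates R S :=
  S `<=` R /\ forall a, S a -> R a^-1 -> S a^-1.

Definition is_unit R : set K := [set u | [/\ u != 0, R u & R u^-1]].

Definition uniformizer R : set K :=
  [set t | [/\ t != 0, R t, ~ R t^-1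
     & forall a, a != 0 -> exists (n : int) u, is_unit R u /\ a = u * t ^ n]].

(* On a regular scheme the points of codimension 1, that is the prime divisors,
   are exactly the points whose local ring is a discrete valuation ring. *)
Definition is_dvr R := exists t, uniformizer R t.

(* The normalised valuation of a nonzero element when R is a discrete valuation
   ring, and junk otherwise; xget picks a uniformizer. *)
Definition ord R (a : K) : int :=
  xget 0 [set n | exists u, is_unit R u /\ a = u * xget 0 (uniformizer R) ^ n].

Record model := Model {
  charts :> set (set K);
  charts_subring : charts `<=` is_subring;
  charts_frac : forall C, charts C ->
    forall x, exists a b, [/\ C a, C b, b != 0 & x = a / b] }.

Record point (X : model) := Point {
  stalk : set K;
  stalkP : exists C P, [/\ charts X C, is_prime C P & stalk = localization C P] }.

Section Topology.
Variable X : model.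

HB.instance Definition _ := gen_eqMixin (point X).
HB.instance Definition _ := gen_choiceMixin (point X).

Definition model_open : set (set (point X)) :=
  [set U | forall C P (x : point X), charts X C -> is_prime C P ->
     stalk x = localization C P -> U x ->
     exists h, [/\ C h, ~ P h & forall Q (y : point X), is_prime C Q -> ~ Q h ->
       stalk y = localization C Q -> U y]].

Let model_openT : model_open setT.
Proof.
move=> C P x XC [[_ _ _ _] P1 _] _ _; exists 1; split=> //.
by have [] := charts_subring XC.
Qed.

Let model_openI : setI_closed model_open.
Proof.
move=> U V oU oV C P x XC prP xP [Ux Vx].
have [h [Ch Ph hU]] := oU _ _ _ XC prP xP Ux.
have [g [Cg Pg gV]] := oV _ _ _ XC prP xP Vx.
have [C1 CB CM] := charts_subring XC.
exists (h * g); split; first exact: CM.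
  by case: prP => _ _ prm /(prm _ _ Ch Cg)[].
move=> Q y prQ Qhg yQ; have [[_ _ _ QM] _ _] := prQ; split.
  by apply: (hU Q) => // Qh; apply: Qhg; rewrite mulrC; exact: QM.
by apply: (gV Q) => // Qg; apply: Qhg; exact: QM.
Qed.

Let model_open_bigU (I : Type) (f : I -> set (point X)) :
  (forall i, model_open (f i)) -> model_open (\bigcup_i f i).
Proof.
move=> of_ C P x XC prP xP [i _ fx].
have [h [Ch Ph hf]] := of_ i _ _ _ XC prP xP fx.
by exists h; split=> // Q y prQ Qh yQ; exists i => //; exact: (hf Q).
Qed.

HB.instance Definition _ := isOpenTopological.Build (point X)
  model_openT model_openI model_open_bigU.

Lemma is_prime0 C : charts X C -> is_prime C [set 0].
Proof.
move=> XC; have [C1 CB CM] := charts_subring XC; split.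
- split=> //= [_ ->|_ _ -> ->|a _ _ ->]; rewrite ?subr0 ?mulr0 //.
  by rewrite -(subrr 1); exact: CB.
- by move/eqP; rewrite oner_eq0.
- move=> x y _ _ /= /eqP; rewrite mulf_eq0 => /orP[]/eqP; by [left|right].
Qed.

Lemma localization0 C : charts X C -> localization C [set 0] = setT.
Proof.
move=> XC; apply/seteqP; split=> // x _.
have [a [b [Ca Cb b0 ->]]] := charts_frac XC x.
by exists a, b; split=> //; apply/eqP.
Qed.

Lemma opens_meet (U V : opens (point X)) x y :
  oset U x -> oset V y -> exists z, oset U z /\ oset V z.
Proof.
have gen W w : oset W w -> exists C, exists XC : charts X C, forall z : point X,
    stalk z = setT -> oset W z.
  move=> Ww; have [C [P [XC prP wP]]] := stalkP w; exists C, XC => z zT.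
  have [h [Ch Ph hW]] := (oset_open W : model_open W) _ _ _ XC prP wP Ww.
  apply: (hW [set 0]) => //; first exact: is_prime0.
    by move=> h0; apply: Ph; case: prP => -[_ P0 _ _] _ _; rewrite h0.
  by rewrite localization0.
move=> /gen[C [XC HU]] /gen[_ [_ HV]].
have zP : exists C P, [/\ charts X C, is_prime C P & setT = localization C P].
  by exists C, [set 0]; rewrite localization0 //; split=> //; exact: is_prime0.
by exists (Point zP); split; [exact: HU | exact: HV].
Qed.

Lemma stalk_subring (x : point X) : is_subring (stalk x).
Proof.
have [C [P [XC prP ->]]] := stalkP x.
have [C1 CB CM] := charts_subring XC; have [[_ P0 _ _] P1 prm] := prP.
have nz s : ~ P s -> s != 0 by move=> Ps; apply/eqP => s0; apply: Ps; rewrite s0.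
split=> [|_ _ [a [s [Ca Cs Ps ->]]] [b [t [Cb Ct Pt ->]]]|
          _ _ [a [s [Ca Cs Ps ->]]] [b [t [Cb Ct Pt ->]]]].
- by exists 1, 1; split=> //; rewrite divr1.
- exists (a * t - b * s), (s * t); split.
  + by apply: CB; exact: CM.
  + exact: CM.
  + by move=> /(prm _ _ Cs Ct)[].
  + by have := nz _ Ps; have := nz _ Pt => t0 s0; field; rewrite s0 t0.
- exists (a * b), (s * t); split.
  + exact: CM.
  + exact: CM.
  + by move=> /(prm _ _ Cs Ct)[].
  + by rewrite invfM mulrACA.
Qed.

End Topology.

Lemma ord_uniq R a t n u : is_subring R -> uniformizer R t ->
  xget 0 (uniformizer R) = t -> is_unit R u -> a = u * t ^ n -> ord R a = n.
Proof.
move=> [R1 RB RM] [t0 Rt Rt1 _] Et [u0 Ru Ru1] Ea.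
have RX s m : R s -> R (s ^+ m).
  by move=> Rs; elim: m => [|m IH]; rewrite ?expr0 // exprS; exact: RM.
have H v w (i j : int) : is_unit R v -> is_unit R w -> v * t ^ i = w * t ^ j ->
    (i <= j)%R.
  move=> [v0 Rv Rv1] [w0 Rw Rw1] E.
  rewrite Order.TotalTheory.leNgt; apply/negP => ji.
  have [m Em] : exists m : nat, i - j = m.+1%:Z.
    have : 0 < i - j by rewrite Num.Theory.subr_gt0.
    by case: (i - j) => [[|m]|m] // _; exists m.
  have Ew : t ^ (i - j) = w / v.
    rewrite expfzDr // -invr_expz; apply/eqP.
    have tj0 : t ^ j != 0 by rewrite expfz_neq0.
    by rewrite eqr_div // [_ * v]mulrC E.
  apply: Rt1; suff -> : t^-1 = t ^+ m * (v * w^-1).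
    exact: RM (RX _ _ Rt) (RM _ _ Rv Rw1).
  have -> : v * w^-1 = (w / v)^-1 by rewrite invfM invrK mulrC.
  by rewrite -Ew Em -exprnP exprS invfM mulrCA divff ?mulr1 // expf_neq0.
apply: xget_unique => [|m]; rewrite /= Et; first by exists u.
move=> [w [wU Ew]]; apply/eqP; rewrite Order.POrderTheory.eq_le.
by rewrite (H w u) ?(H u w) // -?Ea -?Ew.
Qed.

End Models.

Section WittDivisorial.
Variables (p : nat) (p_pr : prime p) (K : fieldType) (X : model K).
(* A Weil divisor, given by its multiplicities; only its values at prime divisors
   matter. *)
Variable E : point X -> int.
Local Notation W := (witt p_pr K).

(* Over a nonempty U the sections are Witt vectors of K. The formula puts no
   condition on them over the empty set, where a sheaf must vanish, hence the
   first clause. *)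
Definition WO_pred (U : opens (point X)) : {pred W} := fun a => `[<
  ((U : set (point X)) = set0 -> a = 0) /\
  forall x, oset U x -> is_dvr (stalk x) ->
    forall i, a i != 0 -> 0 <= ord (stalk x) (a i) + (p ^ i)%:Z * E x >].

Let ieval_closed (I : choiceType) (R : set K) (a : I -> K) P : is_subring R ->
  (forall i, R (a i)) -> R (ieval a P).
Proof.
move=> [R1 RB RM] Ra.
have R0 : R 0 by rewrite -(subrr 1); exact: RB.
have RN x : R x -> R (- x) by move=> Rx; rewrite -sub0r; exact: RB.
have RD x y : R x -> R y -> R (x + y).
  by move=> Rx Ry; rewrite -[y]opprK; exact: RB _ _ Rx (RN _ Ry).
have Rn n : R n%:R.
  by elim: n => [|n IH]; rewrite ?mulr0n // -natr1; exact: RD.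
rewrite /ieval /mmap; apply: (big_ind R) => // m _; apply: (RM).
  by case: (P@_m) => n; rewrite ?NegzE ?mulrNz; [|apply: (RN)]; exact: Rn.
rewrite /cmeval; apply: (big_ind R) => // i _.
by elim: (m i) => [|n IH]; rewrite ?expr0 // exprS; exact: RM.
Qed.

Lemma WO_stalkP (x : point X) (a : W) : is_dvr (stalk x) ->
  (forall i, a i != 0 -> 0 <= ord (stalk x) (a i) + (p ^ i)%:Z * E x) <->
  (forall i, stalk x (wscale p (xget 0 (uniformizer (stalk x)) ^ E x) a i)).
Proof.
move=> /cid[t0 t0P]; set t := xget _ _.
have tP : uniformizer (stalk x) t by exact: (xgetPex _ (ex_intro _ _ t0P)).
have sR := stalk_subring x; have [R1 RB RM] := sR.
have [tn0 Rt Rt1 tgen] := tP.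
have R0 : stalk x 0 by rewrite -(subrr 1); exact: RB.
have RX s m : stalk x s -> stalk x (s ^+ m).
  by move=> Rs; elim: m => [|m IH]; rewrite ?expr0 // exprS; exact: RM.
have key i : a i != 0 ->
    0 <= ord (stalk x) (a i) + (p ^ i)%:Z * E x <->
    stalk x (wscale p (t ^ E x) a i).
  move=> ai0; have [n [u [uU Ea]]] := tgen _ ai0.
  have [u0 Ru Ru1] := uU.
  have -> : ord (stalk x) (a i) = n by exact: (ord_uniq sR tP erefl uU Ea).
  have -> : wscale p (t ^ E x) a i = u * t ^ (n + (p ^ i)%:Z * E x).
    rewrite /wscale {1}Ea expfzDr // mulrCA; congr (_ * _).
    by rewrite mulrC exprnP exprz_exp [E x * _]mulrC.
  case: (n + _) => m.
    by split=> // _; rewrite -exprnP; exact: RM _ _ Ru (RX _ _ Rt).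
  split=> //; rewrite NegzE => Rut; exfalso; apply: Rt1.
  have -> : t^-1 = t ^+ m * (u^-1 * (u * t ^ (- m.+1%:Z))).
    by rewrite mulKf // -invr_expz -exprnP exprS invfM mulrCA divff ?mulr1 // expf_neq0.
  exact: RM _ _ (RX _ _ Rt) (RM _ _ Ru1 Rut).
split=> H i; last by move=> ai0; apply/key.
have [ai0|ai0] := eqVneq (a i) 0; first by rewrite /wscale ai0 mulr0.
by apply/key => //; exact: H.
Qed.

Lemma WO_zmod_closed (U : opens (point X)) : zmod_closed (WO_pred U).
Proof.
split.
  by apply/asboolP; split=> // x _ _ i; rewrite eqxx.
move=> a b /asboolP[a0 aU] /asboolP[b0 bU]; apply/asboolP; split.
  by move=> U0; rewrite a0 // b0 // subrr.
move=> x Ux dx; have sR := stalk_subring x.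
have /(WO_stalkP _ dx) Ha := aU x Ux dx; have /(WO_stalkP _ dx) Hb := bU x Ux dx.
apply/(WO_stalkP _ dx) => i.
set c := _ ^ E x in Ha Hb *.
have -> : wscale p c (a - b) = wadd p (wscale p c a) (wopp p (wscale p c b)).
  by rewrite -wscaleN // -wscaleD.
apply: ieval_closed => // -[[] j] //=; exact: ieval_closed.
Qed.

HB.instance Definition _ U :=
  GRing.isZmodClosed.Build W (WO_pred U) (WO_zmod_closed U).

Record WO_sect (U : opens (point X)) := WOSect {
  WO_val :> W;
  WO_valP : WO_val \in WO_pred U }.

HB.instance Definition _ U := [isSub for @WO_val U].
HB.instance Definition _ U := [Choice of WO_sect U by <:].
HB.instance Definition _ U := [SubChoice_isSubZmodule of WO_sect U by <:].

Lemma WO_res_subproof (U V : opens (point X)) (VU : V `<=` U) (s : WO_sect U) :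
  (if `[< (V : set (point X)) = set0 >] then 0 else WO_val s) \in WO_pred V.
Proof.
apply/asboolP; case: asboolP => [V0|V0].
  by split=> // x _ _ i; rewrite eqxx.
split=> // x Vx; have /asboolP[_ sU] := WO_valP s.
exact: sU (VU _ Vx).
Qed.

Definition WO_res (U V : opens (point X)) (VU : V `<=` U) (s : WO_sect U) :
  WO_sect V := WOSect (WO_res_subproof VU s).

Lemma WO_sect_inj U : injective (@WO_val U).
Proof. exact: val_inj. Qed.

Lemma WO_val0 U (s : WO_sect U) : (U : set (point X)) = set0 -> s = 0.
Proof.
by move=> U0; apply: WO_sect_inj; have /asboolP[-> //] := WO_valP s.
Qed.

Lemma WO_resE (U V : opens (point X)) (VU : V `<=` U) s x :
  oset V x -> WO_val (WO_res VU s) = WO_val s.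
Proof.
by move=> Vx /=; case: asboolP => // V0; move: Vx; rewrite V0.
Qed.

Lemma WO_res_zmod (U V : opens (point X)) (VU : V `<=` U) : zmod_morphism (WO_res VU).
Proof.
move=> s t; apply: WO_sect_inj => /=; case: asboolP => // _.
by rewrite subrr.
Qed.

Lemma WO_res_id (U : opens (point X)) (UU : U `<=` U) s : WO_res UU s = s.
Proof.
apply: WO_sect_inj => /=; case: asboolP => // U0.
by rewrite (WO_val0 s U0).
Qed.

Lemma WO_res_res (U V Z : opens (point X)) (VU : V `<=` U) (ZV : Z `<=` V)
  (ZU : Z `<=` U) s : WO_res ZV (WO_res VU s) = WO_res ZU s.
Proof.
apply: WO_sect_inj => /=; case: asboolP => // Z0; case: asboolP => // V0.
by exfalso; apply: Z0; rewrite -subset0 -V0.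
Qed.

Lemma WO_separated (U : opens (point X)) (C : set (opens (point X)))
    (s : WO_sect U) : (U : set (point X)) = \bigcup_(V in C) V ->
  (forall (V : opens (point X)) (VU : V `<=` U), C V -> WO_res VU s = 0) -> s = 0.
Proof.
move=> UC sC; have [U0|/set0P[x Ux]] := eqVneq (U : set (point X)) set0.
  exact: WO_val0.
have [V CV Vx] : (\bigcup_(V in C) (V : set (point X))) x by rewrite -UC.
have VU : V `<=` U by rewrite UC => y Vy; exists V.
by apply: WO_sect_inj; rewrite -(WO_resE VU s Vx) sC.
Qed.

Lemma WO_glue (U : opens (point X)) (C : set (opens (point X)))
    (s : forall V, WO_sect V) : (U : set (point X)) = \bigcup_(V in C) V ->
  (forall (V V' Z : opens (point X)) (ZV : Z `<=` V) (ZV' : Z `<=` V'),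
     C V -> C V' -> WO_res ZV (s V) = WO_res ZV' (s V')) ->
  exists t : WO_sect U,
    forall (V : opens (point X)) (VU : V `<=` U), C V -> WO_res VU t = s V.
Proof.
move=> UC sC; have [U0|/set0P[x Ux]] := eqVneq (U : set (point X)) set0.
  exists 0 => V VU CV.
  have V00 : (V : set (point X)) = set0 by rewrite -subset0 -U0.
  exact: etrans (WO_val0 _ V00) (esym (WO_val0 _ V00)).
have [V0 CV0 V0x] : (\bigcup_(V in C) (V : set (point X))) x by rewrite -UC.
have eqV (V : opens (point X)) y : C V -> oset V y -> WO_val (s V) = WO_val (s V0).
  move=> CV Vy; have [z [Vz V0z]] := opens_meet Vy V0x.
  pose Z := Opens (openI (oset_open V) (oset_open V0)).
  have ZV : Z `<=` V by move=> ? [].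
  have ZV0 : Z `<=` V0 by move=> ? [].
  have Zz : oset Z z by split.
  by rewrite -(WO_resE ZV (s V) Zz) -(WO_resE ZV0 (s V0) Zz) (sC _ _ _ ZV ZV0).
have tP : WO_val (s V0) \in WO_pred U.
  apply/asboolP; split=> [U0|y Uy]; first by move: Ux; rewrite U0.
  have [V CV Vy] : (\bigcup_(V in C) (V : set (point X))) y by rewrite -UC.
  by rewrite -(eqV V y) //; have /asboolP[_] := WO_valP (s V); apply.
exists (WOSect tP) => V VU CV.
have [V00|/set0P[y Vy]] := eqVneq (V : set (point X)) set0.
  exact: etrans (WO_val0 _ V00) (esym (WO_val0 _ V00)).
by apply: WO_sect_inj; rewrite (WO_resE VU _ Vy) (eqV V y).
Qed.

Definition WO : sheaf (point X) :=
  Sheaf WO_res_zmod WO_res_id WO_res_res WO_separated WO_glue.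

End WittDivisorial.

Lemma fraction_repr (R : idomainType) (x : {fraction R}) :
  exists q r : R, x = FracField.tofrac q / FracField.tofrac r.
Proof.
have d0 := denom_ratioP (repr x).
exists \n_(repr x), \d_(repr x).
apply: (canRL (mulfK _)); first by rewrite tofrac_eq0.
rewrite -[x in LHS]reprK; unlock FracField.tofrac.
rewrite [LHS](esym (FracField.pi_mul _ _)); apply/eqmodP => /=.
rewrite FracField.equivfE /FracField.mulf !numden_Ratio ?oner_neq0 ?mulr1 //=.
by rewrite reprK mulrC.
Qed.

Lemma frac_of_closed (K : fieldType) (A F : set K) : is_subring A ->
  F = [set y | exists a b, [/\ A a, A b, b != 0 & y = a / b]] ->
  [/\ A `<=` F, forall y z, F y -> F z -> F (y + z),
      forall y z, F y -> F z -> F (y * z) & forall y, F y -> F y^-1].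
Proof.
move=> [A1 AB AM] ->.
have A0 : A 0 by rewrite -(subrr 1); exact: AB.
have AN y : A y -> A (- y) by move=> Ay; rewrite -sub0r; exact: AB.
have AD y z : A y -> A z -> A (y + z).
  by move=> Ay Az; rewrite -[z]opprK; exact: AB _ _ Ay (AN _ Az).
split=> [y Ay|_ _ [a [b [Aa Ab b0 ->]]] [c [d [Ac Ad d0 ->]]]
            |_ _ [a [b [Aa Ab b0 ->]]] [c [d [Ac Ad d0 ->]]]
            |_ [a [b [Aa Ab b0 ->]]]].
- by exists y, 1; rewrite oner_neq0 divr1.
- exists (a * d + c * b), (b * d); rewrite mulf_neq0 // addf_div //.
  by split=> //; [apply: AD|]; exact: AM.
- exists (a * c), (b * d); rewrite mulf_neq0 // invfM mulrACA.
  by split=> //; exact: AM.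
- have [->|a0] := eqVneq a 0.
    by exists 0, 1; rewrite oner_neq0 mul0r invr0 mul0r.
  by exists b, a; split=> //; rewrite invfM invrK mulrC.
Qed.

(* The function field k(x_1/x_0, x_2/x_0) of the projective plane with homogeneous
   coordinates x_0, x_1, x_2. *)
Definition P2_field (k : fieldType) : fieldType := {fraction {poly {poly k}}}.

Section Blowup.
Variable k : fieldType.
Local Notation K := (P2_field k).
Local Notation tofrac := (@FracField.tofrac {poly {poly k}}).

Definition kcst (c : k) : K := tofrac c%:P%:P.

(* The image of x_i in K after setting x_0 = 1; only the quotients
   hcoord i / hcoord j = x_i / x_j have an intrinsic meaning. *)
Definition hcoord (i : 'I_3) : K :=
  tofrac (([:: 1; 'X%:P; 'X] : seq {poly {poly k}})`_i).

Definition subring_gen (S : set K) : set K := smallest (@is_subring K) S.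

(* For a subring S of the subfield F_2(x_1/x_0, x_2/x_0) of K, the canonical map
   from the tensor product of S and k over F_2 to K is injective; its image is
   the subring generated by S and k. *)
Definition base_change (S : set K) : set K :=
  subring_gen (range kcst `|` S).

(* The coordinate ring F_2[x_0/x_j, x_1/x_j, x_2/x_j] of the j-th standard chart
   of P^2 over F_2 (F_2 is the prime subring of K). *)
Definition F2chart (j : 'I_3) : set K :=
  subring_gen (range (fun i => hcoord i / hcoord j)).

(* The F_2-points of P^2 are the nonzero vectors a of F_2^3, because 1 is the only
   unit of F_2; in the j-th chart, which contains a iff a_j = 1, the affine
   coordinates of a are the a_i. *)
Definition F2point_eqs (j : 'I_3) (a : 'rV['F_2]_3) : set K :=
  range (fun i => hcoord i / hcoord j - (a 0 i : nat)%:R).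

(* The ideal in the j-th chart of the reduced subscheme of all F_2-points. *)
Definition F2points_ideal (j : 'I_3) : set K :=
  [set g | F2chart j g /\ forall a : 'rV['F_2]_3, a 0 j != 0 ->
     smallest (is_ideal (F2chart j)) (F2point_eqs j a) g].

(* The blowup of Spec A along I is covered by the spectra of the A[I/f], for f
   nonzero in I. *)
Definition blowup_algebra (A I : set K) (f : K) : set K :=
  subring_gen (A `|` [set g / f | g in I]).

Definition blowup_charts : set (set K) :=
  [set C | exists j f, [/\ F2points_ideal j f, f != 0
    & C = base_change (blowup_algebra (F2chart j) (F2points_ideal j) f)]].

Definition P2chart (j : 'I_3) : set K := base_change (F2chart j).

(* The local ring of P^2 over k at the F_2-point a; the members of the union all
   coincide. *)
Definition P2_F2stalk (a : 'rV['F_2]_3) : set K :=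
  \bigcup_(j in [set j | a 0 j != 0])
    localization (P2chart j) (smallest (is_ideal (P2chart j)) (F2point_eqs j a)).

Lemma subring_genP S : is_subring (subring_gen S).
Proof.
split=> [M [[]] //|x y Hx Hy M HM|x y Hx Hy M HM];
  have [[M1 MB MM] _] := HM; [apply: MB|apply: MM];
  by [exact: Hx | exact: Hy].
Qed.

Lemma sub_subring_gen S : S `<=` subring_gen S.
Proof. by move=> x Sx M [_]; apply. Qed.

Lemma blowup_charts_subring : blowup_charts `<=` @is_subring K.
Proof. by move=> C [j [f [_ _ ->]]]; exact: subring_genP. Qed.

Lemma blowup_charts_frac C : blowup_charts C ->
  forall x, exists a b, [/\ C a, C b, b != 0 & x = a / b].
Proof.
move=> [j [f [_ _ ->]]]; set A := base_change _ => x.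
have Ac c : A (kcst c) by apply: sub_subring_gen; left; exists c.
have Au i : A (hcoord i / hcoord j).
  apply: sub_subring_gen; right; apply: sub_subring_gen; left.
  by apply: sub_subring_gen; exists i.
have h0 i : hcoord i != 0.
  rewrite /hcoord tofrac_eq0.
  case: i => -[|[|[|//]]] ? /=;
    by rewrite ?oner_neq0 ?polyC_eq0 ?polyX_eq0.
set F := [set y | exists a b, [/\ A a, A b, b != 0 & y = a / b]].
have [FA FD FM FV] := frac_of_closed (subring_genP _ : is_subring A) (erefl F).
suff : F x by [].
have A0 : A 0.
  by have [A1 AB _] : is_subring A := subring_genP _; rewrite -(subrr 1); exact: AB.
have Fh i : F (hcoord i).
  have -> : hcoord i = (hcoord i / hcoord j) * (hcoord 0 / hcoord j)^-1.
    have -> : hcoord 0 = 1 by rewrite /hcoord /= tofrac1.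
    by rewrite invfM invrK invr1 mul1r divfK.
  by apply: FM; [|apply: FV]; exact: FA.
have Fp1 (q : {poly k}) : F (tofrac q%:P).
  elim/poly_ind: q => [|q c IH]; first by rewrite polyC0 tofrac0; exact: (FA _ A0).
  rewrite polyCD polyCM tofracD tofracM; apply: FD; last exact: FA (Ac c).
  by apply: FM => //; exact: (Fh 1).
have Fp2 (q : {poly {poly k}}) : F (tofrac q).
  elim/poly_ind: q => [|q c IH]; first by rewrite tofrac0; exact: (FA _ A0).
  rewrite tofracD tofracM; apply: FD; last exact: Fp1.
  by apply: FM => //; exact: (Fh 2).
suff [q [r ->]] : exists q r : {poly {poly k}}, x = (tofrac q) / (tofrac r).
  by apply: FM; [|apply: FV]; exact: Fp2.
by have [q [r ->]] := fraction_repr x; exists q, r.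
Qed.

Definition blowup_P2 : model K := Model blowup_charts_subring blowup_charts_frac.

Local Notation X := blowup_P2.

(* The morphism f to P^2 maps x to the point whose local ring is dominated by that
   of x; the exceptional curve over a is the only prime divisor mapping to a. *)
Definition exceptional_curve (a : 'rV['F_2]_3) : point X -> int :=
  fun x => `[< dominates (stalk x) (P2_F2stalk a) >]%:Z.

Definition linear_form (l : 'rV[k]_3) : K :=
  \sum_i kcst (l 0 i) * hcoord i.

(* Multiplicities of the pullback of the line l = 0: if f(x) lies in the j-th chart,
   this line has the local equation l / x_j there. *)
Definition pullback_line (l : 'rV[k]_3) : point X -> int :=
  fun x => xget 0 [set n | exists j, P2chart j `<=` stalk x /\
    n = ord (stalk x) (linear_form l / hcoord j)].

Definition divisor_B (l : 'rV[k]_3) : point X -> int := fun x =>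
  5 * pullback_line l x - 2 * \sum_(a : 'rV['F_2]_3 | a != 0) exceptional_curve a x.

End Blowup.

(* Main.v *)
From mathcomp Require Import all_boot all_order all_algebra finmap.
From mathcomp Require Import boolp classical_sets topology generic_quotient ring_quotient.
From mathcomp.multinomials Require Import monalg.
From mathcomp Require Import ring zify.
Require Import Defs.
(** Let K = k(X, Y) be the function field, where X = x_1/x_0 and Y = x_2/x_0, and
write F for WO(-B).

The cohomology class comes from a cover by two opens U1 and U2 and a Witt vector w0 of
K that is a section of F over their intersection. If N times the class vanishes, then there
is a section w of F over U2 such that w - N w0 is a section over U1 ([WO_H1_class]). If this
is impossible for all N > 0, then the class is not torsion and survives in the tensor product
with Q ([tensor_rat_neq0]).

The strict transforms of the seven F_2-lines are disjoint on the blowup, and 2B is linearly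
equivalent to their sum plus an anticanonical divisor, for which the three lines through one
point together with twice its exceptional curve can be taken: up to linear equivalence, 2B is
effective with disconnected support. A variant of this decomposition is given by the function
h = l^10 / ((X (X - 1))^3 Y), where l is the line in the definition of B. Relative to 2B it has
poles along the line L: Y = 0, and along the three F_2-lines through P = (0 : 0 : 1) together
with the exceptional curve over P; the latter curves are connected and disjoint from L. Let U2
be the complement of L and U1 a neighbourhood of L that avoids the other poles ([open_cover]).
On the intersection, h is a section of O(2B) (see [transition_bound]), hence
w0 = (0, h, 0, 0, ...), the Verschiebung of the Teichmueller representative of h, is a section
of F.

In characteristic 2, multiplication by 2 is Verschiebung after Frobenius, so the first nonzero
component of N w0 is h^(2^n), in position n + 1 for some n ([witt_mulrn_lead]). A relation
w = s + N w0 with w a section over U2 and s a section over U1 would give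
w_(n+1) = s_(n+1) + h^(2^n). Let q be the quotient of w_(n+1) by h^(2^n). Both w_(n+1) and s_(n+1)
are bounded by a multiple of -2B, so they vanish along the poles of h after division by h^(2^n):
on U1 the function q - 1 is regular and vanishes along L, and on U2 the function q vanishes along
the exceptional curve over P. This is contradictory by restriction to the generic fibre of the
projection from P, a projective line over k(X): its point at infinity is the exceptional curve over
P, all other points lie in U1, and one of them is L. So q is a regular function on this line that
is 0 at infinity and 1 on L ([regular_fibre_eq0], [no_global_section]).

What remains is to know the blowup well enough. Its local rings are described by
[blowup_point_gen], from which the cover follows; the order of a local parameter along an
exceptional curve is 1 by [ord_exceptional]; and [dominates_F2stalk] and [not_dominates] decide which
points lie over which F_2-point, that is where the exceptional part of B is supported. *)

Set Implicit Arguments.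
Unset Strict Implicit.
Unset Printing Implicit Defensive.
Import Order.TTheory GRing.Theory Num.Theory.
Local Open Scope ring_scope.
Local Open Scope quotient_scope.
Local Open Scope classical_set_scope.

(** * Tensoring with the rationals *)

Section TensorRat.
Variable M : zmodType.
Implicit Types (t : {malg int[(M * rat)%type]}) (N : nat).

(** For N a common multiple of the denominators occurring in [t], this is N times
the image of [t] under the map m (x) r |-> r m, computed inside M. *)
Definition scaled_num N t : M :=
  \sum_(x <- msupp t) x.1 *~ (t@_x * numq (x.2 * N%:R)).

Lemma scaled_numw N t (d : {fset M * rat}) : (msupp t `<=` d)%fset ->
  scaled_num N t = \sum_(x <- d) x.1 *~ (t@_x * numq (x.2 * N%:R)).
Proof.
move=> le; rewrite /scaled_num (big_fset_incl _ le) //= => x _.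
by move/mcoeff_outdom => ->; rewrite mul0r mulr0z.
Qed.

Lemma scaled_numB N t1 t2 : scaled_num N (t1 - t2) = scaled_num N t1 - scaled_num N t2.
Proof.
rewrite (scaled_numw N (msuppB_le t1 t2)).
rewrite (scaled_numw N (fsubsetUl (msupp t1) (msupp t2))).
rewrite (scaled_numw N (fsubsetUr (msupp t1) (msupp t2))).
rewrite -sumrB; apply: eq_bigr => x _.
by rewrite mcoeffB mulrBl mulrzBr.
Qed.

Lemma scaled_numU N x : scaled_num N << x >> = x.1 *~ numq (x.2 * N%:R).
Proof. by rewrite (scaled_numw N msuppU_le) big_seq_fset1 mcoeffUU mul1r. Qed.

Lemma numqD_den (r s : rat) N :
  (`|denq r| * `|denq s| %| N)%N ->
  numq ((r + s) * N%:R) = numq (r * N%:R) + numq (s * N%:R).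
Proof.
have H (q : rat) : (`|denq q| %| N)%N -> exists z : int, q * N%:R = z%:~R.
  case/dvdnP => n ->; exists (numq q * n%:Z).
  rewrite -{1}(divq_num_den q) natrM -[X in _ * (_ * X)]/((`|denq q|%N : int)%:~R).
  rewrite absz_denq intrM mulrCA mulrC divfK // intr_eq0.
  exact: denq_neq0.
move=> dv.
have [z1 E1] := H r (dvdn_trans (dvdn_mulr _ (dvdnn _)) dv).
have [z2 E2] := H s (dvdn_trans (dvdn_mull _ (dvdnn _)) dv).
by rewrite mulrDl E1 E2 -intrD !numq_int.
Qed.

(** The kernel of M -> M (x) Q is the torsion of M. The elements of the free group
whose numerators, scaled by every large enough multiple N of the denominators, sum to
0 in M form a subgroup that contains the bilinearity relations; the generator (m, 1)
is not in it, because its scaled sum is N m. *)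
Lemma tensor_rat_neq0 (m : M) : (forall n, (0 < n)%N -> m *+ n != 0) ->
  exists t : tensorZ M rat, t != 0.
Proof.
move=> m_tf; exists (\pi << (m, 1) >>).
have -> : (0 : tensorZ M rat) = \pi 0 by rewrite piE.
rewrite -Quotient.idealrBE subr0.
apply/negP => /asboolP.
move/(_ [set t | exists2 N0, (0 < N0)%N & forall N, (N0 %| N)%N -> scaled_num N t = 0]).
case=> [|N0 N0_gt0 /(_ N0 (dvdnn _))].
  split.
    split=> /=; first by exists 1%N => // N _; rewrite /scaled_num msupp0 big_seq_fset0.
    move=> x y [Nx Nx0 Hx] [Ny Ny0 Hy]; exists (Nx * Ny)%N => [|N dv].
      by rewrite muln_gt0 Nx0.
    rewrite scaled_numB Hx; last exact: dvdn_trans (dvdn_mulr _ (dvdnn _)) dv.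
    by rewrite Hy ?subrr //; exact: dvdn_trans (dvdn_mull _ (dvdnn _)) dv.
  move=> t /= [[m1 [m2 [r ->]]]|[m1 [r [s ->]]]].
    exists 1%N => // N _; rewrite !scaled_numB !scaled_numU /= mulrzDl.
    by rewrite addrAC addrK subrr.
  exists (`|denq r| * `|denq s|)%N => [|N dv].
    by rewrite muln_gt0 !absz_gt0 !denq_neq0.
  rewrite !scaled_numB !scaled_numU /= numqD_den // mulrzDr.
  by rewrite addrAC addrK subrr.
rewrite scaled_numU /= mul1r -[N0%:R]/((N0 : int)%:~R) numq_int => /eqP.
by apply/negP; exact: m_tf.
Qed.

End TensorRat.

(** * Leading terms of Witt vectors *)

Section WittLeadingTerm.

Section TorsionFree.
Variables (p : nat) (p_pr : prime p) (R : comNzRingType).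
Hypothesis tf : forall (x : R) n, (0 < n)%N -> x *+ n = 0 -> x = 0.

Lemma mulrn_inj (x y : R) n : (0 < n)%N -> x *+ n = y *+ n -> x = y.
Proof.
move=> n0 /eqP; rewrite -subr_eq0 -mulrnBl => /eqP/(tf n0)/eqP.
by rewrite subr_eq0 => /eqP.
Qed.

Lemma ghost_low (b : nat -> R) L n : (n < L)%N ->
  (forall i, (i < L)%N -> b i = 0) -> ghost p n b = 0.
Proof.
move=> nL b0; rewrite /ghost big1 // => i _.
rewrite b0; last by apply: leq_ltn_trans nL; rewrite -ltnS.
by rewrite expr0n gtn_eqF ?mul0rn // expn_gt0 prime_gt0.
Qed.

Lemma ghost_lead (b : nat -> R) L : (forall i, (i < L)%N -> b i = 0) ->
  ghost p L b = b L *+ p ^ L.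
Proof.
move=> b0; rewrite /ghost big_ord_recr /= subnn expr1 big1 ?add0r // => i _.
by rewrite b0 // expr0n gtn_eqF ?mul0rn // expn_gt0 prime_gt0.
Qed.

(** The ghost components of [b] before position L vanish and the one in position L is
p ^ L times the leading entry, so the entries of the sum can be compared one after the
other. *)
Lemma tf_wadd_lead (a b : nat -> R) L : (forall i, (i < L)%N -> b i = 0) ->
  (forall i, (i < L)%N -> wadd p a b i = a i) /\ wadd p a b L = a L + b L.
Proof.
move=> b0.
have pn n : (0 < p ^ n)%N by rewrite expn_gt0 prime_gt0.
have step n : (n <= L)%N -> (forall i, (i < n)%N -> wadd p a b i = a i) ->
    wadd p a b n *+ p ^ n = a n *+ p ^ n + ghost p n b.
  move=> nL H; have := ghost_wadd p_pr a b n.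
  rewrite {1 2}/ghost !big_ord_recr /= subnn !expr1.
  rewrite (eq_bigr (fun i : 'I_n => a i ^+ (p ^ (n - i)) *+ p ^ i)) => [|i _].
    by rewrite -addrA => /addrI.
  by rewrite H.
have low n : (n < L)%N -> wadd p a b n = a n.
  elim/ltn_ind: n => n IH nL; apply: (mulrn_inj (pn n)).
  rewrite step ?(ltnW nL) ?(ghost_low nL b0) ?addr0 // => i ni.
  by apply: IH => //; exact: ltn_trans nL.
split=> //; apply: (mulrn_inj (pn L)).
by rewrite step // (ghost_lead b0) -mulrnDl.
Qed.

End TorsionFree.

(** On vectors that vanish before L, the universal formula for 2 b in position L + 1
is 2 b_(L+1) - b_L ^ 2: this is the identity 2 = V F modulo 2. *)
Lemma tf_wadd_double (R : comNzRingType)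
    (tf : forall (x : R) n, (0 < n)%N -> x *+ n = 0 -> x = 0)
    (b : nat -> R) L : (forall i, (i < L)%N -> b i = 0) ->
  wadd 2 b b L.+1 = b L.+1 *+ 2 - b L ^+ 2.
Proof.
move=> b0; have p2 : prime 2 by [].
have [low lead] := tf_wadd_lead p2 tf b b0.
apply: (mulrn_inj tf (n := 2 ^ L.+1)%N); first by rewrite expn_gt0.
have := ghost_wadd p2 b b L.+1.
have gE (c : nat -> R) : (forall i, (i < L)%N -> c i = 0) ->
    ghost 2 L.+1 c = c L ^+ 2 *+ 2 ^ L + c L.+1 *+ 2 ^ L.+1.
  move=> c0; rewrite /ghost !big_ord_recr /= subnn expr1 subSnn expn1.
  rewrite big1 ?add0r // => i _.
  by rewrite c0 // expr0n gtn_eqF ?mul0rn // expn_gt0.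
rewrite !gE //; last by move=> i iL; rewrite low ?b0.
rewrite lead -mulr2n exprMn_n => H.
apply: (addrI ((b L ^+ 2 *+ 4) *+ 2 ^ L)); rewrite H.
rewrite expnS !mulrnA; move: ((2 ^ L)%N) => m.
have [c E] : exists c, forall u, u *+ m = c * u :> R.
  by exists m%:R => u; rewrite mulr_natl.
by rewrite !E; ring.
Qed.

Section AnyRing.
Variable A : comNzRingType.

(** Valid over any ring by lifting to integer polynomials; the zero entries of [b] are
lifted to 0, not to variables. *)
Lemma wadd_lead (p : nat) (p_pr : prime p) (a b : nat -> A) L :
  (forall i, (i < L)%N -> b i = 0) ->
  (forall i, (i < L)%N -> wadd p a b i = a i) /\ wadd p a b L = a L + b L.
Proof.
move=> b0.
pose f : {rmorphism ipoly A -> A} := ieval (id : A -> A).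
have fK x : f (ivar x) = x by exact: ieval_var.
pose b' i : ipoly A := if (i < L)%N then 0 else ivar (b i).
have [low lead] := @tf_wadd_lead p p_pr _ (@ipoly_tfree A)
  (fun i => ivar (a i)) b' L (fun i iL => ifT _ _ iL).
have wE n : wadd p a b n = f (wadd p (fun i => ivar (a i)) b' n).
  rewrite rmorph_wadd; congr (wadd p _ _ n); apply: funext => i /=.
    by rewrite fK.
  by rewrite /b'; case: ifP => [/b0 ->|_]; rewrite ?rmorph0 ?fK.
split=> [i iL|]; first by rewrite wE low ?fK.
by rewrite wE lead rmorphD fK /b' ltnn fK.
Qed.

Lemma wadd_double (b : nat -> A) L : 2%N \in [pchar A] ->
  (forall i, (i < L)%N -> b i = 0) ->
  (forall i, (i < L.+1)%N -> wadd 2 b b i = 0) /\ wadd 2 b b L.+1 = b L ^+ 2.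
Proof.
move=> char2 b0; have p2 : prime 2 by [].
split=> [i|].
  have [low lead] := wadd_lead p2 b b0.
  rewrite ltnS leq_eqVlt => /orP[/eqP ->|iL]; last by rewrite low // b0.
  by rewrite lead -mulr2n mulrn_pchar.
pose f : {rmorphism ipoly A -> A} := ieval (id : A -> A).
have fK x : f (ivar x) = x by exact: ieval_var.
pose b' i : ipoly A := if (i < L)%N then 0 else ivar (b i).
have wE n : wadd 2 b b n = f (wadd 2 b' b' n).
  have Eb : b = f \o b'.
    apply: funext => i /=.
    by rewrite /b'; case: ifP => [/b0 ->|_]; rewrite ?rmorph0 ?fK.
  by rewrite rmorph_wadd -Eb.
rewrite wE (@tf_wadd_double _ (@ipoly_tfree A) b' L (fun i iL => ifT _ _ iL)).
rewrite rmorphB rmorphMn mulrn_pchar // sub0r rmorphXn /= /b' ltnn fK.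
by rewrite oppr_pchar2.
Qed.

End AnyRing.

(** In characteristic 2, doubling shifts the leading term by one place and squares it,
while adding a vector that starts further right does not change it. Writing N as 2 ^ n
times an odd number, the leading term of N a is therefore in position L + n. *)
Lemma witt_mulrn_lead (p_pr : prime 2) (A : comNzRingType) (char2 : 2%N \in [pchar A])
    (a : witt p_pr A) L N : (0 < N)%N -> (forall i, (i < L)%N -> a i = 0) ->
  exists n, (forall i, (i < L + n)%N -> (a *+ N) i = 0) /\
    (a *+ N) (L + n)%N = a L ^+ (2 ^ n).
Proof.
have addE (u v : witt p_pr A) i : (u + v) i = wadd 2 u v i by [].
move=> + a0; elim/ltn_ind: N => N IH N_gt0.
have dbl M : (0 < M)%N -> (M < N)%N -> exists n,
    (forall i, (i < L + n.+1)%N -> (a *+ M.*2) i = 0) /\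
    (a *+ M.*2) (L + n.+1)%N = a L ^+ (2 ^ n.+1).
  move=> M0 MN; have [n [H0 Hn]] := IH _ MN M0; exists n.
  have [D0 D1] := wadd_double char2 H0.
  rewrite -addnn mulrnDr !addnS; split=> [i iL|]; first by rewrite addE D0.
  by rewrite addE D1 Hn -exprM -expnSr.
have [N_odd|N_even] := boolP (odd N); last first.
  have E : N = N./2.*2 by rewrite even_halfK.
  have [n Hn] := dbl N./2 ltac:(lia) ltac:(lia).
  by exists n.+1; rewrite E.
exists 0%N; rewrite addn0.
have [N1|N_gt1] := leqP N 1.
  by have -> : N = 1%N by lia.
have E : N = (N./2.*2).+1 by rewrite odd_halfK //; lia.
have [n [H0 _]] := dbl N./2 ltac:(lia) ltac:(lia).
rewrite E mulrS; set b := a *+ _ in H0 *.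
have [low lead] := wadd_lead p_pr a (L := L.+1) (b := b)
   (fun i iL => H0 i ltac:(lia)).
split=> [i iL|]; last by rewrite addE low // expn0 expr1.
by rewrite addE low ?a0 // ltnS ltnW.
Qed.

End WittLeadingTerm.

(** * Cech classes *)

Section Cech.
Variable T : topologicalType.
Implicit Types F G H : sheaf T.

Lemma resB F (U V : opens T) (VU : V `<=` U) (s t : F U) :
  res VU (s - t) = res VU s - res VU t.
Proof. exact: res_zmod. Qed.

Lemma res0 F (U V : opens T) (VU : V `<=` U) : res VU (0 : F U) = 0.
Proof. by rewrite -(subrr 0) resB subrr. Qed.

Lemma resMn F (U V : opens T) (VU : V `<=` U) (s : F U) n :
  res VU (s *+ n) = res VU s *+ n.
Proof.
elim: n => [|n IH]; first exact: res0.
have resN (t : F U) : res VU (- t) = - res VU t by rewrite -sub0r resB res0 sub0r.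
by rewrite !mulrS -[s *+ n]opprK resB resN opprK IH.
Qed.

Lemma homB F G (f : sheaf_hom F G) U (s t : F U) : f U (s - t) = f U s - f U t.
Proof. exact: hom_zmod. Qed.

Lemma hom0 F G (f : sheaf_hom F G) U : f U 0 = 0.
Proof. by rewrite -(subrr 0) homB subrr. Qed.

Lemma homMn F G (f : sheaf_hom F G) U (s : F U) n : f U (s *+ n) = f U s *+ n.
Proof.
elim: n => [|n IH]; first exact: hom0.
have homN (t : F U) : f U (- t) = - f U t by rewrite -sub0r homB hom0 sub0r.
by rewrite !mulrS -[s *+ n]opprK homB homN opprK IH.
Qed.

Lemma hom_mono_inj F G (f : sheaf_hom F G) U : sheaf_mono f -> injective (f U).
Proof.
move=> f_mono x y E; apply/eqP; rewrite -subr_eq0; apply/eqP/f_mono.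
by rewrite homB E subrr.
Qed.

(** Local preimages are unique because [f] is a monomorphism, hence they glue. *)
Lemma exact_lift F G H (f : sheaf_hom F G) (g : sheaf_hom G H) :
  sheaf_mono f -> sheaf_exact f g ->
  forall U (s : G U), g U s = 0 -> exists t, f U t = s.
Proof.
move=> f_mono fg U s /fg loc.
pose C : set (opens T) := [set V : opens T | exists (VU : V `<=` U) (t : F V), f V t = res VU s].
pose lift (V : opens T) : F V := xget 0 [set t | exists VU : V `<=` U, f V t = res VU s].
have liftP (V : opens T) (VU : V `<=` U) : C V -> f V (lift V) = res VU s.
  move=> [VU' [t Et]].
  have [VU2 E] : [set t | exists VU : V `<=` U, f V t = res VU s] (lift V).
    by apply: (@xgetPex _ 0); exists t; exists VU'.
  by rewrite E; congr (res _ s); exact: Prop_irrelevance.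
have UC : (U : set T) = \bigcup_(V in C) V.
  apply/seteqP; split=> [x Ux|x [V [VU _] Vx]]; last exact: VU.
  by have [V [VU [Vx [t Et]]]] := loc _ Ux; exists V => //; exists VU, t.
have [V V' W WV WV' CV CV'|t tP] := sheaf_glue (s := lift) UC.
  have [VU _] := CV; have [VU' _] := CV'.
  have WU : W `<=` U by exact: subset_trans VU.
  apply: (hom_mono_inj f_mono); rewrite !hom_res.
  by rewrite (liftP V VU CV) (liftP V' VU' CV') !(res_res _ _ WU).
exists t; apply/eqP; rewrite -subr_eq0; apply/eqP.
apply: (sheaf_separated UC) => V VU CV.
by rewrite resB -hom_res tP // liftP // subrr.
Qed.

Section TwoOpens.
Variables (U U1 U2 U12 : opens T).
Hypotheses (U1U : U1 `<=` U) (U2U : U2 `<=` U) (cover : U `<=` U1 `|` U2).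
Hypotheses (U12U1 : U12 `<=` U1) (U12U2 : U12 `<=` U2) (U12P : U1 `&` U2 `<=` U12).

Lemma two_separated F (s : F U) : res U1U s = 0 -> res U2U s = 0 -> s = 0.
Proof.
move=> s1 s2; apply: (@sheaf_separated _ _ U [set V : opens T | V = U1 \/ V = U2]).
  apply/seteqP; split=> [x Ux|x [V [->|->]]]; [|exact: U1U|exact: U2U].
  by have [] := cover Ux; [exists U1|exists U2] => //; [left|right].
move=> V VU [] E; subst V.
  by rewrite (Prop_irrelevance VU U1U).
by rewrite (Prop_irrelevance VU U2U).
Qed.

Lemma two_glue F (s1 : F U1) (s2 : F U2) : res U12U1 s1 = res U12U2 s2 ->
  exists t : F U, res U1U t = s1 /\ res U2U t = s2.
Proof.
move=> s12.
pose C : set (opens T) := [set V : opens T | (V : set T) `<=` U1 \/ (V : set T) `<=` U2].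
(* sheaf_glue asks for a section over every open, so the family is defined by choice
   on all opens contained in U1 or in U2. *)
pose P (V : opens T) : set (F V) := [set t | (exists h : V `<=` U1, t = res h s1) \/
                           (exists h : V `<=` U2, t = res h s2)].
have P1 (V : opens T) t (h : V `<=` U1) : P V t -> t = res h s1.
  case=> -[h' ->]; first by rewrite (Prop_irrelevance h h').
  have VU12 : V `<=` U12 by move=> x Vx; apply: U12P; split; [exact: h|exact: h'].
  by rewrite -(res_res U12U1 VU12) s12 res_res.
have P2 (V : opens T) t (h : V `<=` U2) : P V t -> t = res h s2.
  case=> -[h' ->]; last by rewrite (Prop_irrelevance h h').
  have VU12 : V `<=` U12 by move=> x Vx; apply: U12P; split; [exact: h'|exact: h].
  by rewrite -(res_res U12U2 VU12) -s12 res_res.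
have getP (V : opens T) : C V -> P V (xget 0 (P V)).
  move=> CV; apply: xgetPex.
  by case: CV => h; [exists (res h s1); left|exists (res h s2); right]; exists h.
have UC : (U : set T) = \bigcup_(V in [set V : opens T | V = U1 \/ V = U2]) V.
  apply/seteqP; split=> [x Ux|x [V [->|->]]]; [|exact: U1U|exact: U2U].
  by have [] := cover Ux; [exists U1|exists U2] => //; [left|right].
have C12 (V : opens T) : V = U1 \/ V = U2 -> C V by case=> ->; [left|right].
have [V V' W WV WV' CV CV'|t tP] := sheaf_glue (s := fun V => xget 0 (P V)) UC.
  have res_P (Z : opens T) (WZ : W `<=` Z) : C Z -> P W (res WZ (xget 0 (P Z))).
    move=> /getP[] [h ->]; [left|right].
      have h' : W `<=` U1 by exact: subset_trans h.
      by exists h'; rewrite res_res.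
    have h' : W `<=` U2 by exact: subset_trans h.
    by exists h'; rewrite res_res.
  have R1 := res_P _ WV (C12 _ CV); have R2 := res_P _ WV' (C12 _ CV').
  have [h|h] := C12 _ CV.
    have hW : W `<=` U1 by exact: subset_trans h.
    by rewrite (P1 _ _ hW R1) (P1 _ _ hW R2).
  have hW : W `<=` U2 by exact: subset_trans h.
  by rewrite (P2 _ _ hW R1) (P2 _ _ hW R2).
exists t; split.
  rewrite tP; last by left.
  by rewrite (P1 _ _ (fun x => id) (getP _ (C12 _ (or_introl erefl)))) res_id.
rewrite tP; last by right.
by rewrite (P2 _ _ (fun x => id) (getP _ (C12 _ (or_intror erefl)))) res_id.
Qed.

End TwoOpens.

Lemma homology_torsion (A B C : zmodType) (f : {additive A -> B})
  (g : {additive B -> C}) (z : B) : g z = 0 ->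
  exists m : homology f g, forall N, m *+ N = 0 -> exists a, f a = z *+ N.
Proof.
move=> gz; have zP : z \in ker_pred g by rewrite unfold_in /ker_pred gz.
pose c : cycles g := Cycle zP.
have cE N : cycle_val (c *+ N) = z *+ N.
  by elim: N => [//|N IH]; rewrite !mulrS -IH.
exists (\pi_(homology f g) c) => N.
have -> : \pi_(homology f g) c *+ N = \pi_(homology f g) (c *+ N).
  elim: N => [|N IH]; first by rewrite !mulr0n piE.
  by rewrite !mulrS IH; apply/esym; exact: Quotient.pi_add.
have -> : (0 : homology f g) = \pi 0 by rewrite piE.
move/eqP; rewrite -Quotient.idealrBE subr0 => /asboolP[a Ea].
by exists a; rewrite Ea cE.
Qed.

Section CechClass.
Variables (F G : sheaf T) (J : injective_resolution F).
Variables (i : sheaf_hom F G) (i_mono : sheaf_mono i).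
Variables (U1 U2 U12 : opens T).
Hypotheses (cover : forall x, oset U1 x \/ oset U2 x).
Hypotheses (U12U1 : U12 `<=` U1) (U12U2 : U12 `<=` U2) (U12P : U1 `&` U2 `<=` U12).
Variables (g : G U1) (s : F U12).
Hypothesis gs : i U12 s = res U12U1 g.

(** The connecting map of a two-element cover, for a section [s] of F over the
intersection that becomes extendable to U1 in a larger sheaf G. Injectivity extends the
augmentation from F to G; the differentials of the image of [g] on U1 and of 0 on U2 then
glue to a global cocycle. If N times its class is a boundary, the primitive differs from
sections of F on U1 and on U2, whose difference over the intersection is N s. *)
Lemma cech_class : exists m : sheaf_H1 J, forall N, m *+ N = 0 ->
  exists (s1 : F U1) (s2 : F U2), res U12U2 s2 - res U12U1 s1 = s *+ N.
Proof.
have [phi phiP] := @ires_inj T F J 0%N F G i (iaug J) i_mono.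
have iaugD U x : idiff J 0 U (iaug J U x) = 0.
  apply/(@iaug_exact T F J) => y Uy; exists U, (fun _ => id); split=> //.
  by exists x; rewrite res_id.
have idiffD U x : idiff J 1 U (idiff J 0 U x) = 0.
  apply/(@idiff_exact T F J 0%N) => y Uy; exists U, (fun _ => id); split=> //.
  by exists x; rewrite res_id.
pose X := setTo T.
have U1X : U1 `<=` X by [].
have U2X : U2 `<=` X by [].
have cov : X `<=` U1 `|` U2 by move=> x _; exact: cover.
have [c [c1 c2]] := @two_glue X U1 U2 U12 U1X U2X cov U12U1 U12U2 U12P (J 1%N)
  (idiff J 0 U1 (phi U1 g)) 0
  ltac:(by rewrite res0 -!hom_res -gs phiP iaugD).
have dc : idiff J 1 X c = 0.
  apply: (@two_separated X U1 U2 U1X U2X cov (J 2%N)); rewrite -hom_res ?c1 ?c2 ?idiffD //.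
  by rewrite hom0.
have [m mP] := @homology_torsion _ _ _ (idiff J 0 X) (idiff J 1 X) c dc.
exists m => N /mP[b Eb].
have [s2 E2] : exists s2, iaug J U2 s2 = res U2X b.
  apply: (exact_lift (@iaug_mono T F J) (@iaug_exact T F J)).
  by rewrite hom_res Eb resMn c2 mul0rn.
have [s1 E1] : exists s1, iaug J U1 s1 = res U1X b - phi U1 g *+ N.
  apply: (exact_lift (@iaug_mono T F J) (@iaug_exact T F J)).
  by rewrite homB homMn hom_res Eb resMn c1 subrr.
exists s1, s2; apply: (hom_mono_inj (@iaug_mono T F J)).
have U12X : U12 `<=` X by [].
rewrite homB !hom_res E1 E2 resB resMn !(res_res _ _ U12X) homMn opprB.
by rewrite addrC addrNK -hom_res -gs phiP.
Qed.

End CechClass.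
End Cech.

Section WittClass.
Variables (p : nat) (p_pr : prime p) (K : fieldType) (X : model K).
Local Notation W := (witt p_pr K).
Local Notation predE E U := (@WO_pred p p_pr K X E U).
Implicit Types E : point X -> int.

Section Inclusion.
Variables (E E' : point X -> int) (le_EE' : forall x, E x <= E' x).

Lemma WO_pred_incl U w : w \in predE E U -> w \in predE E' U.
Proof.
move=> /asboolP[w0 wU]; apply/asboolP; split=> // x Ux dx i wi.
apply: le_trans (wU x Ux dx i wi) _.
by rewrite lerD2l ler_wpM2l.
Qed.

Definition WO_incl_sect U (s : WO p_pr E U) : WO p_pr E' U :=
  WOSect (WO_pred_incl (WO_valP s)).

Lemma WO_incl_zmod U : zmod_morphism (@WO_incl_sect U).
Proof. by move=> s t; apply: WO_sect_inj. Qed.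

Lemma WO_incl_res (U V : opens (point X)) (VU : V `<=` U) s :
  WO_incl_sect (res VU s) = res VU (WO_incl_sect s).
Proof. exact: WO_sect_inj. Qed.

Definition WO_incl : sheaf_hom (WO p_pr E) (WO p_pr E') :=
  SheafHom WO_incl_zmod WO_incl_res.

Lemma WO_incl_mono : sheaf_mono WO_incl.
Proof.
move=> U s /(congr1 (@WO_val _ _ _ _ _ _)) s0.
exact: (@WO_sect_inj _ _ _ _ _ U s 0 s0).
Qed.

End Inclusion.

Lemma WO_valMn E U (s : WO p_pr E U) n : WO_val (s *+ n) = WO_val s *+ n.
Proof. by elim: n => [//|n IH]; rewrite !mulrS -IH. Qed.

(** The larger sheaf is again of the form WO, for a divisor with more poles. Sections
over nonempty opens are Witt vectors of the function field, so the splitting of a multiple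
of the cocycle is an identity between such vectors. *)
Lemma WO_H1_class E (J : injective_resolution (WO p_pr E)) E' (U1 U2 : opens (point X))
    (w0 : W) x0 :
  (forall x, E x <= E' x) -> (forall x, oset U1 x \/ oset U2 x) ->
  oset U1 x0 -> oset U2 x0 ->
  w0 \in predE E' U1 ->
  w0 \in predE E (Opens (openI (oset_open U1) (oset_open U2))) ->
  exists m : sheaf_H1 J, forall N, m *+ N = 0 ->
    exists w : W, w \in predE E U2 /\ w - w0 *+ N \in predE E U1.
Proof.
move=> le_EE' cover U1x U2x w01 w012; set U12 := Opens _ in w012.
have U12x : oset U12 x0 by [].
have U12U1 : U12 `<=` U1 by move=> ? [].
have U12U2 : U12 `<=` U2 by move=> ? [].
have gs : WO_incl le_EE' U12 (WOSect w012) = res U12U1 (WOSect w01 : WO p_pr E' U1).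
  by apply: WO_sect_inj; rewrite (WO_resE U12U1 _ U12x).
have [m mP] := cech_class J (@WO_incl_mono _ _ le_EE') cover U12U2 (fun _ => id) gs.
exists m => N /mP[s1 [s2 E12]]; exists (WO_val s2); split; first exact: WO_valP.
have := congr1 (@WO_val _ _ _ _ _ _) E12.
rewrite WO_valMn.
have -> : forall a b : WO p_pr E U12, WO_val (a - b) = WO_val a - WO_val b by [].
rewrite (WO_resE U12U1 _ U12x) (WO_resE U12U2 _ U12x) /= => <-.
by rewrite opprB addrC subrK; exact: WO_valP.
Qed.

End WittClass.

(** * Local subrings and valuations *)

Section Subrings.
Variable K : fieldType.
Implicit Types (R C T P : set K) (a b c u v x y z : K).

Section Closure.
Variables (R : set K) (sR : is_subring R).

Lemma subring1 : R 1. Proof. by case: sR. Qed.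
Lemma subringB a b : R a -> R b -> R (a - b). Proof. by case: sR => _ + _; apply. Qed.
Lemma subringM a b : R a -> R b -> R (a * b). Proof. by case: sR => _ _; apply. Qed.
Lemma subring0 : R 0. Proof. by rewrite -(subrr 1); apply: subringB; exact: subring1. Qed.
Lemma subringN a : R a -> R (- a). Proof. by rewrite -sub0r; apply: subringB; exact: subring0. Qed.
Lemma subringD a b : R a -> R b -> R (a + b).
Proof. by move=> Ra Rb; rewrite -[b]opprK; apply: subringB => //; exact: subringN. Qed.
Lemma subringX a n : R a -> R (a ^+ n).
Proof.
by move=> Ra; elim: n => [|n IH]; rewrite ?expr0 ?exprS; [exact: subring1|exact: subringM].
Qed.

Lemma is_unit1 : is_unit R 1.
Proof. by split; rewrite ?oner_neq0 ?invr1 //; exact: subring1. Qed.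

Lemma is_unitM a b : is_unit R a -> is_unit R b -> is_unit R (a * b).
Proof.
move=> [a0 Ra Ra1] [b0 Rb Rb1]; split; first by rewrite mulf_neq0.
  exact: subringM.
by rewrite invfM; exact: subringM.
Qed.

Lemma is_unitV a : is_unit R a -> is_unit R a^-1.
Proof. by move=> [a0 Ra Ra1]; split; rewrite ?invr_eq0 ?invrK. Qed.

Lemma is_unitN a : is_unit R a -> is_unit R (- a).
Proof. by move=> [a0 Ra Ra1]; split; rewrite ?oppr_eq0 ?invrN //; exact: subringN. Qed.

Lemma is_unitX a n : is_unit R a -> is_unit R (a ^+ n).
Proof.
by move=> Ra; elim: n => [|n IH]; rewrite ?expr0 ?exprS; [exact: is_unit1|exact: is_unitM].
Qed.

Lemma is_unit_factor a b : R a -> R b -> is_unit R (a * b) -> is_unit R a.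
Proof.
move=> Ra Rb [ab0 _ Rab1]; have [a0 b0] : a != 0 /\ b != 0.
  by move: ab0; rewrite mulf_eq0 negb_or => /andP.
split=> //; have -> : a^-1 = b * (a * b)^-1 by rewrite invfM mulrCA mulfV ?mulr1.
exact: subringM.
Qed.

End Closure.

Definition local_ring R := forall a b, R a -> R b -> is_unit R (a + b) ->
  is_unit R a \/ is_unit R b.

Lemma localN R a b : is_subring R -> local_ring R -> R a -> R b ->
  is_unit R (a - b) -> is_unit R a \/ is_unit R b.
Proof.
move=> sR lR Ra Rb /(lR _ _ Ra (subringN sR Rb)) [|/(is_unitN sR)]; first by left.
by rewrite opprK; right.
Qed.

Lemma local_unit1B R a : is_subring R -> local_ring R -> R a -> ~ is_unit R a ->
  is_unit R (1 - a).
Proof.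
move=> sR lR Ra nua.
have := is_unit1 sR; rewrite -{1}(subrK a 1) => /(lR _ _ (subringB sR (subring1 sR) Ra) Ra).
by case.
Qed.

Definition unit_closed R T := forall z, T z -> is_unit R z -> T z^-1.

(** For C the coordinate ring of a chart and R the local ring of one of its points, this
is all of R. *)
Definition fracs R C : set K :=
  [set z | exists a s, [/\ C a, C s, is_unit R s & z = a / s]].

Lemma fracs_sub R C : is_subring R -> C `<=` R -> fracs R C `<=` R.
Proof.
by move=> sR CR _ [a [s [Ca Cs [_ _ Rs] ->]]]; apply: subringM => //; exact: CR.
Qed.

Lemma sub_fracs R C : is_subring R -> is_subring C -> C `<=` fracs R C.
Proof.
move=> sR sC a Ca; exists a, 1; rewrite divr1.
by split=> //; [exact: subring1|exact: is_unit1].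
Qed.

Lemma fracs_subring R C : is_subring R -> is_subring C -> is_subring (fracs R C).
Proof.
move=> sR sC; split.
- by apply: sub_fracs => //; exact: subring1.
- move=> _ _ [a [s [Ca Cs us ->]]] [b [t [Cb Ct ut ->]]].
  exists (a * t - b * s), (s * t); split; last first.
  + by have [s0 _ _] := us; have [t0 _ _] := ut; field; rewrite s0 t0.
  + exact: is_unitM.
  + exact: subringM.
  + by apply: subringB => //; exact: subringM.
- move=> _ _ [a [s [Ca Cs us ->]]] [b [t [Cb Ct ut ->]]].
  exists (a * b), (s * t); split; last by rewrite invfM mulrACA.
  + exact: subringM.
  + exact: subringM.
  + exact: is_unitM.
Qed.

Lemma fracs_unit_closed R C : is_subring R -> C `<=` R -> unit_closed R (fracs R C).
Proof.
move=> sR CR z [a [s [Ca Cs us ->]]] uz; exists s, a.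
split=> //; last by rewrite invfM invrK mulrC.
have [s0 Rs _] := us.
by rewrite -(divfK s0 a); exact: is_unitM.
Qed.

(** Generators of the chart suffice to control a local ring, provided that the units are
inverted. *)
Lemma localization_gen C P T : is_subring C -> is_prime C P ->
  is_subring T -> C `<=` T -> unit_closed (localization C P) T ->
  localization C P `<=` T.
Proof.
move=> sC prP sT CT Tu z [a [s [Ca Cs Ps ->]]].
have s0 : s != 0 by apply/eqP => s0; apply: Ps; case: prP => -[_ P0 _ _] _ _; rewrite s0.
have P1 : ~ P 1 by case: prP.
apply: (subringM sT); first exact: CT.
apply: Tu; first exact: CT.
split=> //; first by exists s, 1; rewrite divr1; split=> //; exact: subring1.
by exists 1, s; rewrite mul1r; split=> //; exact: subring1.
Qed.

Lemma localization_local C P : is_subring C -> is_prime C P ->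
  local_ring (localization C P).
Proof.
move=> sC [[PC P0 PB PM] P1 Pp].
have unitP a s : C a -> C s -> ~ P s -> ~ P a -> is_unit (localization C P) (a / s).
  move=> Ca Cs Ps Pa.
  have [a0 s0] : a != 0 /\ s != 0.
    by split; apply/eqP => E; [apply: Pa|apply: Ps]; rewrite E.
  split; first by rewrite mulf_neq0 ?invr_eq0.
    by exists a, s.
  by exists s, a; rewrite invfM invrK mulrC.
move=> _ _ [a [s [Ca Cs Ps ->]]] [b [t [Cb Ct Pt ->]]] [n0 _ uV].
have [Pa|] := pselect (P a); last by left; exact: unitP.
have [Pb|] := pselect (P b); last by right; exact: unitP.
exfalso; move: uV => [c [r [Cc Cr Pr E]]].
have nz q : ~ P q -> q != 0 by move=> Pq; apply/eqP => E0; apply: Pq; rewrite E0.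
have [[s0 t0] r0] := (nz _ Ps, nz _ Pt, nz _ Pr).
have PD q q' : P q -> P q' -> P (q + q').
  move=> Pq Pq'; rewrite -[q']opprK; apply: (PB) => //.
  by rewrite -sub0r; exact: PB.
have Pab : P (a * t + b * s).
  apply: PD; rewrite mulrC.
    exact: PM.
  exact: PM.
have Est : s * t * r = c * (a * t + b * s).
  move: n0 E; have -> : a / s + b / t = (a * t + b * s) / (s * t) by field; rewrite s0 t0.
  rewrite mulf_eq0 negb_or invr_eq0 invfM invrK => /andP[n0 _] E.
  by apply: (mulIf (invr_neq0 r0)); rewrite mulfK // [RHS]mulrAC -E mulrAC mulVf ?mul1r.
have Pstr : P (s * t * r) by rewrite Est; exact: PM.
by case: (Pp _ _ (subringM sC Cs Ct) Cr Pstr) => // /(Pp _ _ Cs Ct)[].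
Qed.

(** The point is the prime ideal of the elements of C that are not units of R. *)
Lemma stalk_exists (X : model K) R C : is_subring R -> local_ring R -> charts X C ->
  C `<=` R -> R `<=` fracs R C -> exists x : point X, stalk x = R.
Proof.
move=> sR lR XC CR RC; have sC := charts_subring XC.
pose P := [set c | C c /\ ~ is_unit R c].
have prP : is_prime C P.
  split.
  - split=> [c []//|||].
    + by split; [exact: subring0|case; rewrite eqxx].
    + move=> c d [Cc nc] [Cd nd]; split; first exact: subringB.
      by move/(localN sR lR (CR _ Cc) (CR _ Cd)) => [].
    + move=> a c Ca [Cc nc]; split; first exact: subringM.
      by rewrite mulrC => /(is_unit_factor sR (CR _ Cc) (CR _ Ca)).
  - by case=> _; apply; exact: is_unit1.
  - move=> c d Cc Cd [_ ncd].
    have [uc|nc] := pselect (is_unit R c); last by left.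
    have [ud|nd] := pselect (is_unit R d); last by right.
    by exfalso; apply: ncd; exact: is_unitM.
have E : R = localization C P.
  apply/seteqP; split=> [z /RC[a [s [Ca Cs us ->]]]|_ [a [s [Ca Cs Ps ->]]]].
    by exists a, s; split=> // -[].
  have us : is_unit R s by apply: contrapT => us; apply: Ps.
  by have [_ _ Rs1] := us; apply: subringM => //; exact: CR.
have xP : exists C P, [/\ charts X C, is_prime C P & R = localization C P].
  by exists C, P.
by exists (Point xP).
Qed.

Section Valuation.
Variables (R : set K) (sR : is_subring R) (dR : is_dvr R).

Let t := xget 0 (uniformizer R).
Let tP : uniformizer R t.
Proof. by have [t0 t0P] := dR; apply: xgetPex; exists t0. Qed.
Let t0 : t != 0. Proof. by case: tP. Qed.

Lemma ord_spec a : a != 0 -> exists2 u, is_unit R u & a = u * t ^ ord R a.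
Proof.
move=> a0; have [_ _ _ /(_ _ a0)[n [u [uu E]]]] := tP.
by exists u => //; rewrite (ord_uniq sR tP erefl uu E).
Qed.

Lemma ord_eq1_exists : exists2 a, a != 0 & ord R a = 1.
Proof.
exists t => //.
by apply: (ord_uniq sR tP erefl (is_unit1 sR)); rewrite expr1z mul1r.
Qed.

Lemma ordM a b : a != 0 -> b != 0 -> ord R (a * b) = ord R a + ord R b.
Proof.
move=> /ord_spec[u uu Ea] /ord_spec[v uv Eb].
apply: (ord_uniq sR tP erefl (is_unitM sR uu uv)).
by rewrite {1}Ea {1}Eb mulrACA expfzDr.
Qed.

Lemma ord_unit u : is_unit R u -> ord R u = 0.
Proof. by move=> uu; apply: (ord_uniq sR tP erefl uu); rewrite expr0z mulr1. Qed.

Lemma ordX a n : a != 0 -> ord R (a ^+ n) = ord R a * n%:Z.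
Proof.
move=> a0; elim: n => [|n IH]; first by rewrite expr0 (ord_unit (is_unit1 sR)) mulr0.
by rewrite exprS ordM ?expf_neq0 // IH -add1n PoszD mulrDr mulr1.
Qed.

Lemma ordV a : a != 0 -> ord R a^-1 = - ord R a.
Proof.
move=> a0; have := ordM (invr_neq0 a0) a0.
rewrite mulVf // (ord_unit (is_unit1 sR)) => /esym/eqP.
by rewrite addr_eq0 => /eqP.
Qed.

(** A nonzero element is a unit times a power of a uniformizer whose inverse is not in
R. *)
Lemma ord_ge0 a : a != 0 -> 0 <= ord R a <-> R a.
Proof.
move=> a0; have [u [u0 Ru Ru1]] := ord_spec a0; move: (ord R a) => m ->.
split; case: m => [n|n] //.
  by move=> _; apply: subringM => //; apply: subringX => //; case: tP.
rewrite NegzE => Ra; exfalso.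
have [_ Rt + _] := tP; apply.
have -> : t^-1 = t ^+ n * (u^-1 * (u * t ^ (- n.+1%:Z))).
  rewrite mulKf // -invr_expz -exprnP exprS invfM mulrCA divff ?mulr1 //.
  by rewrite expf_neq0.
by apply: subringM => //; [exact: subringX|exact: subringM].
Qed.

Lemma ord_gt0 a : a != 0 -> R a -> ~ is_unit R a -> 0 < ord R a.
Proof.
move=> a0 Ra na; rewrite lt_def; have /(ord_ge0 a0) -> := Ra; rewrite andbT.
apply/eqP => E0; apply: na; have [u uu] := ord_spec a0.
by rewrite E0 expr0z mulr1 => ->.
Qed.

Lemma ord_eq0 a : a != 0 -> ord R a = 0 -> is_unit R a.
Proof. by move=> /ord_spec[u uu Ea] Ea0; move: Ea; rewrite Ea0 expr0z mulr1 => ->. Qed.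

Lemma ord_nonunit a : a != 0 -> ~ is_unit R a -> R a -> exists2 b, R b & a = t * b.
Proof.
move=> a0 na Ra; have := ord_gt0 a0 Ra na => a_gt0.
exists (a / t); last by rewrite mulrC divfK.
apply/ord_ge0; first by rewrite mulf_neq0 ?invr_eq0.
rewrite ordM ?invr_eq0 // ordV //.
suff -> : ord R t = 1 by rewrite subr_ge0 -gtz0_ge1.
by apply: (ord_uniq sR tP erefl (is_unit1 sR)); rewrite expr1z mul1r.
Qed.

Lemma dvr_local : local_ring R.
Proof.
move=> a b Ra Rb uab.
have [ua|na] := pselect (is_unit R a); first by left.
have [ub|nb] := pselect (is_unit R b); first by right.
exfalso; have tdiv c : R c -> ~ is_unit R c -> exists2 d, R d & c = t * d.
  move=> Rc nc; have [->|c0] := eqVneq c 0; last exact: ord_nonunit.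
  by exists 0; [exact: subring0|rewrite mulr0].
have [a' Ra' Ea] := tdiv _ Ra na; have [b' Rb' Eb] := tdiv _ Rb nb.
have [_ Rt nt _] := tP; apply: nt.
move: uab; rewrite Ea Eb -mulrDr => /(is_unit_factor sR Rt (subringD sR Ra' Rb')).
by case.
Qed.

End Valuation.

Lemma stalk_local (X : model K) (x : point X) : local_ring (stalk x).
Proof.
have [C [P [XC prP ->]]] := stalkP x.
by apply: localization_local => //; exact: (charts_subring XC).
Qed.

End Subrings.

(** * The ideal of the F_2-points *)

Section Opens.
Variables (K : fieldType) (X : model K).

(** If z = a / s at one point of a chart, then z is regular wherever s does not vanish. *)
Lemma dom_open (z : K) : open [set x : point X | stalk x z].
Proof.
move=> C P x XC prP xP /=; rewrite xP => -[a [s [Ca Cs Ps ->]]]; exists s; split=> // Q y prQ Qs yQ.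
by rewrite /= yQ; exists a, s.
Qed.

End Opens.

Section Charts.
Variable k : fieldType.
Local Notation K := (P2_field k).
Implicit Types (T R : set K) (i j : 'I_3).

Local Notation F2chart_ := (@F2chart k).
Local Notation P2chart_ := (@P2chart k).
Local Notation "x_[ i , j ]" := (@hcoord k i / @hcoord k j) (at level 0, format "x_[ i ,  j ]").

Lemma hcoord0 : @hcoord k 0 = 1.
Proof. by rewrite /hcoord /= tofrac1. Qed.

Lemma hcoord_neq0 i : @hcoord k i != 0.
Proof.
rewrite /hcoord tofrac_eq0.
by case: i => -[|[|[|//]]] ? /=; rewrite ?oner_neq0 ?polyC_eq0 ?polyX_eq0.
Qed.

Lemma hratio1 j : x_[j, j] = 1.
Proof. by rewrite divff // hcoord_neq0. Qed.

Lemma subring_gen_min (S T : set K) : is_subring T -> S `<=` T -> subring_gen S `<=` T.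
Proof. by move=> sT ST z; apply. Qed.

Lemma F2chart_subring j : is_subring (F2chart_ j).
Proof. exact: subring_genP. Qed.

Lemma P2chart_subring j : is_subring (P2chart_ j).
Proof. exact: subring_genP. Qed.

Lemma F2chart_ratio i j : F2chart_ j x_[i, j].
Proof. by apply: sub_subring_gen; exists i. Qed.

Lemma F2chart_min j T : is_subring T -> (forall i, T x_[i, j]) -> F2chart_ j `<=` T.
Proof. by move=> sT Tx; apply: subring_gen_min => // _ [i _ <-]. Qed.

Lemma base_change_min (S T : set K) : is_subring T -> (forall c, T (kcst c)) ->
  S `<=` T -> base_change S `<=` T.
Proof. by move=> sT Tc ST; apply: subring_gen_min => // z [[c _ <-]|/ST]. Qed.

Lemma P2chart_min j T : is_subring T -> (forall c, T (kcst c)) ->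
  (forall i, T x_[i, j]) -> P2chart_ j `<=` T.
Proof. by move=> sT Tc Tx; apply: base_change_min => //; exact: F2chart_min. Qed.

Lemma base_change_cst (S : set K) c : base_change S (kcst c).
Proof. by apply: sub_subring_gen; left; exists c. Qed.

Lemma sub_base_change (S : set K) : S `<=` base_change S.
Proof. by move=> z Sz; apply: sub_subring_gen; right. Qed.

(** The two coordinates [x_[i1, j]] and [x_[i2, j]] of the j-th chart, in some order. *)
Definition coord_frame j i1 i2 :=
  [/\ i1 != j, i2 != j, i1 != i2 & forall i, [\/ i = j, i = i1 | i = i2]].

Lemma F2_cases (c : 'F_2) : c = 0 \/ c = 1.
Proof. by case: c => -[|[|//]] ?; [left|right]; apply: val_inj. Qed.

Lemma F2points_ideal_gen i j : F2points_ideal j (x_[i, j] ^+ 2 - x_[i, j]).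
Proof.
have sA := F2chart_subring j; have Ax := F2chart_ratio.
split=> [|a aj I [[IA I0 IB IM] eqI]]; first by apply: (subringB sA) => //; exact: (subringX sA).
have Ii := eqI _ (imageT _ i).
case: (F2_cases (a 0 i)) => E; move: Ii; rewrite E /=.
  rewrite mulr0n subr0 => Ii.
  have -> : x_[i, j] ^+ 2 - x_[i, j] = (x_[i, j] - 1) * x_[i, j] by ring.
  by apply: IM => //; apply: (subringB sA) => //; exact: (subring1 sA).
rewrite mulr1n => Ii.
have -> : x_[i, j] ^+ 2 - x_[i, j] = x_[i, j] * (x_[i, j] - 1) by ring.
exact: IM.
Qed.

(** The ideal of all F_2-points of an affine plane with coordinates a, b is generated by
a^2 - a and b^2 - b. The four products of one of a, 1 - a with one of b, 1 - b sum to 1,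
and each multiplies the ideal of the point where it is 1 into the ideal of the two
generators. *)
Lemma F2points_idealP j i1 i2 (g : K) : coord_frame j i1 i2 -> F2points_ideal j g ->
  exists c d, [/\ F2chart_ j c, F2chart_ j d &
    g = c * (x_[i1, j] ^+ 2 - x_[i1, j]) + d * (x_[i2, j] ^+ 2 - x_[i2, j])].
Proof.
move=> [i1j i2j i12 ijP] [Ag gI].
have [ji1 ji2 i21] : [/\ (j == i1) = false, (j == i2) = false & (i2 == i1) = false].
  by split; apply/negbTE; rewrite eq_sym.
have sA := F2chart_subring j; have Ax := F2chart_ratio^~ j.
set a := x_[i1, j]; set b := x_[i2, j].
pose J := [set g | exists c d, [/\ F2chart_ j c, F2chart_ j d &
  g = c * (a ^+ 2 - a) + d * (b ^+ 2 - b)]].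
have J0 : J 0 by exists 0, 0; rewrite !mul0r addr0; split=> //; exact: (subring0 sA).
have JB x y : J x -> J y -> J (x - y).
  move=> [c [d [Ac Ad ->]]] [c' [d' [Ac' Ad' ->]]].
  by exists (c - c'), (d - d'); split; [exact: (subringB sA)|exact: (subringB sA)|ring].
have JD x y : J x -> J y -> J (x + y).
  move=> [c [d [Ac Ad ->]]] [c' [d' [Ac' Ad' ->]]].
  by exists (c + c'), (d + d'); split; [exact: (subringD sA)|exact: (subringD sA)|ring].
have JM z x : F2chart_ j z -> J x -> J (z * x).
  move=> Az [c [d [Ac Ad ->]]].
  by exists (z * c), (z * d); split; [exact: (subringM sA)|exact: (subringM sA)|ring].
(* indicator functions of the values 0 and 1 *)
pose e (t : bool) (z : K) := if t then z else 1 - z.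
have Ae t i : F2chart_ j (e t x_[i, j]).
  by case: t; rewrite /e; [exact: Ax|apply: (subringB sA); [exact: (subring1 sA)|exact: Ax]].
have eJ (t : bool) i : exists2 c, F2chart_ j c &
    e t x_[i, j] * (x_[i, j] - (t%:R : 'F_2)%:R) = c * (x_[i, j] ^+ 2 - x_[i, j]).
  case: t; rewrite /e.
    by exists 1; [exact: (subring1 sA)|rewrite mul1r mulrBr mulr1 -expr2].
  exists (-1); first by apply: (subringN sA); exact: (subring1 sA).
  by rewrite mulr0n subr0; ring.
have key s t : J (e s a * e t b * g).
  pose pt : 'rV['F_2]_3 := \row_i (if i == i1 then s%:R else if i == i2 then t%:R else 1).
  have ptj : pt 0 j != 0.
    by rewrite mxE ji1 ji2 oner_neq0.
  have [] := gI pt ptj [set z | F2chart_ j z /\ J (e s a * e t b * z)]; last by [].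
  split; [split|].
  - by move=> z [].
  - by split; [exact: (subring0 sA)|rewrite mulr0].
  - move=> x y [Fx Jx] [Fy Jy]; split; first exact: (subringB sA).
    by rewrite mulrBr; exact: JB.
  - move=> z x Az [Fx Jx]; split; first exact: (subringM sA).
    by rewrite mulrCA; exact: JM.
  - move=> _ [i _ <-]; split.
      apply: (subringB sA) => //; elim: (nat_of_ord _) => [|n IH].
        exact: (subring0 sA).
      by rewrite mulrS; apply: (subringD sA) => //; exact: (subring1 sA).
    rewrite /pt mxE; have [->|->|->] := ijP i.
    + rewrite ji1 ji2 hratio1 /= mulr1n subrr mulr0.
      exact: J0.
    + rewrite eqxx mulrAC -/a mulrC; have [c Ac ->] := eJ s i1.
      by apply: JM; [exact: Ae|exists c, 0; rewrite mul0r addr0; split=> //; exact: (subring0 sA)].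
    + rewrite i21 eqxx -mulrA -/b; have [c Ac ->] := eJ t i2.
      by apply: JM; [exact: Ae|exists 0, c; rewrite mul0r add0r; split=> //; exact: (subring0 sA)].
have -> : g = e true a * e true b * g + e true a * e false b * g
    + e false a * e true b * g + e false a * e false b * g by rewrite /e; ring.
exact: JD _ _ (JD _ _ (JD _ _ (key _ _) (key _ _)) (key _ _)) (key _ _).
Qed.

End Charts.

(** * Local rings of the blowup *)

Section FieldIdentities.
Variable F : fieldType.
Implicit Types a b c d f : F.

Lemma div_div_cancel a b f : f != 0 -> b / a = b / f * (a / f)^-1.
Proof. by move=> f0; rewrite invfM invrK [a^-1 * f]mulrC mulrA divfK. Qed.

Lemma lin_comb_div a b c d f : a != 0 ->
  (c * a + d * b) / f = (c + d * (b / a)) * (a / f).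
Proof.
move=> a0; have -> : c * a + d * b = (c + d * (b / a)) * a.
  by rewrite mulrDl -mulrA divfK.
by rewrite -[LHS]mulrA.
Qed.

Lemma divf_neq0l a f : a / f != 0 -> a != 0.
Proof. by apply: contraNneq => ->; rewrite mul0r. Qed.

Lemma inv_lin_comb a b c d f : a != 0 -> f != 0 -> f = c * a + d * b ->
  (a / f)^-1 = c + d * (b / a).
Proof. by move=> a0 f0 E; rewrite invfM invrK E; field. Qed.

Lemma one_lin_comb a b c d f : f != 0 -> f = c * a + d * b ->
  1 = a / f * c + b / f * d.
Proof.
move=> f0 E; rewrite mulrAC [_ / f * d]mulrAC -mulrDl [_ * c]mulrC [_ * d]mulrC -E.
by rewrite divff.
Qed.

End FieldIdentities.

Section StalkGen.
Variable k : fieldType.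
Local Notation K := (P2_field k).
Local Notation F2chart_ := (@F2chart k).
Local Notation P2chart_ := (@P2chart k).
Local Notation "x_[ i , j ]" := (@hcoord k i / @hcoord k j) (at level 0, format "x_[ i ,  j ]").
Local Notation X := (blowup_P2 k).
Implicit Types (T R : set K) (i j : 'I_3).

Lemma coord_frame_sym j i1 i2 : coord_frame j i1 i2 -> coord_frame j i2 i1.
Proof.
move=> [i1j i2j i12 ijP]; split=> // [|i]; first by rewrite eq_sym.
by case: (ijP i) => ->; [constructor 1|constructor 3|constructor 2].
Qed.

Lemma ord3_cases (i : 'I_3) : [\/ i = 0, i = 1 | i = 2].
Proof.
by case: i => -[|[|[|//]]] ?; [constructor 1|constructor 2|constructor 3]; apply: val_inj.
Qed.

Lemma coord_frame_exists j : exists i1 i2, coord_frame j i1 i2.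
Proof.
case: (ord3_cases j) => ->; [exists 1, 2|exists 0, 2|exists 0, 1]; split=> // i;
  case: (ord3_cases i) => ->; by [constructor 1|constructor 2|constructor 3].
Qed.

Definition grid j i : K := x_[i, j] ^+ 2 - x_[i, j].

(** The ideal of the F_2-points is generated by two grid polynomials. At a point of the
blowup it is principal, so one of the two generators, divided by a generator of the ideal,
is a unit: the ratio of the two grid polynomials, in the right order, is regular there, and
the local ring is generated by k, the affine coordinates, this ratio and the inverses of
units. *)
Lemma blowup_point_gen (x : point X) : exists j i1 i2,
  [/\ coord_frame j i1 i2, P2chart_ j `<=` stalk x,
      stalk x (grid j i2 / grid j i1) &
      forall T, is_subring T -> (forall c, T (kcst c)) -> (forall i, T x_[i, j]) ->
        T (grid j i2 / grid j i1) -> unit_closed (stalk x) T -> stalk x `<=` T].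
Proof.
have [C [P [XC prP xE]]] := stalkP x.
have sC := charts_subring XC; have sR := stalk_subring x; have lR := @stalk_local _ _ x.
have CR : C `<=` stalk x.
  move=> c Cc; rewrite xE; exists c, 1; rewrite divr1; split=> //; first exact: (subring1 sC).
  by case: prP.
have [j [f [If f0 EC]]] := XC.
have AC : F2chart_ j `<=` C.
  by move=> z Az; rewrite EC; apply: sub_base_change; apply: sub_subring_gen; left.
have cstC c : C (kcst c) by rewrite EC; exact: base_change_cst.
have IC g : F2points_ideal j g -> C (g / f).
  by move=> Ig; rewrite EC; apply: sub_base_change; apply: sub_subring_gen; right; exists g.
have main i1 i2 : coord_frame j i1 i2 -> is_unit (stalk x) (grid j i1 / f) ->
    exists j i1 i2, [/\ coord_frame j i1 i2, P2chart_ j `<=` stalk x,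
      stalk x (grid j i2 / grid j i1) &
      forall T, is_subring T -> (forall c, T (kcst c)) -> (forall i, T x_[i, j]) ->
        T (grid j i2 / grid j i1) -> unit_closed (stalk x) T -> stalk x `<=` T].
  move=> fr uG; exists j, i1, i2.
  have [g0 Rg Rg1] := uG.
  have G10 := divf_neq0l g0.
  split=> //.
  - apply: P2chart_min => [||i]; [exact: sR|by move=> c; exact: CR|apply: CR].
    by apply: AC; exact: F2chart_ratio.
  - rewrite (div_div_cancel _ _ f0).
    by apply: (subringM sR) => //; apply/CR/IC; exact: F2points_ideal_gen.
  move=> T sT Tc Tx TG Tu.
  have AT : F2chart_ j `<=` T by exact: F2chart_min.
  have [c [d [Ac Ad Ef]]] := F2points_idealP fr If.
  have Tf : T (grid j i1 / f).
    rewrite -[_ / f]invrK; apply: Tu; last exact: (is_unitV uG).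
    rewrite (inv_lin_comb G10 f0 Ef).
    by apply: (subringD sT); [|apply: (subringM sT)]; rewrite ?TG //; exact: AT.
  move=> z; rewrite xE; apply: localization_gen => //; last by rewrite -xE.
  rewrite EC; apply: base_change_min => //; apply: subring_gen_min => // w [/AT //|].
  move=> [g Ig <-]; have [c' [d' [Ac' Ad' ->]]] := F2points_idealP fr Ig.
  rewrite -/(grid j i1) -/(grid j i2).
  rewrite (lin_comb_div _ _ _ _ G10).
  apply: (subringM sT) => //; apply: (subringD sT); first exact: AT.
  by apply: (subringM sT) => //; exact: AT.
have [i1 [i2 fr]] := coord_frame_exists j.
have [c [d [Ac Ad Ef]]] := F2points_idealP fr If.
have RG i : stalk x (grid j i / f) by apply/CR/IC; exact: F2points_ideal_gen.
have Rc := CR _ (AC _ Ac); have Rd := CR _ (AC _ Ad).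
have := is_unit1 sR.
rewrite (one_lin_comb f0 Ef).
case/(lR _ _ (subringM sR (RG _) Rc) (subringM sR (RG _) Rd)) => /(is_unit_factor sR (RG _)) u.
  exact: main fr (u Rc).
exact: main (coord_frame_sym fr) (u Rd).
Qed.

End StalkGen.

(** * Points near a line *)

Section LineAlgebra.
Variables (F : fieldType) (R : set F) (sR : is_subring R) (lR : local_ring R).
Implicit Types a b u v x y : F.

(** Near the strict transform of b = 0. If b is not a unit and none of 1, a, a - 1 is
divisible by b, then b(b-1) / a(a-1) is regular and not conversely: of a and a - 1 one is
a unit, and b - 1 is a unit, so the opposite ratio would make b divide the other one. *)
Lemma grid_ratio_div a b : a != 0 -> a != 1 -> b != 0 -> b != 1 ->
  R a -> R b -> R ((b ^+ 2 - b) / (a ^+ 2 - a)) \/ R ((a ^+ 2 - a) / (b ^+ 2 - b)) ->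
  ~ R b^-1 -> ~ R (a / b) -> ~ R ((a - 1) / b) ->
  [/\ R b, R (b / a) & R (b / (a - 1))].
Proof.
move=> a0 a1 b0 b1 Ra Rb Rg nb nab na1b.
have a10 : a - 1 != 0 by rewrite subr_eq0.
have b10 : b - 1 != 0 by rewrite subr_eq0.
have gE (z : F) : z ^+ 2 - z = z * (z - 1) by ring.
rewrite !gE in Rg.
have nub : ~ is_unit R b by case.
have [_ Rb1 Rb1i] : is_unit R (b - 1).
  by rewrite -opprB; apply: (is_unitN sR); exact: local_unit1B.
have Ra1 : R (a - 1) by apply: (subringB sR) => //; exact: (subring1 sR).
have {}Rg : R (b * (b - 1) / (a * (a - 1))).
  case: Rg => // Rg; exfalso.
  have Rab : R (a * (a - 1) / b).
    have -> : a * (a - 1) / b = a * (a - 1) / (b * (b - 1)) * (b - 1).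
      by field; rewrite b0 b10.
    exact: (subringM sR).
  have : is_unit R (a - (a - 1)) by rewrite opprB addrC subrK; exact: (is_unit1 sR).
  case/(localN sR lR Ra Ra1) => -[_ _ Ri].
    apply: na1b; have -> : (a - 1) / b = a^-1 * (a * (a - 1) / b).
      by field; rewrite a0 b0.
    exact: (subringM sR).
  apply: nab; have -> : a / b = (a - 1)^-1 * (a * (a - 1) / b).
    by field; rewrite a10 b0.
  exact: (subringM sR).
split=> //.
  have -> : b / a = b * (b - 1) / (a * (a - 1)) * (b - 1)^-1 * (a - 1).
    by field; rewrite a0 a10 b10.
  by do 2?apply: (subringM sR).
have -> : b / (a - 1) = b * (b - 1) / (a * (a - 1)) * (b - 1)^-1 * a.
  by field; rewrite a0 a10 b10.
by do 2?apply: (subringM sR).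
Qed.

(** Affine equation of three times each of the lines 1, x, x - 1 through (0 : 0 : 1), where 1 is
the line at infinity, plus the line y. *)
Definition pole_den x y := (x * (x - 1)) ^+ 3 * y.

(** The points where y is divisible by 1, x, x - 1 and divides one of them. If y does
not vanish there, neither do the three lines; otherwise y vanishes together with exactly
one of them, to the same order, and [pole_den] is the fourth power of y up to a unit. The
third case is the point at infinity of the line y, with local parameters 1/x and y/x. *)
Lemma transition_cases x y : x != 0 -> x != 1 -> y != 0 ->
  R y -> R (y / x) -> R (y / (x - 1)) ->
  [\/ R y^-1, R (x / y) | R ((x - 1) / y)] ->
  [\/ [/\ R x, R y & is_unit R (pole_den x y)],
      exists u, [/\ u = x \/ u = x - 1, R x, R y,
         ~ is_unit R y & is_unit R (u / y) /\ is_unit R (pole_den x y / y ^+ 4)] |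
      [/\ R x^-1, R (y / x), ~ is_unit R (y / x) , is_unit R y^-1 &
          is_unit R (pole_den x y / x ^+ 10 / (y / x) ^+ 4)]].
Proof.
move=> x0 x1 y0 Ry Ryx Ryx1 H.
have hratio10 : x - 1 != 0 by rewrite subr_eq0.
have Rx1 : R x -> R (x - 1) by move=> Rx; apply: (subringB sR) => //; exact: (subring1 sR).
have unit_of u : R u -> u != 0 -> is_unit R y -> R (y / u) -> is_unit R u.
  move=> Ru u0 [_ _ Ryi] Ryu; split=> //.
  by have -> : u^-1 = y^-1 * (y / u) by [rewrite mulKf]; exact: (subringM sR).
have Case1 : R x -> is_unit R y -> is_unit R (pole_den x y).
  move=> Rx uy; apply: (is_unitM sR) => //; apply: (is_unitX sR); apply: (is_unitM sR).
    exact: unit_of.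
  by apply: unit_of => //; exact: Rx1.
have Case2 u u' : u != 0 -> u' != 0 -> R u -> R (u / y) -> R (y / u) ->
    u' = 1 - u \/ u' = 1 - - u ->
    pole_den x y = (u * u') ^+ 3 * y \/ pole_den x y = - ((u * u') ^+ 3 * y) ->
    ~ is_unit R y -> is_unit R (u / y) /\ is_unit R (pole_den x y / y ^+ 4).
  move=> u0 u'0 Ru Ruy Ryu Eu' ED ny.
  have uw : is_unit R (u / y).
    by split; rewrite ?mulf_neq0 ?invr_eq0 // invfM invrK mulrC.
  have nu : ~ is_unit R u.
    move=> uu; apply: ny; have -> : y = u * (u / y)^-1.
      by rewrite invfM invrK [_^-1 * y]mulrC mulrCA divff ?mulr1.
    by apply: (is_unitM sR) => //; exact: (is_unitV uw).
  have uu' : is_unit R u'.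
    case: Eu' => ->; apply: local_unit1B => //; first exact: (subringN sR).
    by move/(is_unitN sR); rewrite opprK.
  split=> //.
  have H3 : is_unit R ((u * u') ^+ 3 * y / y ^+ 4).
    have -> : (u * u') ^+ 3 * y / y ^+ 4 = (u / y) ^+ 3 * u' ^+ 3 by field.
    by apply: (is_unitM sR); exact: (is_unitX sR).
  by case: ED => -> //; rewrite mulNr; exact: (is_unitN sR).
case: H => [Ryi|Rxy|Rx1y].
- have uy : is_unit R y by [].
  have [ux|nux] := pselect (is_unit R (y / x)).
    constructor 1; have [_ _ +] := ux; rewrite invfM invrK => Rxy.
    have Rx : R x by have -> : x = y * (y^-1 * x) by [rewrite mulVKf]; exact: (subringM sR).
    by split=> //; exact: Case1.
  constructor 3; have Rxi : R x^-1.
    by have -> : x^-1 = y^-1 * (y / x) by [rewrite mulKf]; exact: (subringM sR).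
  split=> //; first exact: (is_unitV uy).
  have nxi : ~ is_unit R x^-1.
    by move=> uxi; apply: nux; exact: (is_unitM sR).
  have u1x := local_unit1B sR lR Rxi nxi.
  have -> : pole_den x y / x ^+ 10 / (y / x) ^+ 4 = y^-1 ^+ 3 * (1 - x^-1) ^+ 3.
    by rewrite /pole_den; field; rewrite x0 y0.
  by apply: (is_unitM sR); apply: (is_unitX sR) => //; exact: (is_unitV uy).
- have Rx : R x by have -> : x = x / y * y by [rewrite divfK]; exact: (subringM sR).
  have [uy|ny] := pselect (is_unit R y).
    by constructor 1; split=> //; exact: Case1.
  constructor 2; exists x; split=> //; first by left.
  apply: (Case2 x (1 - x)) => //; [by rewrite subr_eq0 eq_sym|by left|right].
  by rewrite /pole_den; ring.
have Rx : R x.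
  have -> : x = (x - 1) / y * y + 1 by rewrite divfK // subrK.
  by apply: (subringD sR); [exact: (subringM sR)|exact: (subring1 sR)].
have [uy|ny] := pselect (is_unit R y).
  by constructor 1; split=> //; exact: Case1.
constructor 2; exists (x - 1); split=> //; first by right.
apply: (Case2 (x - 1) x) => //; [exact: Rx1|by right; ring|left].
by rewrite /pole_den; ring.
Qed.

End LineAlgebra.

(** * Substitutions and places *)

Section Place.
Variables (A : idomainType) (L : fieldType) (th : {rmorphism A -> L}).
Local Notation tofrac := (@FracField.tofrac A).
Implicit Types p q d : A.

(** The extension of the ring morphism [th] to the localization of A at its kernel, as a
relation: [z] is the fraction of [p] by [d], with [th d] nonzero. *)
Definition place (z : {fraction A}) (z' : L) := exists p d,
  [/\ th d != 0, z * tofrac d = tofrac p & th p = th d * z'].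


Lemma place_fun z z1 z2 : place z z1 -> place z z2 -> z1 = z2.
Proof.
move=> [p1 [d1 [n1 E1 F1]]] [p2 [d2 [n2 E2 F2]]].
have E : p1 * d2 = p2 * d1.
  apply/eqP; rewrite -tofrac_eq tofracM -E1 tofracM -E2.
  by rewrite mulrAC.
apply: (mulfI (mulf_neq0 n1 n2)).
have := congr1 (th) E; rewrite !rmorphM F1 F2 /= => H.
by rewrite mulrAC H mulrAC; congr (_ * _); exact: mulrC.
Qed.

Lemma placeB z1 z1' z2 z2' : place z1 z1' -> place z2 z2' ->
  place (z1 - z2) (z1' - z2').
Proof.
move=> [p1 [d1 [n1 E1 F1]]] [p2 [d2 [n2 E2 F2]]].
exists (p1 * d2 - p2 * d1), (d1 * d2); split.
- by rewrite rmorphM; exact: mulf_neq0.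
- by rewrite tofracB !tofracM -E1 -E2; ring.
- by rewrite rmorphB !rmorphM F1 F2; ring.
Qed.

Lemma placeM z1 z1' z2 z2' : place z1 z1' -> place z2 z2' ->
  place (z1 * z2) (z1' * z2').
Proof.
move=> [p1 [d1 [n1 E1 F1]]] [p2 [d2 [n2 E2 F2]]].
exists (p1 * p2), (d1 * d2); split.
- by rewrite rmorphM; exact: mulf_neq0.
- by rewrite !tofracM -E1 -E2; ring.
- by rewrite !rmorphM F1 F2; ring.
Qed.

Lemma placeV z z' : place z z' -> z' != 0 -> place z^-1 z'^-1.
Proof.
move=> [p [d [n E F]]] z'0; exists d, p; rewrite F; split; first exact: mulf_neq0.
  have d0 : tofrac d != 0.
    by rewrite tofrac_eq0; apply: contraNneq n => ->; rewrite rmorph0.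
  have z0 : z != 0.
    apply: contraNneq (mulf_neq0 n z'0) => z0; move: E; rewrite z0 mul0r => /esym/eqP.
    by rewrite tofrac_eq0 => /eqP p0; rewrite -F p0 rmorph0.
  by rewrite -E mulKf.
by rewrite mulfK.
Qed.

Lemma place_poly q : place (tofrac q) (th q).
Proof. by exists q, 1; rewrite rmorph1 oner_neq0 tofrac1 mulr1 mul1r. Qed.


Lemma place1 : place 1 1.
Proof. by have := place_poly 1; rewrite rmorph1 tofrac1. Qed.

Lemma placeD z1 z1' z2 z2' : place z1 z1' -> place z2 z2' -> place (z1 + z2) (z1' + z2').
Proof.
move=> H1 H2; have := placeB H1 (placeB (placeB place1 place1) H2).
by rewrite !subrr !sub0r !opprK.
Qed.

Lemma place0 : place 0 0.
Proof. by have := placeB place1 place1; rewrite !subrr. Qed.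

End Place.

Section Evaluation.
Variable k : fieldType.
Local Notation K := (P2_field k).
Local Notation tofrac := (@FracField.tofrac {poly {poly k}}).
Implicit Types (T R : set K) (i j : 'I_3) (x y z v w : K).

Definition kcst_rm : {rmorphism k -> K} := tofrac \o polyC \o polyC.
Definition ev1 x : {rmorphism {poly k} -> K} :=
  horner_morph (fun c => mulrC x (kcst_rm c) : GRing.comm _ _).
(** Substitution of [x] and [y] for the coordinates; the inner variable of
{poly {poly k}} is the first coordinate. *)
Definition ev x y : {rmorphism {poly {poly k}} -> K} :=
  horner_morph (fun q => mulrC y (ev1 x q) : GRing.comm _ _).

Lemma ev1C x c : ev1 x c%:P = kcst c.
Proof. exact: horner_morphC. Qed.
Lemma ev1X x : ev1 x 'X = x.
Proof. exact: horner_morphX. Qed.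
Lemma evC x y q : ev x y q%:P = ev1 x q.
Proof. exact: horner_morphC. Qed.
Lemma evX x y : ev x y 'X = y.
Proof. exact: horner_morphX. Qed.

Lemma ev_closed T x y : is_subring T -> (forall c, T (kcst c)) -> T x -> T y ->
  forall q, T (ev x y q).
Proof.
move=> sT Tc Tx Ty.
have T1 (q : {poly k}) : T (ev1 x q).
  elim/poly_ind: q => [|q c IH]; first by rewrite rmorph0; exact: (subring0 sT).
  rewrite rmorphD rmorphM /= ev1C ev1X; apply: (subringD sT); last exact: Tc.
  exact: (subringM sT).
elim/poly_ind => [|q c IH]; first by rewrite rmorph0; exact: (subring0 sT).
rewrite rmorphD rmorphM /= evC evX; apply: (subringD sT); last exact: T1.
exact: (subringM sT).
Qed.

Lemma ev_split x y q : exists q', ev x y q = ev1 x q`_0 + y * ev x y q' /\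
  q = (q`_0)%:P + 'X * q'.
Proof.
elim/poly_ind: q => [|q c _].
  by exists 0; rewrite coef0 !rmorph0 !mulr0 !addr0.
exists q; rewrite coefD coefMX coefC add0r /=; split; last by rewrite addrC commr_polyX.
by rewrite rmorphD rmorphM /= evC evX addrC mulrC.
Qed.

Lemma range_ev_subring x y : is_subring (range (ev x y)).
Proof.
split; first by exists 1 => //; exact: rmorph1.
- by move=> _ _ [p _ <-] [q _ <-]; exists (p - q) => //; exact: rmorphB.
- by move=> _ _ [p _ <-] [q _ <-]; exists (p * q) => //; exact: rmorphM.
Qed.

Lemma tofrac_ev q : tofrac q = ev (hcoord k 1) (hcoord k 2) q.
Proof.
have T1 (p : {poly k}) : tofrac p%:P = ev1 (hcoord k 1) p.
  elim/poly_ind: p => [|p c IH]; first by rewrite polyC0 tofrac0 rmorph0.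
  by rewrite polyCD polyCM tofracD tofracM IH rmorphD rmorphM /= ev1C ev1X.
elim/poly_ind: q => [|q c IH]; first by rewrite tofrac0 rmorph0.
by rewrite tofracD tofracM IH T1 rmorphD rmorphM /= evC evX.
Qed.

Section PlaceEv.
Variables x y : K.
Local Notation plc := (place (ev x y)).

Lemma place_cst c : plc (kcst c) (kcst c).
Proof. by have := place_poly (ev x y) c%:P%:P; rewrite evC ev1C. Qed.

Lemma placeX : plc (hcoord k 1) x.
Proof. by have := place_poly (ev x y) 'X%:P; rewrite evC ev1X. Qed.

Lemma placeY : plc (hcoord k 2) y.
Proof. by have := place_poly (ev x y) 'X; rewrite evX. Qed.

Lemma place_ev v w v' w' q : plc v v' -> plc w w' ->
  plc (ev v w q) (ev v' w' q).
Proof.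
move=> Hv Hw.
have P0 := place0 (ev x y).
have P1 (p : {poly k}) : plc (ev1 v p) (ev1 v' p).
  elim/poly_ind: p => [|p c IH]; first by rewrite !rmorph0.
  rewrite !rmorphD !rmorphM /= !ev1C !ev1X; apply: placeD; last exact: place_cst.
  exact: placeM.
elim/poly_ind: q => [|q c IH]; first by rewrite !rmorph0.
rewrite !rmorphD !rmorphM /= !evC !evX; apply: placeD => //.
exact: placeM.
Qed.

(** If a place sends w and v to the two coordinates, then v and w are algebraically
independent over k. Only the consequence that v divides no nonzero polynomial in w is
stated. *)
Lemma place_indep v w c q : plc w (hcoord k 1) -> plc v (hcoord k 2) ->
  ev1 w c = v * ev w v q -> c = 0.
Proof.
move=> Hw Hv E.
have P1 : plc (ev1 w c) (tofrac c%:P).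
  by rewrite -(evC w v) tofrac_ev; exact: place_ev.
have P2 : plc (v * ev w v q) (tofrac ('X * q)).
  by rewrite tofracM [tofrac q]tofrac_ev; apply: placeM => //; exact: place_ev.
rewrite -E in P2; have /eqP := place_fun P1 P2.
rewrite tofrac_eq => /eqP/(congr1 (fun p : {poly {poly k}} => p`_0)).
by rewrite coefC coefXM.
Qed.

End PlaceEv.

End Evaluation.

(** * Valuation rings of the projective line *)

Section Fractions.
Variable F : fieldType.
Implicit Types a b c d e f : F.

Lemma subf_div a b c d : b != 0 -> d != 0 -> a / b - c / d = (a * d - c * b) / (b * d).
Proof. by move=> b0 d0; field; rewrite b0 d0. Qed.

Lemma div_eq_mulrr a b c : c != 0 -> a / b = a * c / b / c.
Proof. by move=> c0; rewrite mulrAC mulfK. Qed.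

Lemma div_eq_mulrl a b c : c != 0 -> a / b = a / (b * c) * c.
Proof. by move=> c0; rewrite invfM mulrA divfK. Qed.

Lemma mulf_div_eq a b c d e : b != 0 -> d != 0 -> a / b * e = c / d -> a * e * d = c * b.
Proof.
move=> b0 d0 E; rewrite -[c in RHS](divfK d0) -E; by field.
Qed.

Lemma divf_common p d p1 d1 f c e : (d : F) != 0 -> d1 != 0 -> f != 0 -> c != 0 -> e != 0 ->
  e * p = p1 * f -> c * d = d1 * f -> p / d = (c * p1) / (e * d1).
Proof.
move=> d0 d10 f0 c0 e0 Ep Ed.
have -> : p = p1 * f / e by rewrite -Ep mulrC mulKf.
have -> : d = d1 * f / c by rewrite -Ed mulrC mulKf.
by field; rewrite c0 e0 d10 f0.
Qed.

End Fractions.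

Lemma ltn_pred_addl a b c m : a = (b + c).-1%N -> (0 < b)%N -> (1 < c)%N ->
  (a <= m.+1)%N -> (b <= m)%N.
Proof. lia. Qed.

Section PolynomialDVR.
Variable A : idomainType.
Local Notation P := {poly A}.
Local Notation K := {fraction P}.
Local Notation tofrac := (@FracField.tofrac P).
Implicit Types (p q d pi : P) (z : K).

(** The divisibility of {poly A} is pseudo-divisibility, that is divisibility over the
fraction field L of A: these are the local rings of the closed points of the affine line
over L. *)
Definition ring_at pi : set K :=
  [set z | exists p d, ~~ (pi %| d) /\ z = tofrac p / tofrac d].

(** The local ring of the projective line over the fraction field of A at infinity. *)
Definition ring_inf : set K :=
  [set z | exists p d, [/\ d != 0, (size p <= size d)%N & z = tofrac p / tofrac d]].

Lemma size_mul_le p q : (size (p * q)%R <= (size p + size q).-1)%N.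
Proof. exact: size_polyMleq. Qed.

Lemma size_mul_eq p q : p != 0 -> q != 0 -> size (p * q) = (size p + size q).-1%N.
Proof. exact: size_mul. Qed.

Lemma size_gt0 p : p != 0 -> (0 < size p)%N.
Proof. by rewrite size_poly_gt0. Qed.

Lemma tofrac_neq0 d : d != 0 -> tofrac d != 0.
Proof. by rewrite tofrac_eq0. Qed.

Lemma frac_neq0 p d : p != 0 -> d != 0 -> tofrac p / tofrac d != 0.
Proof. by move=> p0 d0; rewrite mulf_neq0 ?invr_eq0 ?tofrac_neq0. Qed.

Lemma ring_inf_subring : is_subring ring_inf.
Proof.
split.
- by exists 1, 1; rewrite oner_neq0 tofrac1 divr1.
- move=> _ _ [p [d [d0 pd ->]]] [q [e [e0 qe ->]]].
  exists (p * e - q * d), (d * e); split; first by rewrite mulf_neq0.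
    rewrite size_mul_eq //; apply: leq_trans (size_polyD _ _) _.
    rewrite size_polyN geq_max; apply/andP; split.
      by apply: leq_trans (size_mul_le _ _) _; lia.
    by apply: leq_trans (size_mul_le _ _) _; lia.
  by rewrite subf_div ?tofrac_neq0 // tofracB !tofracM.
move=> _ _ [p [d [d0 pd ->]]] [q [e [e0 qe ->]]].
exists (p * q), (d * e); split; first by rewrite mulf_neq0.
  by rewrite (size_mul_eq d0 e0); apply: leq_trans (size_mul_le _ _) _; lia.
by rewrite !tofracM mulf_div.
Qed.

Lemma ring_inf_unit p d : p != 0 -> d != 0 -> size p = size d ->
  is_unit ring_inf (tofrac p / tofrac d).
Proof.
move=> p0 d0 E; split; first by rewrite mulf_neq0 ?invr_eq0 ?tofrac_neq0.
  by exists p, d; rewrite d0 E.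
by exists d, p; rewrite p0 E invfM invrK mulrC.
Qed.

Lemma ring_infX : ~ ring_inf (tofrac 'X).
Proof.
move=> [p [d [d0 pd E]]].
have : tofrac ('X * d) = tofrac p by rewrite tofracM E divfK ?tofrac_neq0.
move/eqP; rewrite tofrac_eq => /eqP Ep; move: pd; rewrite -Ep size_mul_eq ?polyX_eq0 //.
by rewrite size_polyX; move: d0; rewrite -size_poly_gt0; lia.
Qed.

Lemma ring_infVX : ring_inf (tofrac 'X)^-1.
Proof. by exists 1, 'X; rewrite polyX_eq0 size_polyX size_poly1 tofrac1 mul1r. Qed.

Lemma uniformizer_inf : uniformizer ring_inf (tofrac 'X)^-1.
Proof.
have X0 : tofrac 'X != 0 by rewrite tofrac_neq0 // polyX_eq0.
split; rewrite ?invr_eq0 ?invrK //; [exact: ring_infVX|exact: ring_infX|].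
move=> z z0; have [p [d Ez]] := fraction_repr z.
have [p0 d0] : p != 0 /\ d != 0.
  by split; apply: contraNneq z0 => E; rewrite Ez E tofrac0 ?invr0 ?mul0r ?mulr0.
exists ((size d)%:Z - (size p)%:Z).
have [le|lt] := leqP (size p) (size d).
  exists (tofrac (p * 'X^(size d - size p)) / tofrac d); split.
    apply: ring_inf_unit; rewrite ?mulf_neq0 ?expf_neq0 ?polyX_eq0 //.
    by rewrite size_mulXn // subnK.
  rewrite subzn // -exprnP exprVn tofracM tofracXn Ez.
  exact: (div_eq_mulrr (tofrac p) (tofrac d) (expf_neq0 _ X0)).
exists (tofrac p / tofrac (d * 'X^(size p - size d))); split.
  apply: ring_inf_unit; rewrite ?mulf_neq0 ?expf_neq0 ?polyX_eq0 //.
  by rewrite size_mulXn // subnK // ltnW.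
have -> : (size d)%:Z - (size p)%:Z = - (size p - size d)%N%:Z.
  by rewrite -subzn ?opprB // ltnW.
rewrite -invr_expz -exprnP exprVn invrK tofracM tofracXn Ez.
exact: (div_eq_mulrl (tofrac p) (tofrac d) (expf_neq0 _ X0)).
Qed.

Section AtPrime.
Variables (pi : P) (pi_irr : irreducible_poly pi).

Lemma irr_prime p q : pi %| p * q -> (pi %| p) || (pi %| q).
Proof.
have [//|np] := boolP (pi %| p); rewrite Gauss_dvdpr //.
rewrite coprimep_sym; have := np.
have [_ irr] := pi_irr; move=> npi; rewrite coprimep_sym /coprimep.
apply: contraNT npi => /irr/(_ (dvdp_gcdl _ _)) /eqp_dvdl <-.
exact: dvdp_gcdr.
Qed.

Lemma ndvd_neq0 d : ~~ (pi %| d) -> d != 0.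
Proof. by apply: contraNneq => ->; rewrite dvdp0. Qed.

Lemma ndvd_const (c : A) : c != 0 -> ~~ (pi %| c%:P).
Proof.
move=> c0; apply/negP => /dvdp_leq; rewrite polyC_eq0 c0 size_polyC c0 => /(_ isT).
by case: pi_irr => + _; lia.
Qed.

Lemma ring_at_unit p d : ~~ (pi %| p) -> ~~ (pi %| d) ->
  is_unit (ring_at pi) (tofrac p / tofrac d).
Proof.
move=> np nd; split.
- exact: frac_neq0 (ndvd_neq0 np) (ndvd_neq0 nd).
- by exists p, d.
- by exists d, p; rewrite invfM invrK mulrC.
Qed.

Lemma ring_at_subring : is_subring (ring_at pi).
Proof.
have n1 : ~~ (pi %| 1) by rewrite -polyC1; apply: ndvd_const; exact: oner_neq0.
have nM d e : ~~ (pi %| d) -> ~~ (pi %| e) -> ~~ (pi %| d * e).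
  by move=> nd ne; apply/negP => /irr_prime; rewrite (negPf nd) (negPf ne).
split.
- by exists 1, 1; rewrite tofrac1 divr1.
- move=> _ _ [p [d [nd ->]]] [q [e [ne ->]]].
  exists (p * e - q * d), (d * e); split; first exact: nM.
  by rewrite (subf_div _ _ (tofrac_neq0 (ndvd_neq0 nd)) (tofrac_neq0 (ndvd_neq0 ne))) tofracB !tofracM.
move=> _ _ [p [d [nd ->]]] [q [e [ne ->]]].
exists (p * q), (d * e); split; first exact: nM.
by rewrite !tofracM mulf_div.
Qed.

Lemma ring_at_poly p : ring_at pi (tofrac p).
Proof.
exists p, 1; rewrite tofrac1 divr1; split=> //.
by rewrite -polyC1; apply: ndvd_const; exact: oner_neq0.
Qed.

(** The factor [c] is a unit of [ring_at pi]. *)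
Lemma multiplicity_irr p : p != 0 -> exists n c q,
  [/\ c != 0, ~~ (pi %| q) & c *: p = pi ^+ n * q].
Proof.
move: {2}(size p) (leqnn (size p)) => m; elim: m p => [|m IH] p.
  by rewrite leqn0 size_poly_eq0 => /eqP ->; rewrite eqxx.
move=> pm p0; have [dv|ndv] := boolP (pi %| p); last first.
  by exists 0%N, 1, p; rewrite oner_neq0 scale1r mul1r.
move: (dv); rewrite Pdiv.WeakIdomain.dvdp_eq => /eqP Ep.
set c := lead_coef pi ^+ _ in Ep; set p1 := p %/ pi in Ep.
have [sz _] := pi_irr.
have pi0 : pi != 0 by rewrite -size_poly_gt0; lia.
have c0 : c != 0 by rewrite expf_neq0 // lead_coef_eq0.
have p10 : p1 != 0.
  apply: contraNneq p0 => p10; have := Ep; rewrite p10 mul0r => /eqP.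
  by rewrite scale_poly_eq0 (negPf c0).
have sp : (size p1 <= m)%N.
  have Es : size p = (size p1 + size pi).-1%N.
    by rewrite -(size_scale p c0) Ep (size_mul_eq p10 pi0).
  exact: ltn_pred_addl Es (size_gt0 p10) sz pm.
have [n [c1 [q [c10 nq E]]]] := IH _ sp p10.
exists n.+1, (c1 * c), q; split=> //; first by rewrite mulf_neq0.
by rewrite -scalerA Ep scalerAl E exprS mulrAC [pi * _]mulrC.
Qed.

Lemma uniformizer_at : uniformizer (ring_at pi) (tofrac pi).
Proof.
have [sz _] := pi_irr.
have pi0 : pi != 0 by rewrite -size_poly_gt0; lia.
have fpi0 := tofrac_neq0 pi0.
split=> //; first exact: ring_at_poly.
  move=> [p [d [nd E]]]; case/negP: (nd).
  suff -> : d = pi * p by exact: dvdp_mulIl.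
  apply/eqP; rewrite -tofrac_eq tofracM.
  have -> : tofrac p = (tofrac pi)^-1 * tofrac d.
    by rewrite E (divfK (tofrac_neq0 (ndvd_neq0 nd))).
  by rewrite (mulVKf fpi0).
move=> z z0; have [p [d Ez]] := fraction_repr z.
have [p0 d0] : p != 0 /\ d != 0.
  by split; apply: contraNneq z0 => E; rewrite Ez E tofrac0 ?invr0 ?mul0r ?mulr0.
have key q : q != 0 -> exists n u, is_unit (ring_at pi) u /\ tofrac q = u * tofrac pi ^+ n.
  move=> /multiplicity_irr[n [c [q' [c0 nq' E]]]].
  exists n, (tofrac q' / tofrac c%:P); split; first by apply: ring_at_unit => //; exact: ndvd_const.
  have fc0 : tofrac c%:P != 0 by rewrite tofrac_neq0 // polyC_eq0.
  apply: (mulfI fc0); rewrite -tofracM mul_polyC E tofracM tofracXn.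
  by rewrite mulrA (mulrC _ (tofrac q' / _)) divfK // mulrC.
have [n [u [uu Ep]]] := key _ p0; have [m [w [uw Ed]]] := key _ d0.
exists (n%:Z - m%:Z), (u / w); split.
  by apply: (is_unitM ring_at_subring); [exact: uu|exact: (is_unitV uw)].
by rewrite (expfzDr _ _ fpi0) -invr_expz -!exprnP Ez Ep Ed -mulf_div.
Qed.

End AtPrime.

Lemma irreducible_factor p : (1 < size p)%N -> exists2 pi, irreducible_poly pi & pi %| p.
Proof.
move: {2}(size p) (leqnn (size p)) => m; elim: m p => [|m IH] p.
  by rewrite leqn0 => /eqP ->.
move=> pm p1; have p0 : p != 0 by rewrite -size_poly_gt0; lia.
have [irr|] := pselect (irreducible_poly p); first by exists p => //; exact: dvdpp.
move=> nirr; have : exists q, [/\ size q != 1, q %| p & ~~ (q %= p)].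
  apply: contrapT => H; apply: nirr; split=> // q q1 qp.
  by apply: contrapT => /negP nqp; apply: H; exists q.
move=> [q [q1 qp nqp]].
have q0 : q != 0 by apply: contraTneq qp => ->; rewrite dvd0p.
have szq : (size q < size p)%N by rewrite ltn_neqAle dvdp_leq // andbT dvdp_size_eqp.
have qm : (size q <= m)%N by move: szq pm; lia.
have szq1 : (1 < size q)%N by move: (size_gt0 q0) q1; case: (size q) => [|[]].
have [pi irr piq] := IH q qm szq1.
by exists pi => //; exact: dvdp_trans qp.
Qed.

(** Induction on the degree of the denominator: an irreducible factor of the denominator
at which z is regular also divides the numerator. *)
Lemma regular_at_all z : (forall pi, irreducible_poly pi -> ring_at pi z) ->
  exists p c, c != 0 /\ z = tofrac p / tofrac c%:P.
Proof.
move=> Hz; have [p [d Ez]] := fraction_repr z.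
have [z0|z0] := eqVneq z 0.
  by exists 0, 1; rewrite oner_neq0 tofrac0 mul0r.
have d0 : d != 0 by apply: contraNneq z0 => E; rewrite Ez E tofrac0 invr0 mulr0.
move: {2}(size d) (leqnn (size d)) => m; elim: m p d Ez d0 => [|m IH] p d Ez d0 dm.
  by exfalso; move: dm; rewrite leqn0 size_poly_eq0 (negPf d0).
have [d1|d1] := leqP (size d) 1.
  exists p, d`_0; rewrite -size1_polyC //; split=> //.
  by apply: contraNneq d0 => E; rewrite (size1_polyC d1) E.
have [pi irr pid] := irreducible_factor d1.
have [p' [d' [nd' Ez']]] := Hz _ irr.
have d'0 := ndvd_neq0 nd'.
have E : p * d' = p' * d.
  apply/eqP; rewrite -tofrac_eq !tofracM -[tofrac p](divfK (tofrac_neq0 d0)) -Ez Ez'.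
  by rewrite mulrAC (divfK (tofrac_neq0 d'0)).
have : pi %| p * d' by rewrite E dvdp_mull.
case/(irr_prime irr)/orP => [pip|]; last by rewrite (negPf nd').
move: pid pip; rewrite !Pdiv.WeakIdomain.dvdp_eq => /eqP Ed /eqP Ep.
have [sz _] := irr; have pi0 : pi != 0 by rewrite -size_poly_gt0; lia.
have l0 n : lead_coef pi ^+ n != 0 by rewrite expf_neq0 // lead_coef_eq0.
set c := lead_coef pi ^+ _ in Ed; set e := lead_coef pi ^+ _ in Ep.
have [c0 e0] : c != 0 /\ e != 0 by split; exact: l0.
have dpi0 : d %/ pi != 0.
  apply: contraNneq d0 => E0; have := Ed; rewrite E0 mul0r => /eqP.
  by rewrite scale_poly_eq0 (negPf c0).
have fc0 : tofrac c%:P != 0 by rewrite tofrac_neq0 // polyC_eq0.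
have fe0 : tofrac e%:P != 0 by rewrite tofrac_neq0 // polyC_eq0.
apply: (IH (c *: (p %/ pi)) (e *: (d %/ pi))).
- rewrite Ez -!mul_polyC !tofracM.
  apply: (divf_common (tofrac_neq0 d0) (tofrac_neq0 dpi0) (tofrac_neq0 pi0) fc0 fe0).
    by rewrite -!tofracM mul_polyC Ep.
  by rewrite -!tofracM mul_polyC Ed.
- by rewrite scale_poly_eq0 negb_or e0.
rewrite size_scale //.
have Es : size d = (size (d %/ pi)%R + size pi).-1%N.
  by rewrite -(size_scale d c0) Ed (size_mul_eq dpi0 pi0).
exact: ltn_pred_addl Es (size_gt0 dpi0) sz dm.
Qed.

(** A regular function on the projective line that vanishes at infinity is 0. *)
Lemma regular_fibre_eq0 z : (forall pi, irreducible_poly pi -> ring_at pi z) ->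
  ring_inf (z * tofrac 'X) -> z = 0.
Proof.
move=> /regular_at_all[p [c [c0 ->]]] [q [d [d0 qd E]]].
have fc0 : tofrac c%:P != 0 by rewrite tofrac_neq0 // polyC_eq0.
suff -> : p = 0 by rewrite tofrac0 mul0r.
have {}E : p * 'X * d = q * c%:P.
  apply/eqP; rewrite -tofrac_eq !tofracM; apply/eqP.
  exact: mulf_div_eq fc0 (tofrac_neq0 d0) E.
apply/eqP; rewrite -size_poly_eq0; apply: contraTT (qd) => p0.
have p0' : p != 0 by rewrite -size_poly_eq0.
have Es : (size p + size d)%N = size q.
  have pX0 : p * 'X != 0 by rewrite mulf_neq0 ?polyX_eq0.
  have := size_mul_eq pX0 d0; rewrite E [q * _]mulrC size_Cmul // size_mulX // => ->.
by rewrite -ltnNge -Es -[X in (X < _)%N]add0n ltn_add2r size_gt0.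
Qed.

End PolynomialDVR.

(** * Orders along exceptional curves *)

Section LocalParameter.
Variables (F : fieldType) (R : set F) (sR : is_subring R) (dR : is_dvr R).
Variables (v : F) (A A0 : set F).
Hypotheses (v0 : v != 0) (nv : ~ is_unit R v) (sA : is_subring A) (Av : A v).
Hypotheses (AR : A `<=` R) (RA : R `<=` fracs R A).
Hypotheses (A0A : A0 `<=` A) (A0M : forall a b, A0 a -> A0 b -> A0 (a * b)).
Hypotheses (Asplit : forall a, A a -> exists a0 a1, [/\ A0 a0, A a1 & a = a0 + v * a1]).
Hypotheses (A0v : forall a b, A0 a -> A b -> a = v * b -> a = 0).

(** Here A is a polynomial ring A0[v], where A0 does not meet v A outside 0, and R is a
discrete valuation ring that localizes A. If the maximal ideal met A0 in some b <> 0, then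
v ^ ord b / b ^ ord v would be a unit of R, that is a fraction d / e of elements of A not
divisible by v; clearing denominators shows that v divides a power of b times the
constant term of d. So the maximal ideal is generated by v. *)
Lemma ord_eq1 : ord R v = 1.
Proof.
have Rv : R v by exact: AR.
have v_gt0 := ord_gt0 sR dR v0 Rv nv.
have [t t0 ord_t] := ord_eq1_exists sR dR.
have nuv a : R a -> ~ is_unit R (v * a).
  by move=> Ra /(is_unit_factor sR Rv Ra).
have Rt : R t by apply/(ord_ge0 sR dR t0); rewrite ord_t.
have [a [s [Aa As us Et]]] := RA Rt.
have [s0 _ _] := us.
have Ea : a = t * s by rewrite Et divfK.
have a0 : a != 0 by rewrite Ea mulf_neq0.
have ord_a : ord R a = 1 by rewrite Ea (ordM sR dR) // ord_t (ord_unit sR dR us) addr0.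
have nua : ~ is_unit R a by move=> /(ord_unit sR dR); rewrite ord_a.
have [b [c [A0b Ac Eabc]]] := Asplit Aa.
have [b0|b0] := eqVneq b 0.
  have c0 : c != 0 by apply: contraNneq a0 => c0; rewrite Eabc b0 c0 mulr0 addr0.
  have : 0 <= ord R c by apply/(ord_ge0 sR dR c0); exact: AR.
  by move: ord_a; rewrite Eabc b0 add0r (ordM sR dR) //; lia.
exfalso; have Rb : R b by apply/AR/A0A.
have Rc : R c by exact: AR.
have nub : ~ is_unit R b.
  have -> : b = a - v * c by rewrite Eabc addrK.
  by move/(localN sR (dvr_local sR dR) (AR Aa) (subringM sR Rv Rc)) => [//|/(nuv _ Rc)].
have b_gt0 := ord_gt0 sR dR b0 Rb nub.
have [n En] : exists n : nat, ord R v = n by exists `|ord R v|%N; lia.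
have [r Er] : exists r : nat, ord R b = r.+1 by exists `|ord R b|.-1; lia.
pose z := v ^+ r.+1 / b ^+ n.
have z0 : z != 0 by rewrite mulf_neq0 ?invr_eq0 ?expf_neq0.
have uz : is_unit R z.
  apply: (ord_eq0 sR dR z0).
  rewrite (ordM sR dR) ?invr_eq0 ?expf_neq0 // (ordV sR dR) ?expf_neq0 //.
  by rewrite !(ordX sR dR) // En Er mulrC subrr.
have [_ Rz _] := uz.
have [d [e [Ad Ae ue Ez]]] := RA Rz; have [e0 _ _] := ue.
have ud : is_unit R d by rewrite -(divfK e0 d) -Ez; exact: (is_unitM sR).
have [f [g [A0f Ag Ed]]] := Asplit Ad.
have f0 : f != 0.
  apply/eqP => f0; apply: (nuv _ (AR Ag)); by move: ud; rewrite Ed f0 add0r.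
have A0bn m : A0 (b ^+ m * f).
  by elim: m => [|m IH]; rewrite ?mul1r // exprS -mulrA; exact: A0M.
have bf0 : b ^+ n * f != 0 by rewrite mulf_neq0 ?expf_neq0.
have bn0 : b ^+ n != 0 by rewrite expf_neq0.
have E : v ^+ r.+1 * e = b ^+ n * d.
  have -> : v ^+ r.+1 = z * b ^+ n by rewrite divfK.
  by rewrite Ez mulrAC divfK // mulrC.
move/eqP: bf0; apply; apply: (A0v (b := v ^+ r * e - b ^+ n * g)) => //.
  apply: (subringB sA); apply: (subringM sA) => //; apply: (subringX sA) => //; exact: A0A.
rewrite mulrBr mulrA -exprS E Ed; ring.
Qed.

End LocalParameter.

Section FrameAlgebra.
Variables (F : fieldType) (R T : set F) (sR : is_subring R) (lR : local_ring R).
Hypotheses (sT : is_subring T) (TR : T `<=` R) (Tu : unit_closed R T).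
Implicit Types u v w x y z : F.

(** [z] is a unit times [v], where the unit lies in T. *)
Definition assoc_in v z := exists t, [/\ T t, is_unit R t & z = v * t].

Lemma assoc_div v z1 z2 : v != 0 -> assoc_in v z1 -> assoc_in v z2 -> T (z2 / z1).
Proof.
move=> v0 [t1 [T1 u1 ->]] [t2 [T2 u2 ->]]; have [t0 _ _] := u1.
have -> : v * t2 / (v * t1) = t2 * t1^-1 by field; rewrite v0 t0.
by apply: (subringM sT) => //; exact: Tu.
Qed.

Lemma nonunit_sub1 z : R z -> ~ is_unit R z -> is_unit R (z - 1).
Proof. by move=> Rz nz; rewrite -opprB; apply: (is_unitN sR); exact: local_unit1B. Qed.

Lemma assoc_grid v : T v -> ~ is_unit R v -> assoc_in v (v ^+ 2 - v).
Proof.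
move=> Tv nv; exists (v - 1); split; last by ring.
  by apply: (subringB sT) => //; exact: (subring1 sT).
by apply: nonunit_sub1 => //; exact: TR.
Qed.

Lemma nonunit_mul v w : R v -> ~ is_unit R v -> is_unit R w -> ~ is_unit R (w * v).
Proof. by move=> Rv nv [_ Rw _]; rewrite mulrC => /(is_unit_factor sR Rv Rw). Qed.

Lemma assoc_grid_mul v w : T v -> ~ is_unit R v -> T w -> is_unit R w ->
  assoc_in v ((w * v) ^+ 2 - w * v).
Proof.
move=> Tv nv Tw uw; exists (w * (w * v - 1)); split; last by ring.
  by apply: (subringM sT) => //; apply: (subringB sT); [exact: (subringM sT)|exact: (subring1 sT)].
apply: (is_unitM sR) => //; apply: nonunit_sub1; first by apply: TR; exact: (subringM sT).
by apply: nonunit_mul => //; exact: TR.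
Qed.

Lemma assoc_grid_mul1 v w : T v -> ~ is_unit R v -> T w -> is_unit R w ->
  assoc_in v ((w * v + 1) ^+ 2 - (w * v + 1)).
Proof.
move=> Tv nv Tw uw; exists (w * (w * v + 1)); split; last by ring.
  by apply: (subringM sT) => //; apply: (subringD sT); [exact: (subringM sT)|exact: (subring1 sT)].
apply: (is_unitM sR) => //; rewrite -[_ + 1]opprK opprD; apply: (is_unitN sR).
rewrite -mulNr; apply: nonunit_sub1; first by apply: TR; apply: (subringM sT) => //; exact: (subringN sT).
by apply: nonunit_mul => //; [exact: TR|exact: (is_unitN sR)].
Qed.

Lemma unit_grid_inv v w : T v -> ~ is_unit R v -> T w -> is_unit R w ->
  let x := w * v + 1 in
  [/\ is_unit R x, T x^-1, T (v / x), assoc_in v (x^-1 ^+ 2 - x^-1) &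
      assoc_in v ((v / x) ^+ 2 - v / x)].
Proof.
move=> Tv nv Tw uw x.
have Tx : T x by apply: (subringD sT); [exact: (subringM sT)|exact: (subring1 sT)].
have ux : is_unit R x.
  rewrite /x -[_ + 1]opprK opprD; apply: (is_unitN sR).
  rewrite -mulNr; apply: nonunit_sub1; first by apply: TR; apply: (subringM sT) => //; exact: (subringN sT).
  by apply: nonunit_mul => //; [exact: TR|exact: (is_unitN sR)].
have Txi := Tu Tx ux; have uxi := is_unitV ux; have [x0 Rx Rxi] := ux.
split=> //; first exact: (subringM sT).
  exists (- w * x^-1 ^+ 2); split.
  - by apply: (subringM sT); [exact: (subringN sT)|exact: (subringX sT)].
  - by apply: (is_unitM sR); [exact: (is_unitN sR)|exact: (is_unitX sR)].
  - have E : 1 - x = - (w * v) by rewrite /x; ring.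
    have -> : x^-1 ^+ 2 - x^-1 = (1 - x) * x^-1 ^+ 2 by field.
    by rewrite E; ring.
exists ((v * x^-1 - 1) * x^-1); split.
- by apply: (subringM sT) => //; apply: (subringB sT); [exact: (subringM sT)|exact: (subring1 sT)].
- apply: (is_unitM sR) => //; apply: nonunit_sub1; first by apply: TR; exact: (subringM sT).
  by rewrite mulrC; apply: nonunit_mul => //; exact: TR.
by ring.
Qed.

End FrameAlgebra.

Section ExceptionalOrder.
Variable k : fieldType.
Local Notation K := (P2_field k).
Local Notation P2chart_ := (@P2chart k).
Local Notation "x_[ i , j ]" := (@hcoord k i / @hcoord k j) (at level 0, format "x_[ i ,  j ]").
Local Notation XX := (blowup_P2 k).
Local Notation X := (hcoord k 1).
Local Notation Y := (hcoord k 2).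

Lemma P2chart_cst j c : P2chart_ j (kcst c).
Proof. exact: base_change_cst. Qed.

Lemma P2chart_ratio i j : P2chart_ j x_[i, j].
Proof. by apply: sub_base_change; exact: F2chart_ratio. Qed.

Lemma stalk_cst (x : point XX) c : stalk x (kcst c).
Proof. by have [j [i1 [i2 [_ + _ _]]]] := blowup_point_gen x; apply; exact: P2chart_cst. Qed.

(** On a point of codimension 1 over an F_2-point, a parameter v of which the other
parameter is a multiple w v has order 1. In every chart that contains the point, the grid
polynomials are v up to units, so the local ring is generated by v and w, and the place
shows that these are independent. *)
Lemma ord_exceptional (x : point XX) (v w xx yy : K) : is_dvr (stalk x) ->
  v != 0 -> stalk x v -> ~ is_unit (stalk x) v -> stalk x w ->
  place (ev xx yy) w X -> place (ev xx yy) v Y ->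
  (forall T, is_subring T -> T `<=` stalk x -> unit_closed (stalk x) T ->
     T v -> T w -> forall j, P2chart_ j `<=` stalk x -> (forall i, T x_[i, j]) /\
     forall i, i != j -> assoc_in (stalk x) T v (grid k j i)) ->
  ord (stalk x) v = 1.
Proof.
move=> dx v0 Rv nv Rw pw pv H.
have sR := stalk_subring x; have lR := @stalk_local _ _ x.
have sA := range_ev_subring w v.
have Av : range (ev w v) v by exists 'X => //; exact: evX.
have A1 p : range (ev w v) (ev1 w p) by exists p%:P => //; exact: evC.
have Ac c : range (ev w v) (kcst c) by rewrite -(ev1C w c); exact: A1.
have AR : range (ev w v) `<=` stalk x.
  by move=> _ [p _ <-]; apply: ev_closed => // c; exact: stalk_cst.
have RA : stalk x `<=` fracs (stalk x) (range (ev w v)).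
  (* T is closed under the inverses of units, so it contains the ratio of grid
     polynomials that generates the local ring. *)
  set T := fracs _ _.
  have sT : is_subring T by exact: fracs_subring.
  have TR : T `<=` stalk x by exact: fracs_sub.
  have Tu : unit_closed (stalk x) T by exact: fracs_unit_closed.
  have AT : range (ev w v) `<=` T by exact: sub_fracs.
  have Tv : T v by exact: AT.
  have Tw : T w by apply: AT; exists 'X%:P => //; rewrite evC ev1X.
  have [j [i1 [i2 [[i1j i2j _ _] CR _ gen]]]] := blowup_point_gen x.
  have [Tx Tg] := H T sT TR Tu Tv Tw j CR.
  apply: gen => // [c|]; first by apply: AT; exact: Ac.
  exact: assoc_div (Tg _ i1j) (Tg _ i2j).
apply: (ord_eq1 sR dx v0 nv sA Av AR RA (A0 := range (ev1 w))).
- by move=> _ [p _ <-].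
- by move=> _ _ [p _ <-] [q _ <-]; exists (p * q) => //; exact: rmorphM.
- move=> _ [p _ <-]; have [q [E _]] := ev_split w v p.
  by exists (ev1 w p`_0), (ev w v q); split.
- move=> _ _ [p _ <-] [q _ <-] E.
  by rewrite (place_indep pw pv E) rmorph0.
Qed.

End ExceptionalOrder.

(** * Local rings of the plane at F_2-points *)

Section F2Stalks.
Variable k : fieldType.
Local Notation K := (P2_field k).
Local Notation tofrac := (@FracField.tofrac {poly {poly k}}).
Local Notation P2chart_ := (@P2chart k).
Local Notation "x_[ i , j ]" := (@hcoord k i / @hcoord k j) (at level 0, format "x_[ i ,  j ]").
Local Notation Y := (hcoord k 2).
Local Notation P2_F2stalk_ := (@P2_F2stalk k).
Local Notation ringinf := (@ring_inf {poly k}).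
Implicit Types (a : 'rV['F_2]_3) (i j : 'I_3) (R : set K).

(** The ideal of the point [a] in the j-th chart of the plane. *)
Definition point_ideal j a : set K := smallest (is_ideal (P2chart_ j)) (@F2point_eqs k j a).
Definition centred j a i : K := x_[i, j] - (a 0 i : nat)%:R.

Lemma subring_nat T n : is_subring T -> (T : set K) n%:R.
Proof.
move=> sT; elim: n => [|n IH]; first exact: (subring0 sT).
by rewrite -natr1; apply: (subringD sT) => //; exact: (subring1 sT).
Qed.

Lemma P2chart_centred j a i : P2chart_ j (centred j a i).
Proof.
have sP := P2chart_subring k j.
by apply: (subringB sP); [exact: P2chart_ratio|exact: subring_nat].
Qed.

Lemma point_idealP j a : is_ideal (P2chart_ j) (point_ideal j a).
Proof.
have sP := P2chart_subring k j; split.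
- move=> z; apply; split; last by move=> _ [i _ <-]; exact: P2chart_centred.
  split=> //; [exact: (subring0 sP)|exact: (subringB sP)|].
  by move=> b z' Pb Pz; exact: (subringM sP).
- by move=> I [[_ I0 _ _] _].
- by move=> x y Ix Iy I HI; have [[_ _ IB _] _] := HI; apply: (IB); [exact: Ix|exact: Iy].
- by move=> b x Pb Ix I HI; have [[_ _ _ IM] _] := HI; apply: (IM) => //; exact: Ix.
Qed.

Lemma point_ideal_centred j a i : point_ideal j a (centred j a i).
Proof. by move=> I [_]; apply; exists i. Qed.

Lemma kcst1 : kcst 1 = 1 :> K.
Proof. by rewrite /kcst !polyC1 tofrac1. Qed.
Lemma kcstB c d : kcst (c - d) = kcst c - kcst d :> K.
Proof. by rewrite /kcst !polyCB tofracB. Qed.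
Lemma kcstM c d : kcst (c * d) = kcst c * kcst d :> K.
Proof. by rewrite /kcst !polyCM tofracM. Qed.
Lemma kcst0 : kcst 0 = 0 :> K.
Proof. by rewrite /kcst !polyC0 tofrac0. Qed.
Lemma kcst_nat n : kcst n%:R = n%:R :> K.
Proof. exact: (rmorph_nat (kcst_rm k) n). Qed.

Lemma kcst_unit R c : is_subring R -> (forall c, R (kcst c)) -> c != 0 -> is_unit R (kcst c).
Proof.
move=> sR Rc c0; have E : kcst c * kcst c^-1 = 1 :> K.
  by apply: etrans (esym (kcstM c c^-1)) _; rewrite (divff c0); exact: kcst1.
have : is_unit R (kcst c * kcst c^-1) by rewrite E; exact: (is_unit1 sR).
exact: (is_unit_factor sR (Rc _) (Rc _)).
Qed.

(** F_2-points have residue field k. *)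
Lemma point_residue j a z : P2chart_ j z -> exists c, point_ideal j a (z - kcst c).
Proof.
have sP := P2chart_subring k j; have [IP I0 IB IM] := point_idealP j a.
have ID u v : point_ideal j a u -> point_ideal j a v -> point_ideal j a (u + v).
  by move=> Iu Iv; rewrite -[v]opprK -[- v]sub0r; apply: (IB) => //; exact: (IB).
suff : P2chart_ j `<=` [set z | P2chart_ j z /\ exists c, point_ideal j a (z - kcst c)].
  by move=> H /H[].
apply: P2chart_min.
- split.
  + by split; [exact: (subring1 sP)|exists 1; rewrite kcst1 subrr].
  + move=> u v [Pu [c Ic]] [Pv [d Id]]; split; first exact: (subringB sP).
    exists (c - d); have -> : u - v - kcst (c - d) = u - kcst c - (v - kcst d).
      by rewrite kcstB; ring.
    exact: (IB).
  + move=> u v [Pu [c Ic]] [Pv [d Id]]; split; first exact: (subringM sP).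
    exists (c * d).
    have -> : u * v - kcst (c * d) = u * (v - kcst d) + kcst d * (u - kcst c).
      by rewrite kcstM; ring.
    by apply: ID; apply: (IM) => //; exact: P2chart_cst.
- by move=> c; split; [exact: P2chart_cst|exists c; rewrite subrr].
move=> i; split; first exact: P2chart_ratio.
by exists ((a 0 i : nat)%:R); rewrite kcst_nat; exact: point_ideal_centred.
Qed.

(** Since point ideals are maximal, it is enough that the centred coordinates are not
units. *)
Lemma dominates_F2stalk R a : is_subring R -> local_ring R -> (forall c, R (kcst c)) ->
  (forall j, a 0 j != 0 -> forall i, R x_[i, j] /\ ~ is_unit R (centred j a i)) ->
  dominates R (P2_F2stalk_ a).
Proof.
move=> sR lR Rc H.
have PR j : a 0 j != 0 -> P2chart_ j `<=` R.
  by move=> aj; apply: P2chart_min => // i; have [] := H j aj i.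
have IR j z : a 0 j != 0 -> point_ideal j a z -> R z /\ ~ is_unit R z.
  move=> aj; have sP := P2chart_subring k j.
  move/(_ [set z | P2chart_ j z /\ ~ is_unit R z]).
  case; last by move=> Pz nz; split=> //; exact: PR aj _ Pz.
  split; last first.
    move=> _ [i _ <-]; split; first exact: P2chart_centred.
    by have [] := H j aj i.
  split.
  - by move=> ? [].
  - by split; [exact: (subring0 sP)|case; rewrite eqxx].
  - move=> u v [Pu nu] [Pv nv]; split; first exact: (subringB sP).
    by move/(localN sR lR (PR _ aj _ Pu) (PR _ aj _ Pv)) => [].
  - move=> b u Pb [Pu nu]; split; first exact: (subringM sP).
    rewrite mulrC => ubu; apply: nu.
    exact: (is_unit_factor sR (PR _ aj _ Pu) (PR _ aj _ Pb) ubu).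
have unitI j s : a 0 j != 0 -> P2chart_ j s -> ~ point_ideal j a s -> is_unit R s.
  move=> aj Ps nIs; have [c Ic] := point_residue a Ps.
  have [Rz nz] := IR j _ aj Ic.
  have c0 : c != 0 by apply/eqP => c0; apply: nIs; move: Ic; rewrite c0 kcst0 subr0.
  have := kcst_unit sR Rc c0.
  have -> : kcst c = s - (s - kcst c) :> K by rewrite opprB addrC subrK.
  by case/(localN sR lR (PR _ aj _ Ps) Rz).
split=> [z [j aj [b [s [Pb Ps nIs ->]]]]|z [j aj [b [s [Pb Ps nIs ->]]]] Rzi].
  have [_ _ Rsi] := unitI j s aj Ps nIs.
  by apply: (subringM sR) => //; exact: PR aj _ Pb.
have us := unitI j s aj Ps nIs; have [s0 Rs Rsi] := us.
have [b0|b0] := eqVneq b 0.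
  by exists j => //; exists 0, s; rewrite b0 mul0r invr0 -b0.
exists j => //; exists s, b; split=> //; last by rewrite invfM invrK mulrC.
move=> Ib; have [Rb nb] := IR j b aj Ib; apply: nb; split=> //.
have -> : b^-1 = s^-1 * (b / s)^-1 by rewrite invfM invrK [b^-1 * s]mulrC (mulKf s0).
exact: (subringM sR).
Qed.

Lemma ring_inf_is_dvr : is_dvr ringinf.
Proof. by exists (tofrac 'X)^-1; exact: uniformizer_inf. Qed.

Lemma ring_inf_cst c : ringinf (kcst c).
Proof.
exists c%:P%:P, 1; rewrite oner_neq0 tofrac1 divr1 size_poly1.
by split=> //; exact: size_polyC_leq1.
Qed.

Section Place.
Variables (a : 'rV['F_2]_3) (pt : 'I_3 -> K).
Hypotheses (pt0 : pt 0 = 1) (pt_neq0 : forall j, a 0 j != 0 -> pt j != 0).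
Hypothesis (pt_near : forall j i, a 0 j != 0 ->
  ringinf ((pt i / pt j - (a 0 i : nat)%:R) * Y)).
Local Notation plc := (place (ev (pt 1) (pt 2))).

Let s_inf := @ring_inf_subring {poly k}.
Let l_inf : local_ring ringinf := dvr_local s_inf ring_inf_is_dvr.

Lemma place_hcoord i : plc (hcoord k i) (pt i).
Proof.
case: (ord3_cases i) => ->; [|exact: placeX|exact: placeY].
by rewrite hcoord0 pt0; exact: place1.
Qed.

Lemma place_ratio i j : a 0 j != 0 -> plc x_[i, j] (pt i / pt j).
Proof.
move=> aj; apply: placeM; first exact: place_hcoord.
by apply: placeV; [exact: place_hcoord|exact: pt_neq0].
Qed.

Lemma place_nat n : plc n%:R n%:R.
Proof. by rewrite -kcst_nat; exact: place_cst. Qed.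

Lemma place_centred j i : a 0 j != 0 -> plc (centred j a i) (pt i / pt j - (a 0 i : nat)%:R).
Proof. by move=> aj; apply: placeB; [exact: place_ratio|exact: place_nat]. Qed.

Lemma ring_inf_mulY z : ringinf (z * Y) -> ringinf z.
Proof.
move=> Hz; have -> : z = z * Y * Y^-1 by rewrite (mulfK (hcoord_neq0 k 2)).
by apply: (subringM s_inf) => //; exact: ring_infVX.
Qed.

Lemma ring_inf_mulY_nonunit z : ringinf (z * Y) -> ~ is_unit ringinf z.
Proof.
move=> Hz [z0 _ Rzi]; apply: (@ring_infX {poly k}).
have -> : tofrac 'X = z^-1 * (z * Y) by rewrite (mulKf z0).
exact: (subringM s_inf).
Qed.

Lemma place_chart j : a 0 j != 0 ->
  P2chart_ j `<=` [set z | exists2 z', plc z z' & ringinf z'].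
Proof.
move=> aj; apply: P2chart_min.
- split.
  + by exists 1; [exact: place1|exact: (subring1 s_inf)].
  + move=> u v [u' pu Ru] [v' pv Rv]; exists (u' - v'); first exact: placeB.
    exact: (subringB s_inf).
  + move=> u v [u' pu Ru] [v' pv Rv]; exists (u' * v'); first exact: placeM.
    exact: (subringM s_inf).
- by move=> c; exists (kcst c); [exact: place_cst|exact: ring_inf_cst].
move=> i; exists (pt i / pt j); first exact: place_ratio.
have -> : pt i / pt j = (pt i / pt j - (a 0 i : nat)%:R) + (a 0 i : nat)%:R.
  by rewrite subrK.
by apply: (subringD s_inf); [apply: ring_inf_mulY; exact: pt_near|exact: subring_nat].
Qed.

Lemma place_ideal j z : a 0 j != 0 -> point_ideal j a z ->
  exists2 z', plc z z' & ringinf (z' * Y).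
Proof.
move=> aj; have sP := P2chart_subring k j.
move/(_ [set z | P2chart_ j z /\ exists2 z', plc z z' & ringinf (z' * Y)]).
case; last by [].
split; last first.
  move=> _ [i _ <-]; split; first exact: P2chart_centred.
  by exists (pt i / pt j - (a 0 i : nat)%:R); [exact: place_centred|exact: pt_near].
split.
- by move=> ? [].
- split; first exact: (subring0 sP).
  by exists 0; [exact: place0|rewrite mul0r; exact: (subring0 s_inf)].
- move=> u v [Pu [u' pu Ru]] [Pv [v' pv Rv]]; split; first exact: (subringB sP).
  by exists (u' - v'); [exact: placeB|rewrite mulrBl; exact: (subringB s_inf)].
- move=> b u Pb [Pu [u' pu Ru]]; split; first exact: (subringM sP).
  have [b' pb Rb] := place_chart aj Pb.
  by exists (b' * u'); [exact: placeM|rewrite -mulrA; exact: (subringM s_inf)].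
Qed.

(** A place that sends the coordinates of the point to a point close to it, over the
valuation ring at infinity, is defined on the whole local ring. Its existence shows in
particular that the point ideals are proper. *)
Lemma place_stalk z : P2_F2stalk_ a z -> exists2 z', plc z z' & ringinf z'.
Proof.
move=> [j aj [b [s [Pb Ps nIs ->]]]].
have [c Ic] := point_residue a Ps.
have c0 : c != 0 by apply/eqP => c0; apply: nIs; move: Ic; rewrite c0 kcst0 subr0.
have [m pm Rm] := place_ideal aj Ic.
have ps : plc s (m + kcst c).
  by rewrite -(subrK (kcst c) s); apply: placeD => //; exact: place_cst.
have Rs : ringinf (m + kcst c).
  by apply: (subringD s_inf); [exact: ring_inf_mulY|exact: ring_inf_cst].
have us : is_unit ringinf (m + kcst c).
  have := kcst_unit s_inf ring_inf_cst c0.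
  rewrite -{1}(addKr m (kcst c)) addrC => H.
  have [//|] := localN s_inf l_inf Rs (ring_inf_mulY Rm) H.
  by move/(ring_inf_mulY_nonunit Rm).
have [b' pb Rb] := place_chart aj Pb; have [s0 _ Rsi] := us.
exists (b' / (m + kcst c)); first by apply: placeM => //; exact: placeV.
exact: (subringM s_inf).
Qed.

Lemma stalk_centred j i : a 0 j != 0 -> P2_F2stalk_ a (centred j a i).
Proof.
move=> aj; exists j => //; exists (centred j a i), 1; rewrite divr1; split=> //.
- exact: P2chart_centred.
- exact: (subring1 (P2chart_subring k j)).
move/(place_ideal aj) => [z' p1 Rz]; have E := place_fun p1 (place1 _).
by move: Rz; rewrite E mul1r; exact: ring_infX.
Qed.

Lemma place_not_dominates R j i : a 0 j != 0 -> centred j a i != 0 ->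
  R (centred j a i)^-1 -> ~ dominates R (P2_F2stalk_ a).
Proof.
move=> aj n0 Ri [_ /(_ _ (stalk_centred i aj) Ri)/place_stalk[z' pz Rz]].
have := placeM (place_centred i aj) pz; rewrite divff // => /place_fun/(_ (place1 _)) E.
apply: (@ring_infX {poly k}); rewrite -[tofrac 'X]mul1r -E mulrAC.
by apply: (subringM s_inf) => //; exact: pt_near.
Qed.

End Place.

(** A centred coordinate generates a proper ideal of the local ring of the point, so
its inverse is not in that ring. *)
Lemma not_dominates R a j i : a 0 j != 0 -> centred j a i != 0 ->
  R (centred j a i)^-1 -> ~ dominates R (P2_F2stalk_ a).
Proof.
move=> aj.
have Y0 : Y != 0 := hcoord_neq0 k 2.
(* The point (1 : a_1 : a_2) itself if a_0 = 1; otherwise (1 : a_1 Y : a_2 Y), which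
   tends to a when Y tends to infinity. *)
pose c : K := if a 0 0 == 0 then Y else 1.
have c0 : c != 0 by rewrite /c; case: ifP => _; [exact: Y0|exact: oner_neq0].
have nat1 l : a 0 l != 0 -> (a 0 l : nat)%:R = 1 :> K.
  by case: (F2_cases (a 0 l)) => ->; rewrite ?eqxx.
pose pt l : K := if l == 0 then 1 else (a 0 l : nat)%:R * c.
have ptE l : a 0 l != 0 -> pt l = c.
  move=> al; rewrite /pt; case: eqP => [l0|_]; last by rewrite nat1 // mul1r.
  by rewrite /c -l0 (negPf al).
have pt_n l : a 0 l != 0 -> pt l != 0 by move=> al; rewrite (ptE l al); exact: c0.
suff near l m : a 0 l != 0 -> ringinf ((pt m / pt l - (a 0 m : nat)%:R) * Y).
  exact: (@place_not_dominates a pt (erefl _) pt_n near R j i aj).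
move=> al; rewrite (ptE l al).
have s_inf := @ring_inf_subring {poly k}.
have [m0|m0] := eqVneq m 0; last first.
  rewrite /pt (negPf m0) (mulfK c0) subrr mul0r; exact: (subring0 s_inf).
rewrite /pt m0 eqxx /c; case: eqP => [->|/eqP a0].
  by rewrite subr0 (divfK Y0); exact: (subring1 s_inf).
by rewrite nat1 // divr1 subrr mul0r; exact: (subring0 s_inf).
Qed.

End F2Stalks.

(** * The generic fibre of a projection *)

Section Points.
Variable k : fieldType.
Local Notation K := (P2_field k).
Local Notation tofrac := (@FracField.tofrac {poly {poly k}}).
Local Notation F2chart_ := (@F2chart k).
Local Notation P2chart_ := (@P2chart k).
Local Notation "x_[ i , j ]" := (@hcoord k i / @hcoord k j) (at level 0, format "x_[ i ,  j ]").
Local Notation XX := (blowup_P2 k).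
Local Notation X := (hcoord k 1).
Local Notation Y := (hcoord k 2).
Local Notation ringinf := (@ring_inf {poly k}).
Local Notation ringat := (@ring_at {poly k}).
Implicit Types (pi p q : {poly {poly k}}) (T R : set K).

Lemma hcoord2E : Y = tofrac 'X. Proof. by []. Qed.

Lemma hcoord1_neq1 : X != 1.
Proof.
rewrite -tofrac1 tofrac_eq -polyC1; apply/eqP => /polyC_inj/(congr1 (fun q : {poly k} => q`_0)).
by rewrite coefX coef1 /= => /eqP; rewrite eq_sym oner_eq0.
Qed.

Lemma hcoord2_neq1 : Y != 1.
Proof.
rewrite -tofrac1 tofrac_eq; apply/eqP => /(congr1 (fun q : {poly {poly k}} => q`_0)).
by rewrite coefX coef1 /= => /eqP; rewrite eq_sym oner_eq0.
Qed.

Lemma hcoord1_neq2 : X != Y.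
Proof.
rewrite tofrac_eq; apply/eqP => /(congr1 (fun q : {poly {poly k}} => q`_1)).
by rewrite coefX coefC /= => /eqP; rewrite eq_sym oner_eq0.
Qed.

Lemma grid_neq0 (F : fieldType) (z : F) : z != 0 -> z != 1 -> z ^+ 2 - z != 0.
Proof.
move=> z0 z1; have -> : z ^+ 2 - z = z * (z - 1) by ring.
by rewrite mulf_neq0 // subr_eq0.
Qed.

Lemma hratio00 : x_[0, 0] = 1. Proof. exact: hratio1. Qed.
Lemma hratio10 : x_[1, 0] = X. Proof. by rewrite hcoord0 divr1. Qed.
Lemma hratio20 : x_[2, 0] = Y. Proof. by rewrite hcoord0 divr1. Qed.
Lemma hratio01 : x_[0, 1] = X^-1. Proof. by rewrite hcoord0 mul1r. Qed.
Lemma hratio02 : x_[0, 2] = Y^-1. Proof. by rewrite hcoord0 mul1r. Qed.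

Lemma P2chart0_sub R : is_subring R -> (forall c, R (kcst c)) -> R X -> R Y ->
  P2chart_ 0 `<=` R.
Proof.
move=> sR Rc RX RY; apply: P2chart_min => // i.
by case: (ord3_cases i) => ->; rewrite ?hratio00 ?hratio10 ?hratio20 //; exact: (subring1 sR).
Qed.

Lemma P2chart1_sub R : is_subring R -> (forall c, R (kcst c)) -> R X^-1 -> R (Y / X) ->
  P2chart_ 1 `<=` R.
Proof.
move=> sR Rc RX RY; apply: P2chart_min => // i.
by case: (ord3_cases i) => ->; rewrite ?hratio1 ?hratio01 //; exact: (subring1 sR).
Qed.

Lemma P2chart2_sub R : is_subring R -> (forall c, R (kcst c)) -> R Y^-1 -> R (X / Y) ->
  P2chart_ 2 `<=` R.
Proof.
move=> sR Rc RX RY; apply: P2chart_min => // i.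
by case: (ord3_cases i) => ->; rewrite ?hratio1 ?hratio02 //; exact: (subring1 sR).
Qed.

Lemma chart_exists j i : x_[i, j] != 0 -> x_[i, j] != 1 ->
  charts XX (base_change (blowup_algebra (F2chart_ j) (@F2points_ideal k j) (grid k j i))).
Proof.
move=> n0 n1; exists j, (grid k j i); split; last by [].
  exact: F2points_ideal_gen.
exact: (grid_neq0 n0 n1).
Qed.

Lemma ring_at_const_unit pi (c : {poly k}) : irreducible_poly pi -> c != 0 ->
  is_unit (ringat pi) (tofrac c%:P).
Proof.
move=> irr c0; rewrite -[tofrac _]divr1 -tofrac1.
apply: (ring_at_unit (ndvd_const irr c0)).
by rewrite -polyC1; apply: (ndvd_const irr); exact: oner_neq0.
Qed.

(** The grid polynomial X^2 - X is a unit at all points of the generic fibre of the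
projection from (0 : 0 : 1) other than the one at infinity; hence these points lie in one
chart. *)
Lemma point_at pi : irreducible_poly pi -> exists x : point XX, stalk x = ringat pi.
Proof.
move=> irr; have sR := ring_at_subring irr.
have dR : is_dvr (ringat pi) by exists (tofrac pi); exact: uniformizer_at.
have Rp := ring_at_poly irr.
have n0 : x_[1, 0] != 0 by rewrite hratio10; exact: hcoord_neq0.
have n1 : x_[1, 0] != 1 by rewrite hratio10; exact: hcoord1_neq1.
have XC := chart_exists n0 n1; have sC := charts_subring XC.
set C := base_change _ in XC sC.
have ug : is_unit (ringat pi) (grid k 0 1).
  have -> : grid k 0 1 = tofrac ('X ^+ 2 - 'X)%:P.
    by rewrite /grid hratio10 polyCB polyCM tofracB tofracM.
  apply: ring_at_const_unit => //; apply/eqP => /(congr1 (fun q : {poly k} => q`_1)).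
  rewrite coefB coefX coef0 expr2 coefMX coefX /= sub0r => /eqP.
  by rewrite oppr_eq0 oner_eq0.
have FR : F2chart_ 0 `<=` ringat pi.
  apply: F2chart_min => // i.
  by case: (ord3_cases i) => ->; rewrite ?hratio00 ?hratio10 ?hratio20; [exact: (subring1 sR)|exact: Rp|exact: Rp].
apply: (stalk_exists sR (dvr_local sR dR) XC).
  apply: base_change_min => //; first by move=> c; exact: Rp.
  apply: subring_gen_min => // z [/FR //|[g [Fg _] <-]].
  by have [_ _ ugi] := ug; apply: (subringM sR) => //; exact: FR.
have Cp q : C (tofrac q).
  rewrite tofrac_ev; apply: ev_closed => //; first exact: base_change_cst.
    rewrite -hratio10; apply: sub_base_change; apply: sub_subring_gen; left; exact: F2chart_ratio.
  rewrite -hratio20; apply: sub_base_change; apply: sub_subring_gen; left; exact: F2chart_ratio.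
move=> z [p [d [nd ->]]]; exists (tofrac p), (tofrac d); split; [exact: Cp|exact: Cp| |by []].
rewrite -[tofrac d]divr1 -tofrac1; apply: (ring_at_unit nd).
by rewrite -polyC1; apply: (ndvd_const irr); exact: oner_neq0.
Qed.

Lemma ring_inf_const (c : {poly k}) : ringinf (tofrac c%:P).
Proof.
exists c%:P, 1; rewrite oner_neq0 tofrac1 divr1 size_poly1.
by split=> //; exact: size_polyC_leq1.
Qed.

Lemma ring_inf_Ynonunit z : ringinf z -> ~ is_unit ringinf (z * Y^-1).
Proof.
move=> Rz; apply: ring_inf_mulY_nonunit.
by rewrite (divfK (hcoord_neq0 k 2)).
Qed.

(** Polynomials of degree at most n in Y, divided by Y ^ n, are polynomials in 1/Y. *)
Lemma div_pow_closed T (p : {poly {poly k}}) n : is_subring T ->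
  (forall c : {poly k}, T (tofrac c%:P)) -> T Y^-1 -> (size p <= n.+1)%N ->
  T (tofrac p / Y ^+ n).
Proof.
move=> sT Tc Ts; elim/poly_ind: p n => [|p c IH] n.
  by rewrite tofrac0 mul0r => _; exact: (subring0 sT).
have cY m : T (tofrac c%:P / Y ^+ m).
  by rewrite -exprVn; apply: (subringM sT) => //; exact: (subringX sT).
rewrite size_MXaddC tofracD tofracM mulrDl.
have [->|p0] := eqVneq p 0.
  by rewrite tofrac0 !mul0r add0r => _; exact: cY.
rewrite /=; case: n => [|n].
  by rewrite ltnS leqn0 size_poly_eq0 (negPf p0).
rewrite ltnS => /IH Tp; apply: (subringD sT) => //.
have Y0 : Y != 0 := hcoord_neq0 k 2.
have -> : tofrac p * tofrac 'X / Y ^+ n.+1 = tofrac p / Y ^+ n.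
  by rewrite exprS invfM mulrA (mulfK Y0).
exact: Tp.
Qed.

Lemma inf_ratio (F : fieldType) (x s : F) : s != 0 -> s - 1 != 0 ->
  ((x * s) ^+ 2 - x * s) / (s ^+ 2 - s) = x * (x * s - 1) * (s - 1)^-1.
Proof.
move=> s0 s1; have -> : s ^+ 2 - s = s * (s - 1) by ring.
by field; rewrite s0 s1.
Qed.

(** The point at infinity of the generic fibre is the exceptional curve over
(0 : 0 : 1). In the coordinates s = 1/Y and t = X/Y it lies in the chart where s^2 - s
generates the ideal of the F_2-points, and X is recovered from the ratio of the grid
polynomials because s - 1 and t - 1 are units. *)
Lemma point_inf : exists x : point XX, stalk x = ringinf.
Proof.
have sR := @ring_inf_subring {poly k}; have dR := ring_inf_is_dvr k.
have lR := dvr_local sR dR.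
have Y0 : Y != 0 := hcoord_neq0 k 2.
have Rs : ringinf Y^-1 by exact: ring_infVX.
have RX : ringinf X by exact: ring_inf_const.
have Rt : ringinf (X / Y) by exact: (subringM sR).
have us : is_unit ringinf (Y^-1 - 1).
  apply: nonunit_sub1 => //; rewrite -[Y^-1]mul1r.
  by apply: ring_inf_Ynonunit; exact: (subring1 sR).
have ut : is_unit ringinf (X / Y - 1) by apply: nonunit_sub1 => //; exact: ring_inf_Ynonunit.
have [us0 _ usi] := us; have [ut0 ut1 uti] := ut.
have n0 : x_[0, 2] != 0 by rewrite hratio02; exact: (invr_neq0 Y0).
have n1 : x_[0, 2] != 1 by rewrite hratio02; apply/eqP => E; move/eqP: us0; apply; rewrite E subrr.
have XC := chart_exists n0 n1; have sC := charts_subring XC.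
set C := base_change _ in XC sC.
have g0 : grid k 2 0 != 0 := grid_neq0 n0 n1.
have Eg : grid k 2 1 / grid k 2 0 = X * (X / Y - 1) * (Y^-1 - 1)^-1.
  by rewrite /grid hratio02; exact: (inf_ratio X (invr_neq0 Y0) us0).
have FR : F2chart_ 2 `<=` ringinf.
  apply: F2chart_min => // i.
  by case: (ord3_cases i) => ->; rewrite ?hratio1 ?hratio02; [exact: Rs|exact: Rt|exact: (subring1 sR)].
have FC : F2chart_ 2 `<=` C.
  by move=> z Fz; apply: sub_base_change; apply: sub_subring_gen; left.
have fr : @coord_frame 2 0 1.
  by split=> // i; case: (ord3_cases i) => ->; [constructor 2|constructor 3|constructor 1].
have CR : C `<=` ringinf.
  apply: base_change_min => //; first exact: ring_inf_cst.
  apply: subring_gen_min => // z [/FR //|[g Ig <-]].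
  have [c [d [Fc Fd ->]]] := F2points_idealP fr Ig.
  rewrite -/(grid k 2 0) -/(grid k 2 1) mulrDl (mulfK g0) -mulrA Eg.
  apply: (subringD sR); first exact: FR.
  apply: (subringM sR); first exact: FR.
  by apply: (subringM sR) => //; exact: (subringM sR).
apply: (stalk_exists sR lR XC CR).
set T := fracs _ _.
have sT : is_subring T by exact: fracs_subring.
have Tu : unit_closed ringinf T by exact: fracs_unit_closed.
have CT : C `<=` T by exact: sub_fracs.
have Ts : T Y^-1 by apply: CT; apply: FC; rewrite -hratio02; exact: F2chart_ratio.
have Tt : T (X / Y) by apply: CT; apply: FC; exact: F2chart_ratio.
have Ts1 : T (Y^-1 - 1) by apply: (subringB sT) => //; exact: (subring1 sT).
have Tt1 : T (X / Y - 1) by apply: (subringB sT) => //; exact: (subring1 sT).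
have Tg : T (grid k 2 1 / grid k 2 0).
  apply: CT; apply: sub_base_change; apply: sub_subring_gen; right; exists (grid k 2 1) => //.
  exact: F2points_ideal_gen.
have TX : T X.
  have -> : X = grid k 2 1 / grid k 2 0 * (Y^-1 - 1) * (X / Y - 1)^-1.
    by rewrite Eg (divfK us0) (mulfK ut0).
  by apply: (subringM sT); [exact: (subringM sT)|exact: Tu].
have Tc (c : {poly k}) : T (tofrac c%:P).
  rewrite tofrac_ev evC -(evC X 0); apply: ev_closed => //; last exact: (subring0 sT).
  by move=> e; apply: CT; exact: base_change_cst.
move=> z [p [d [d0 pd ->]]].
have [n dn] : exists n, size d = n.+1.
  by exists (size d).-1; rewrite prednK // size_poly_gt0.
have Tp := div_pow_closed sT Tc Ts (leq_trans pd (eq_leq dn)).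
have Td := div_pow_closed sT Tc Ts (eq_leq dn).
have ud : is_unit ringinf (tofrac d / Y ^+ n).
  rewrite hcoord2E -tofracXn; apply: ring_inf_unit => //; last by rewrite size_polyXn.
  by rewrite -size_poly_gt0 size_polyXn.
rewrite (div_div_cancel (tofrac d) (tofrac p) (expf_neq0 n Y0)).
by apply: (subringM sT) => //; exact: Tu.
Qed.

Lemma generic_point : exists x : point XX, stalk x = setT.
Proof.
have [y _] := point_inf; have [C [P [XC _ _]]] := stalkP y.
have xP : exists C P, [/\ charts XX C, is_prime C P & setT = localization C P].
  exists C, [set 0]; split; [exact: XC|exact: is_prime0 XC|].
  exact: esym (localization0 XC).
by exists (Point xP).
Qed.

End Points.

(** * Exceptional curves over the line Y = 0 *)

Section Bounds.
Variable k : fieldType.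
Local Notation P2_F2stalk_ := (@P2_F2stalk k).
Local Notation "x_[ i , j ]" := (@hcoord k i / @hcoord k j) (at level 0, format "x_[ i ,  j ]").
Local Notation XX := (blowup_P2 k).
Local Notation X := (hcoord k 1).
Local Notation Y := (hcoord k 2).
Implicit Types (x : point XX).

Let X0 : X != 0 := hcoord_neq0 k 1.
Let Y0 : Y != 0 := hcoord_neq0 k 2.

Definition f2row (b0 b1 b2 : bool) : 'rV['F_2]_3 :=
  \row_i (if i == 0 then b0 else if i == 1 then b1 else b2)%:R.

Lemma centredE j b0 b1 b2 i :
  @centred k j (f2row b0 b1 b2) i = x_[i, j] - (if i == 0 then b0 else if i == 1 then b1 else b2)%:R.
Proof. by rewrite /centred mxE; case: (if _ then _ else _). Qed.

Lemma f2row_neq0 b0 b1 b2 i : (f2row b0 b1 b2 0 i != 0) =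
  (if i == 0 then b0 else if i == 1 then b1 else b2).
Proof. by rewrite mxE; case: (if _ then _ else _). Qed.

Lemma nonunit0 (F : fieldType) (R : set F) : ~ is_unit R 0.
Proof. by case; rewrite eqxx. Qed.

Lemma divfK_sym (F : fieldType) (a b : F) : b != 0 -> a = a / b * b.
Proof. by move=> b0; rewrite divfK. Qed.

Section AtPoint.
Variables (x : point XX) (dx : is_dvr (stalk x)).
Local Notation R := (stalk x).
Let sR : is_subring R := stalk_subring x.
Let lR : local_ring R := @stalk_local _ _ x.
Let Rc : forall c, R (kcst c) := stalk_cst x.

(** The F_2-points (1 : 0 : 0) and (1 : 1 : 0) of the line Y = 0, with parameters Y and
u = X or X - 1. The second one also lies in the chart of the coordinates 1/X and Y/X. The
place is the substitution X = w v or X = w v + 1, Y = v. *)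
Lemma ord_line0 u : u = X \/ u = X - 1 -> R X -> R Y -> ~ is_unit R Y -> is_unit R (u / Y) ->
  ord R Y = 1.
Proof.
move=> Eu RX RY nY uw; have [_ Rw _] := uw.
have Euw : u = u / Y * Y := divfK_sym u Y0.
have nY2 : ~ R Y^-1 by move=> Ri; apply: nY.
pose xx := if u == X then X * Y else X * Y + 1.
apply: (@ord_exceptional k x Y (u / Y) xx Y dx Y0 RY nY Rw).
- have pu : place (ev xx Y) u (X * Y).
    have pX := placeX xx Y.
    case: (eqVneq u X) => [uX|nuX]; first by move: pX; rewrite /xx uX eqxx.
    case: Eu => // Eu'; first by rewrite Eu' eqxx in nuX.
    have -> : X * Y = xx - 1 by rewrite /xx (negPf nuX) addrK.
    by rewrite Eu'; apply: placeB; [exact: pX|exact: place1].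
  have := placeM pu (placeV (placeY xx Y) Y0).
  by rewrite (mulfK Y0).
- exact: placeY.
move=> T sT TR Tu TY Tw j CR.
have RT i : R x_[i, j] by apply: CR; exact: P2chart_ratio.
have [j0|j1|j2] := ord3_cases j; last first.
- by exfalso; have := RT 0; rewrite j2 hratio02.
- subst j; case: Eu => Eu.
    exfalso; have nX : ~ is_unit R X.
      by rewrite -Eu Euw; apply: nonunit_mul => //.
    by apply: nX; split; [exact: X0|exact: RX|have := RT 0; rewrite hratio01].
  have EX : X = u / Y * Y + 1 by rewrite -Euw Eu subrK.
  have [] := unit_grid_inv sR lR sT TR Tu TY nY Tw uw.
  rewrite -EX => uX TXi TYX A0 A2.
  split=> i.
    by case: (ord3_cases i) => ->; rewrite ?hratio1 ?hratio01; [exact: TXi|exact: (subring1 sT)|exact: TYX].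
  case: (ord3_cases i) => ->; rewrite /grid ?hratio01 ?eqxx // => _.
subst j; split=> i.
  case: (ord3_cases i) => ->; rewrite ?hratio00 ?hratio10 ?hratio20; [exact: (subring1 sT)| |exact: TY].
  case: Eu => Eu; first by rewrite -Eu Euw; exact: (subringM sT).
  have -> : X = u / Y * Y + 1 by rewrite -Euw Eu subrK.
  by apply: (subringD sT); [exact: (subringM sT)|exact: (subring1 sT)].
case: (ord3_cases i) => ->; rewrite /grid ?hratio10 ?hratio20 ?eqxx // => _; last exact: assoc_grid.
case: Eu => Eu; first by rewrite -Eu Euw; exact: assoc_grid_mul.
have -> : X = u / Y * Y + 1 by rewrite -Euw Eu subrK.
exact: assoc_grid_mul1.
Qed.

(** The F_2-point (0 : 1 : 0) of the line Y = 0, with parameters Y/X and 1/X. *)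
Lemma ord_line1 : R X^-1 -> R (Y / X) -> ~ is_unit R (Y / X) -> is_unit R Y^-1 ->
  ord R (Y / X) = 1.
Proof.
move=> RXi Rv nv uw; have [_ Rw Ry] := uw; rewrite invrK in Ry.
have YX0 : Y / X != 0 := mulf_neq0 Y0 (invr_neq0 X0).
have EX : X^-1 = Y^-1 * (Y / X) by rewrite (mulKf Y0).
have XY0 : (X * Y)^-1 != 0 := invr_neq0 (mulf_neq0 X0 Y0).
have nX : ~ R X.
  move=> RX; apply: nv; split; [exact: YX0|exact: Rv|].
  by rewrite invfM invrK; exact: (subringM sR).
apply: (@ord_exceptional k x (Y / X) Y^-1 (X * Y)^-1 X^-1 dx YX0 Rv nv Rw).
- have := placeV (placeY (X * Y)^-1 X^-1) (invr_neq0 X0).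
  by rewrite invrK.
- have := placeM (placeY (X * Y)^-1 X^-1) (placeV (placeX (X * Y)^-1 X^-1) XY0).
  by rewrite invrK (mulKf X0).
move=> T sT TR Tu Tv Tw j CR.
have RT i : R x_[i, j] by apply: CR; exact: P2chart_ratio.
have [j0|j1|j2] := ord3_cases j.
- by exfalso; have := RT 1; rewrite j0 hratio10.
- subst j; split=> i.
    case: (ord3_cases i) => ->; rewrite ?hratio1 ?hratio01; [|exact: (subring1 sT)|exact: Tv].
    by rewrite EX; exact: (subringM sT).
  case: (ord3_cases i) => ->; rewrite /grid ?hratio01 ?eqxx // => _; last exact: assoc_grid.
  by have := assoc_grid_mul sR lR sT TR Tv nv Tw uw; rewrite -EX.
exfalso; apply: nv; split; [exact: YX0|exact: Rv|].
by have := RT 1; rewrite j2 invfM invrK mulrC.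
Qed.

Lemma dominates_line0 u : u = X \/ u = X - 1 -> R X -> R Y -> ~ is_unit R Y -> is_unit R (u / Y) ->
  exists2 a : 'rV['F_2]_3, a != 0 & dominates R (P2_F2stalk_ a).
Proof.
move=> Eu RX RY nY uw.
have Euw : u = u / Y * Y := divfK_sym u Y0.
have nu : ~ is_unit R u by rewrite Euw; exact: nonunit_mul.
have nz b1 b2 : f2row true b1 b2 != 0.
  by apply/eqP => /rowP/(_ 0)/eqP; rewrite [X in _ == X]mxE; apply/negP; rewrite f2row_neq0.
case: Eu => Eu.
  exists (f2row true false false) => //; apply: (dominates_F2stalk sR lR Rc) => j.
  rewrite f2row_neq0; case: (ord3_cases j) => -> // _ i; rewrite centredE.
  case: (ord3_cases i) => ->; rewrite ?hratio00 ?hratio10 ?hratio20 /= ?mulr1n ?mulr0n.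
  - by rewrite subrr; split; [exact: (subring1 sR)|exact: nonunit0].
  - by rewrite subr0; split; [exact: RX|rewrite -Eu].
  - by rewrite subr0; split; [exact: RY|exact: nY].
have uX : is_unit R X.
  have -> : X = - (u * -1 - 1) by rewrite Eu; ring.
  apply: (is_unitN sR); apply: nonunit_sub1 => //.
    by rewrite mulrN1; apply: (subringN sR); rewrite Eu; apply: (subringB sR) => //; exact: (subring1 sR).
  by rewrite mulrN1 => /(is_unitN sR); rewrite opprK.
have [_ _ RXi] := uX.
have Ru : R u by rewrite Eu; apply: (subringB sR) => //; exact: (subring1 sR).
exists (f2row true true false) => //; apply: (dominates_F2stalk sR lR Rc) => j.
rewrite f2row_neq0; case: (ord3_cases j) => -> // _ i; rewrite centredE.
  case: (ord3_cases i) => ->; rewrite ?hratio00 ?hratio10 ?hratio20 /= ?mulr1n ?mulr0n.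
  - by rewrite subrr; split; [exact: (subring1 sR)|exact: nonunit0].
  - by split; [exact: RX|rewrite -Eu].
  - by rewrite subr0; split; [exact: RY|exact: nY].
case: (ord3_cases i) => ->; rewrite ?hratio1 ?hratio01 /= ?mulr1n ?mulr0n.
- split; first exact: RXi.
  have -> : X^-1 - 1 = X^-1 * - u by rewrite Eu mulrN mulrBr (mulVf X0) mulr1 opprB.
  apply: (nonunit_mul sR (subringN sR Ru) _ (is_unitV uX)).
  by move/(is_unitN sR); rewrite opprK.
- by rewrite subrr; split; [exact: (subring1 sR)|exact: nonunit0].
- rewrite subr0; split; first exact: (subringM sR RY RXi).
  by rewrite mulrC; exact: (nonunit_mul sR RY nY (is_unitV uX)).
Qed.

Lemma dominates_line1 : R X^-1 -> R (Y / X) -> ~ is_unit R (Y / X) -> is_unit R Y^-1 ->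
  exists2 a : 'rV['F_2]_3, a != 0 & dominates R (P2_F2stalk_ a).
Proof.
move=> RXi Rv nv uw.
have EX : X^-1 = Y^-1 * (Y / X) by rewrite (mulKf Y0).
exists (f2row false true false).
  by apply/eqP => /rowP/(_ 1)/eqP; rewrite [X in _ == X]mxE; apply/negP; rewrite f2row_neq0.
apply: (dominates_F2stalk sR lR Rc) => j.
rewrite f2row_neq0; case: (ord3_cases j) => -> // _ i; rewrite centredE.
case: (ord3_cases i) => ->; rewrite ?hratio1 ?hratio01 /= ?mulr1n ?mulr0n.
- rewrite subr0; split; first exact: RXi.
  by rewrite EX; exact: (nonunit_mul sR Rv nv uw).
- by rewrite subrr; split; [exact: (subring1 sR)|exact: nonunit0].
- by rewrite subr0; split; [exact: Rv|exact: nv].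
Qed.

End AtPoint.
End Bounds.

(** * The divisor B and the cocycle *)

Section OrdAlgebra.
Variables (F : fieldType) (R : set F) (sR : is_subring R) (dR : is_dvr R).
Implicit Types f z D : F.

Lemma ord_pow_div f z D n : f != 0 -> z != 0 -> D != 0 ->
  ord R (f ^+ n / D) = ord R (f / z) * n%:Z - ord R (D / z ^+ n).
Proof.
move=> f0 z0 D0; have fz0 : f / z != 0 by rewrite mulf_neq0 ?invr_eq0.
have Dz0 : D / z ^+ n != 0 by rewrite mulf_neq0 ?invr_eq0 ?expf_neq0.
have -> : f ^+ n / D = (f / z) ^+ n * (D / z ^+ n)^-1.
  by rewrite expr_div_n invfM invrK [D^-1 * _]mulrC mulrA divfK ?expf_neq0.
by rewrite (ordM sR dR) ?invr_eq0 ?expf_neq0 // (ordX sR dR) // (ordV sR dR).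
Qed.

Lemma ord_unit_pow D t n : D != 0 -> t != 0 -> ord R t = 1 -> is_unit R (D / t ^+ n) ->
  ord R D = n.
Proof.
move=> D0 t0 t1 u; rewrite -(divfK (expf_neq0 n t0) D) (ordM sR dR) ?expf_neq0 //.
  by rewrite (ord_unit sR dR u) (ordX sR dR) // t1 add0r mul1r.
by rewrite mulf_neq0 ?invr_eq0 ?expf_neq0.
Qed.

Lemma div_pow_pow f z D m : z / (f ^+ 10 / D) ^+ m = z / (f ^+ (10 * m)) * D ^+ m.
Proof. by rewrite expr_div_n invfM invrK mulrA exprM. Qed.

Lemma ord_div_pow_ge0 z f m p : f != 0 -> p = ord R f ->
  (z != 0 -> 0 <= ord R z - p * m%:Z) -> R (z / f ^+ m).
Proof.
move=> f0 ->; have [->|z0 /(_ isT) H] := eqVneq z 0.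
  by rewrite mul0r => _; exact: (subring0 sR).
have zf0 : z / f ^+ m != 0 by rewrite mulf_neq0 ?invr_eq0 ?expf_neq0.
apply/(ord_ge0 sR dR zf0).
by rewrite (ordM sR dR) ?invr_eq0 ?expf_neq0 // (ordV sR dR) ?expf_neq0 // (ordX sR dR).
Qed.

End OrdAlgebra.

Lemma swap_line (F : fieldType) (x y : F) : x != 0 -> x != 1 ->
  y / (x - 1) = - (y / x / (x^-1 - 1)).
Proof.
move=> x0; rewrite -subr_eq0 => x1.
have -> : x^-1 - 1 = - (x - 1) / x by field.
by field; rewrite oppr_eq0 x0 x1.
Qed.


Section Divisor.
Variables (k : fieldType) (l : 'rV[k]_3) (l_neq0 : l != 0).
Local Notation K := (P2_field k).
Local Notation tofrac := (@FracField.tofrac {poly {poly k}}).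
Local Notation P2chart_ := (@P2chart k).
Local Notation P2_F2stalk_ := (@P2_F2stalk k).
Local Notation "x_[ i , j ]" := (@hcoord k i / @hcoord k j) (at level 0, format "x_[ i ,  j ]").
Local Notation XX := (blowup_P2 k).
Local Notation X := (hcoord k 1).
Local Notation Y := (hcoord k 2).
Local Notation lf := (linear_form l).
Implicit Types (x : point XX).

Let X0 : X != 0 := hcoord_neq0 k 1.
Let Y0 : Y != 0 := hcoord_neq0 k 2.
Let X1 : X != 1 := @hcoord1_neq1 k.

(** The coefficients of the polynomial that represents the form are those of [l]. *)
Lemma linear_form_neq0 : lf != 0.
Proof.
have E : lf = tofrac ((l 0 2)%:P%:P * 'X + ((l 0 1)%:P * 'X + (l 0 0)%:P)%:P).
  rewrite /linear_form !big_ord_recl big_ord0 addr0.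
  have -> : lift ord0 (lift ord0 ord0) = 2 :> 'I_3 by exact: val_inj.
  have -> : lift ord0 ord0 = 1 :> 'I_3 by exact: val_inj.
  have -> : ord0 = 0 :> 'I_3 by exact: val_inj.
  rewrite hcoord0 mulr1 polyCD polyCM !tofracD !tofracM.
  by rewrite [LHS]addrC [LHS]addrAC [LHS]addrC.
rewrite E tofrac_eq0; apply: contraNneq l_neq0 => H.
have c2 : l 0 2 = 0.
  have := congr1 (fun q : {poly {poly k}} => q`_1`_0) H.
  by rewrite coefD coefMX coefC /= coefC addr0 coefC coef0 coef0.
have c01 : (l 0 1)%:P * 'X + (l 0 0)%:P = 0 :> {poly k}.
  have := congr1 (fun q : {poly {poly k}} => q`_0) H.
  by rewrite coefD coefMX coefC /= add0r coef0 coefC /=.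
have c1 : l 0 1 = 0.
  have := congr1 (fun q : {poly k} => q`_1) c01.
  by rewrite coefD coefMX !coefC /= addr0.
have c0 : l 0 0 = 0.
  have := congr1 (fun q : {poly k} => q`_0) c01.
  by rewrite coefD coefMX !coefC /= add0r.
apply/eqP/rowP => i; rewrite mxE.
by case: (ord3_cases i) => ->.
Qed.

Lemma linear_form_div_neq0 j : lf / hcoord k j != 0.
Proof. by apply: mulf_neq0; [exact: linear_form_neq0|apply: invr_neq0; exact: hcoord_neq0]. Qed.

(** Another admissible chart changes the local equation by a unit. *)
Lemma pullback_lineE x j : is_dvr (stalk x) -> P2chart_ j `<=` stalk x ->
  pullback_line l x = ord (stalk x) (lf / hcoord k j).
Proof.
move=> dx CR; have sR := stalk_subring x.
apply: xget_unique => [|n [i [CRi ->]]]; first by exists j.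
have ux : is_unit (stalk x) x_[i, j].
  split.
  - by apply: mulf_neq0; [exact: hcoord_neq0|apply: invr_neq0; exact: hcoord_neq0].
  - by apply: CR; exact: P2chart_ratio.
  - by rewrite invfM invrK mulrC; apply: CRi; exact: P2chart_ratio.
have -> : lf / hcoord k j = lf / hcoord k i * x_[i, j].
  by rewrite mulrA (divfK (hcoord_neq0 k i)).
have [n0 _ _] := ux.
by rewrite (ordM sR dx (linear_form_div_neq0 i) n0) (ord_unit sR dx ux) addr0.
Qed.

Definition exceptional_sum x : int :=
  \sum_(a : 'rV['F_2]_3 | a != 0) @exceptional_curve k a x.

Lemma exceptional_sum_ge0 x : 0 <= exceptional_sum x.
Proof. by apply: sumr_ge0 => a _; rewrite /exceptional_curve; case: asboolP. Qed.

Lemma exceptional_sum_ge1 x : (exists2 a : 'rV['F_2]_3, a != 0 & dominates (stalk x) (P2_F2stalk_ a)) ->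
  1 <= exceptional_sum x.
Proof.
move=> [a a0 dom]; rewrite /exceptional_sum (bigD1 a) //=.
rewrite {1}/exceptional_curve (asboolT dom) lerDl.
by apply: sumr_ge0 => b _; rewrite /exceptional_curve; case: asboolP.
Qed.

Definition cocycle_den : K := pole_den X Y.
Local Notation den := cocycle_den.

(** A rational section of O(2B). Relative to 2B, its poles are the line Y = 0 and the
connected curve made of the three F_2-lines through (0 : 0 : 1) and of the exceptional
curve over that point; the two are disjoint on the blowup. *)
Definition cocycle_fun : K := lf ^+ 10 / cocycle_den.

Lemma cocycle_den_neq0 : den != 0.
Proof.
apply: mulf_neq0; last exact: Y0.
by apply: expf_neq0; apply: mulf_neq0; [exact: X0|rewrite subr_eq0; exact: X1].
Qed.

Lemma cocycle_fun_neq0 : cocycle_fun != 0.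
Proof. by apply: mulf_neq0; [apply: expf_neq0; exact: linear_form_neq0|apply: invr_neq0; exact: cocycle_den_neq0]. Qed.

Lemma divisor_BE x : divisor_B l x = 5 * pullback_line l x - 2 * exceptional_sum x.
Proof. by []. Qed.

(** Away from the F_2-points the line Y = 0 and the three lines through (0 : 0 : 1) do
not meet the overlap of the two opens; over an F_2-point of the line Y = 0, the denominator
of [cocycle_fun] has order 4 = 2 * 2, which B allows. *)
Lemma transition_bound x : is_dvr (stalk x) ->
  [/\ stalk x Y, stalk x (Y / X) & stalk x (Y / (X - 1))] ->
  [\/ stalk x Y^-1, stalk x (X / Y) | stalk x ((X - 1) / Y)] ->
  2 * divisor_B l x <= ord (stalk x) cocycle_fun.
Proof.
move=> dx [RY RYX RYX1] H; have sR := stalk_subring x; have lR := @stalk_local _ _ x.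
have Rc := stalk_cst x; have den0 := cocycle_den_neq0.
have h0 : hcoord k 0 != 0 := hcoord_neq0 k 0.
have den1 : den / hcoord k 0 ^+ 10 = den by rewrite hcoord0 expr1n divr1.
have ordh j := ord_pow_div sR dx 10 linear_form_neq0 (hcoord_neq0 k j) den0.
have s0 := exceptional_sum_ge0 x.
have [[RX _ uD]|[u [Eu RX _ nY [uw uD]]]|[RXi _ nv uw uD]] :=
  transition_cases sR lR X0 X1 Y0 RY RYX RYX1 H.
- rewrite divisor_BE (pullback_lineE dx (P2chart0_sub sR Rc RX RY)) /cocycle_fun (ordh 0) den1.
  rewrite (ord_unit sR dx uD) subr0; move: (exceptional_sum x) (ord _ _) s0 => s p; lia.
- have s1 := exceptional_sum_ge1 (dominates_line0 Eu RX RY nY uw).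
  have oY := ord_line0 dx Eu RX RY nY uw.
  rewrite divisor_BE (pullback_lineE dx (P2chart0_sub sR Rc RX RY)) /cocycle_fun (ordh 0) den1.
  rewrite (ord_unit_pow sR dx den0 Y0 oY uD).
  by move: (exceptional_sum x) (ord _ _) s1 => s p; lia.
have s1 := exceptional_sum_ge1 (dominates_line1 RXi RYX nv uw).
have ov := ord_line1 dx RXi RYX nv uw.
have YX0 : Y / X != 0 := mulf_neq0 Y0 (invr_neq0 X0).
have denX0 : den / X ^+ 10 != 0 := mulf_neq0 den0 (invr_neq0 (expf_neq0 10 X0)).
rewrite divisor_BE (pullback_lineE dx (P2chart1_sub sR Rc RXi RYX)) /cocycle_fun (ordh 1).
rewrite (ord_unit_pow sR dx denX0 YX0 ov uD).
by move: (exceptional_sum x) (ord _ _) s1 => s p; lia.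
Qed.

(** A neighbourhood of the strict transform of Y = 0, on which the quotients of Y by the
equations of the three lines through (0 : 0 : 1) are regular. *)
Definition open_near : opens (point XX) :=
  Opens (openI (openI (@dom_open _ XX Y) (@dom_open _ XX (Y / X))) (@dom_open _ XX (Y / (X - 1)))).
(** The complement of the strict transform of Y = 0. *)
Definition open_off : opens (point XX) :=
  Opens (openU (openU (@dom_open _ XX Y^-1) (@dom_open _ XX (X / Y))) (@dom_open _ XX ((X - 1) / Y))).

Lemma open_cover x : oset open_near x \/ oset open_off x.
Proof.
have sR := stalk_subring x; have lR := @stalk_local _ _ x.
have [off|noff] := pselect (oset open_off x); first by right.
left; have nY : ~ stalk x Y^-1 by move=> H; apply: noff; left; left.
have nXY : ~ stalk x (X / Y) by move=> H; apply: noff; left; right.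
have nX1Y : ~ stalk x ((X - 1) / Y) by move=> H; apply: noff; right.
have [j [i1 [i2 [[i1j i2j i12 _] CR Rg _]]]] := blowup_point_gen x.
have RT i : stalk x x_[i, j] by apply: CR; exact: P2chart_ratio.
have [j0|j1|j2] := ord3_cases j; last first.
- by exfalso; apply: nY; have := RT 0; rewrite j2 hratio02.
- subst j; have RXi := RT 0; rewrite hratio01 in RXi; have RYX := RT 2.
  have XiX0 : X^-1 != 0 := invr_neq0 X0.
  have Xi1 : X^-1 != 1.
    by apply/eqP => E; move/eqP: X1; apply; rewrite -[X]invrK E invr1.
  have YX0 : Y / X != 0 := mulf_neq0 Y0 XiX0.
  have YX1 : Y / X != 1.
    apply/eqP => E; have /eqP := @hcoord1_neq2 k; apply.
    by rewrite -[Y](divfK X0) E mul1r.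
  have Rg' : stalk x (((Y / X) ^+ 2 - Y / X) / (X^-1 ^+ 2 - X^-1)) \/
             stalk x ((X^-1 ^+ 2 - X^-1) / ((Y / X) ^+ 2 - Y / X)).
    move: Rg i1j i2j i12; rewrite /grid.
    by case: (ord3_cases i1) => ->; case: (ord3_cases i2) => ->; rewrite ?hratio01 // => Rg _ _ _;
      [left|right].
  have [] := grid_ratio_div sR lR XiX0 Xi1 YX0 YX1 RXi RYX Rg'.
  + by rewrite invfM invrK mulrC.
  + by rewrite invfM invrK mulrCA (mulVf X0) mulr1.
  + have -> : (X^-1 - 1) / (Y / X) = - ((X - 1) / Y).
      by rewrite invfM invrK mulrCA mulrBl (mulVf X0) mul1r mulrC -opprB mulNr.
    by move/(subringN sR); rewrite opprK.
  move=> _ RY RYX1; split; first split; rewrite /=.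
  + by move: RY; rewrite invrK (divfK X0).
  + exact: RYX.
  rewrite (swap_line Y X0 X1).
  exact: (subringN sR).
subst j; have RX := RT 1; rewrite hratio10 in RX; have RY := RT 2; rewrite hratio20 in RY.
have Rg' : stalk x ((Y ^+ 2 - Y) / (X ^+ 2 - X)) \/
           stalk x ((X ^+ 2 - X) / (Y ^+ 2 - Y)).
  move: Rg i1j i2j i12; rewrite /grid.
  by case: (ord3_cases i1) => ->; case: (ord3_cases i2) => ->; rewrite ?hratio10 ?hratio20 // => Rg _ _ _;
    [left|right].
have [? ? ?] := grid_ratio_div sR lR X0 X1 Y0 (@hcoord2_neq1 k) RX RY Rg' nY nXY nX1Y.
by split; first split.
Qed.

Lemma generic_in_opens : exists x, oset open_near x /\ oset open_off x.
Proof.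
have [x xT] := generic_point k; exists x.
by split; [split; [split|]|left; left]; rewrite /= xT.
Qed.

End Divisor.

(** * Non-vanishing *)

Section Final.
Variables (k : fieldType) (l : 'rV[k]_3) (l_neq0 : l != 0).
Local Notation K := (P2_field k).
Local Notation tofrac := (@FracField.tofrac {poly {poly k}}).
Local Notation P2chart_ := (@P2chart k).
Local Notation P2_F2stalk_ := (@P2_F2stalk k).
Local Notation XX := (blowup_P2 k).
Local Notation X := (hcoord k 1).
Local Notation Y := (hcoord k 2).
Local Notation ringinf := (@ring_inf {poly k}).
Local Notation ringat := (@ring_at {poly k}).
Local Notation lf := (linear_form l).
Local Notation den := (cocycle_den k).
Local Notation h := (cocycle_fun l).
Implicit Types (x : point XX) (pi : {poly {poly k}}).

Let X0 : X != 0 := hcoord_neq0 k 1.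
Let Y0 : Y != 0 := hcoord_neq0 k 2.
Let X1 : X != 1 := @hcoord1_neq1 k.

(** X takes no F_2-value on the generic fibre. *)
Lemma fibre_not_dominates (R : set K) (a : 'rV['F_2]_3) :
  R X -> R X^-1 -> R (X - 1)^-1 -> (a 0 0 != 0) || (a 0 1 != 0) ->
  ~ dominates R (P2_F2stalk_ a).
Proof.
move=> RX RXi RX1; have [a0 _|/negPn/eqP a00 /= a1] := boolP (a 0 0 != 0).
  have E : centred k 0 a 1 = X - (a 0 1 : nat)%:R by rewrite /centred hratio10.
  case: (F2_cases (a 0 1)) => Ea; rewrite Ea /= in E.
    rewrite mulr0n subr0 in E.
    by apply: (not_dominates (i := 1) a0); rewrite E; [exact: X0|exact: RXi].
  rewrite mulr1n in E.
  by apply: (not_dominates (i := 1) a0); rewrite E; [rewrite subr_eq0; exact: X1|exact: RX1].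
have E : centred k 1 a 0 = X^-1 by rewrite /centred hratio01 a00 /= mulr0n subr0.
by apply: (not_dominates (i := 0) a1); rewrite E; [exact: (invr_neq0 X0)|rewrite invrK].
Qed.

Lemma F2_point_last (a : 'rV['F_2]_3) : a != 0 -> a 0 0 = 0 -> a 0 1 = 0 -> a 0 2 = 1.
Proof.
move=> a0 a00 a01; case: (F2_cases (a 0 2)) => // a02.
case/eqP: a0; apply/rowP => i; rewrite mxE.
by case: (ord3_cases i) => ->.
Qed.

Lemma exceptional_sum_le1 x : stalk x X -> stalk x X^-1 -> stalk x (X - 1)^-1 ->
  exceptional_sum x <= 1.
Proof.
move=> RX RXi RX1; pose P : 'rV['F_2]_3 := f2row false false true.
have P0 : P != 0.
  by apply/eqP => /rowP/(_ 2)/eqP; rewrite [X in _ == X]mxE; apply/negP; rewrite f2row_neq0.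
rewrite /exceptional_sum (bigD1 P) //= big1 => [|a /andP[a0 aP]].
  by rewrite addr0 /exceptional_curve; case: asboolP.
rewrite /exceptional_curve; case: asboolP => // dom; exfalso.
apply: (fibre_not_dominates RX RXi RX1 _ dom); apply: contraR aP.
rewrite negb_or !negbK => /andP[/eqP a00 /eqP a01].
have a02 := F2_point_last a0 a00 a01.
apply/eqP/rowP => i; rewrite mxE.
by case: (ord3_cases i) => ->; rewrite ?a00 ?a01 ?a02.
Qed.

Lemma exceptional_sum_eq0 x : stalk x X -> stalk x X^-1 -> stalk x (X - 1)^-1 ->
  stalk x Y -> exceptional_sum x = 0.
Proof.
move=> RX RXi RX1 RY; rewrite /exceptional_sum big1 // => a a0.
rewrite /exceptional_curve; case: asboolP => // dom; exfalso.
have [a01|] := boolP ((a 0 0 != 0) || (a 0 1 != 0)).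
  exact: (fibre_not_dominates RX RXi RX1 a01 dom).
rewrite negb_or !negbK => /andP[/eqP a00 /eqP a01].
have a2 : a 0 2 != 0 by rewrite (F2_point_last a0 a00 a01).
have E : centred k 2 a 0 = Y^-1 by rewrite /centred hratio02 a00 /= mulr0n subr0.
by apply: (not_dominates (i := 0) a2 _ _ dom); rewrite E; [exact: (invr_neq0 Y0)|rewrite invrK].
Qed.

Lemma ring_at_coords pi : irreducible_poly pi ->
  [/\ is_unit (ringat pi) X, is_unit (ringat pi) (X - 1) & ringat pi Y].
Proof.
move=> irr; split; last exact: ring_at_poly.
  by apply: ring_at_const_unit => //; rewrite polyX_eq0.
have -> : X - 1 = tofrac ('X - 1%:P)%:P by rewrite polyCB tofracB !polyC1 tofrac1.
by apply: ring_at_const_unit => //; rewrite polyXsubC_eq0.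
Qed.

(** The condition on the component n of a section of WO(-B) at a prime divisor. *)
Definition component_bound x n (z : K) :=
  z != 0 -> 0 <= ord (stalk x) z + (2 ^ n)%:Z * - divisor_B l x.

(** On the affine part of the generic fibre B is 5 times the pullback of the line. *)
Lemma component_bound_fibre x pi n z : irreducible_poly pi -> stalk x = ringat pi ->
  component_bound x n.+1 z -> exists2 r, ringat pi r & z / h ^+ (2 ^ n) = r * den ^+ (2 ^ n).
Proof.
move=> irr xE H; have [[_ RX RXi] [_ RX1 RX1i] RY] := ring_at_coords irr.
have sR := ring_at_subring irr.
have dR : is_dvr (ringat pi) by exists (tofrac pi); exact: uniformizer_at.
have dx : is_dvr (stalk x) by rewrite xE.
have Rc c : stalk x (kcst c) by exact: stalk_cst.
have CR : P2chart_ 0 `<=` stalk x.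
  by apply: P2chart0_sub; rewrite ?xE // -xE.
have S0 : exceptional_sum x = 0 by apply: exceptional_sum_eq0; rewrite xE.
exists (z / lf ^+ (10 * 2 ^ n)); last by rewrite /cocycle_fun div_pow_pow.
apply: (ord_div_pow_ge0 sR dR (linear_form_neq0 l_neq0) (erefl _)) => z0.
have := H z0; rewrite divisor_BE S0 (pullback_lineE l_neq0 dx CR) xE hcoord0 divr1.
rewrite expnS PoszM; move: (ord _ z) (ord _ lf) (2 ^ n)%N => u v m.
by rewrite PoszM; lia.
Qed.

(** Division by the equation of B at infinity, with the pole of order 4 allowed along
the exceptional curve; the remaining zero of the denominator, of order 5 (m + 1),
absorbs the factor y. *)
Lemma inf_identity (F : fieldType) (z f y c : F) m : f != 0 -> y != 0 ->
  z / (f ^+ 10 / (c * y)) ^+ m.+1 * y =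
  z * y^-1 ^+ (4 * m.+1) / (f / y) ^+ (10 * m.+1) * (c ^+ m.+1 * y^-1 ^+ (5 * m + 4)).
Proof.
move=> f0 y0; rewrite div_pow_pow !exprMn !exprVn.
have -> : (10 * m.+1 = 4 * m.+1 + (5 * m + 4) + m.+1 + 1)%N by lia.
rewrite !exprD !expr1.
by field; rewrite ?(expf_neq0 _ f0) ?(expf_neq0 _ y0) ?f0 ?y0.
Qed.

Lemma pow_factor (F : fieldType) (r d c y : F) m : d = c * y ->
  r * d ^+ m.+1 = r * (d ^+ m * c) * y.
Proof. by move=> E; rewrite exprSr {2}E !mulrA. Qed.

Lemma inv_of_mulN1 (F : fieldType) (b y : F) : y != 0 -> - 1 = b * y -> y^-1 = - b.
Proof. by move=> y0 E; apply: (mulIf y0); rewrite mulVf // mulNr -E opprK. Qed.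

Lemma mem_pchar (F : fieldType) p : prime p -> p%:R = 0 :> F -> p \in [pchar F].
Proof. by move=> p_pr E; rewrite inE /= p_pr E eqxx. Qed.

(** The denominator of [cocycle_fun] has a zero of order 9 along the exceptional curve over
(0 : 0 : 1) and 2B allows a pole of order 4, so that sections vanish there after division by
the power of [cocycle_fun]. *)
Lemma component_bound_infinity x n z : stalk x = ringinf -> component_bound x n.+1 z ->
  ringinf (z / h ^+ (2 ^ n) * Y).
Proof.
move=> xE H; have sR := @ring_inf_subring {poly k}; have dR := ring_inf_is_dvr k.
have dx : is_dvr (stalk x) by rewrite xE.
have Rs : ringinf Y^-1 by exact: ring_infVX.
have RX : ringinf X by exact: ring_inf_const.
have RXY : ringinf (X / Y) by exact: (subringM sR RX Rs).
have uc (c : {poly k}) : c != 0 -> is_unit ringinf (tofrac c%:P).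
  move=> c0; rewrite -[tofrac _]divr1 -tofrac1; apply: ring_inf_unit.
  - by rewrite polyC_eq0.
  - exact: oner_neq0.
  - by rewrite size_polyC c0 size_poly1.
have [_ _ RXi] : is_unit ringinf X by apply: uc; rewrite polyX_eq0.
have [_ RX1 RX1i] : is_unit ringinf (X - 1).
  have -> : X - 1 = tofrac ('X - 1%:P)%:P by rewrite polyCB tofracB !polyC1 tofrac1.
  by apply: uc; rewrite polyXsubC_eq0.
have CR : P2chart_ 2 `<=` stalk x.
  by rewrite xE; apply: (P2chart2_sub sR); [exact: ring_inf_cst|exact: Rs|exact: RXY].
have S1 : exceptional_sum x <= 1 by apply: exceptional_sum_le1; rewrite xE.
have s0 : Y^-1 != 0 := invr_neq0 Y0.
have os : 1 <= ord ringinf Y^-1.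
  rewrite -gtz0_ge1; apply: (ord_gt0 sR dR s0 Rs) => -[_ _]; rewrite invrK.
  exact: ring_infX.
have lY0 : lf / Y != 0 := linear_form_div_neq0 l_neq0 2.
have Rz : ringinf (z * Y^-1 ^+ (4 * 2 ^ n) / (lf / Y) ^+ (10 * 2 ^ n)).
  apply: (ord_div_pow_ge0 sR dR lY0 (erefl _)) => zs0.
  have ss0 : Y^-1 ^+ (4 * 2 ^ n) != 0 := expf_neq0 _ s0.
  have z0 : z != 0 by move: zs0; apply: contraNneq => ->; rewrite mul0r.
  rewrite (ordM sR dR z0 ss0) (ordX sR dR _ s0).
  have := H z0; rewrite divisor_BE (pullback_lineE l_neq0 dx CR) xE.
  rewrite expnS !PoszM.
  move: (ord _ z) (ord _ (lf / _)) (ord _ _) os (2 ^ n)%N (exceptional_sum x) S1 => u v s os m S S1.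
  by nia.
have [m Em] : exists m, (2 ^ n = m.+1)%N.
  by exists (2 ^ n).-1; rewrite prednK // expn_gt0.
rewrite Em in Rz *.
rewrite /cocycle_fun /den /pole_den (inf_identity _ _ _ (linear_form_neq0 l_neq0) Y0).
apply: (subringM sR Rz); apply: (subringM sR); last exact: (subringX sR).
by do 2!apply: (subringX sR); exact: (subringM sR).
Qed.

(** The quotient q of [w] by the power of [cocycle_fun] is regular on the generic fibre of the
projection from (0 : 0 : 1) and vanishes at infinity, so it is 0; but q - 1 vanishes on the
line Y = 0. *)
Lemma no_global_section n (w s : K) :
  (forall x, oset (open_off k) x -> is_dvr (stalk x) -> component_bound x n.+1 w) ->
  (forall x, oset (open_near k) x -> is_dvr (stalk x) -> component_bound x n.+1 s) ->
  w <> s + h ^+ (2 ^ n).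
Proof.
move=> Hw Hs Ews.
have h0 : h ^+ (2 ^ n) != 0 := expf_neq0 _ (cocycle_fun_neq0 l_neq0).
pose q := w / h ^+ (2 ^ n).
have Eq : q = s / h ^+ (2 ^ n) + 1 by rewrite /q Ews mulrDl (divff h0).
have Hat pi : irreducible_poly pi ->
    exists2 r, ringat pi r & s / h ^+ (2 ^ n) = r * den ^+ (2 ^ n).
  move=> irr; have [x xE] := point_at irr.
  have sR := ring_at_subring irr.
  have [[_ RX RXi] [_ RX1 RX1i] RY] := ring_at_coords irr.
  apply: (component_bound_fibre irr xE); apply: Hs.
    split; [split|]; rewrite /= xE; [exact: RY|exact: (subringM sR RY RXi)|].
    exact: (subringM sR RY RX1i).
  by rewrite xE; exists (tofrac pi); exact: uniformizer_at.
have Rden pi : irreducible_poly pi -> ringat pi (den ^+ (2 ^ n)).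
  move=> irr; have sR := ring_at_subring irr.
  have [[_ RX RXi] [_ RX1 RX1i] RY] := ring_at_coords irr.
  by apply: (subringX sR); apply: (subringM sR) => //; apply: (subringX sR); exact: (subringM sR).
have q0 : q = 0.
  apply: regular_fibre_eq0 => [pi irr|].
    have sR := ring_at_subring irr; have [r Rr E] := Hat _ irr.
    rewrite Eq E; apply: (subringD sR); last exact: (subring1 sR).
    by apply: (subringM sR Rr); exact: Rden.
  have [x xE] := point_inf k; apply: (component_bound_infinity xE); apply: Hw.
    by left; left; rewrite /= xE; exact: ring_infVX.
  by rewrite xE; exact: ring_inf_is_dvr.
have irr : irreducible_poly ('X : {poly {poly k}}).
  by have := irredp_XsubC (0 : {poly k}); rewrite polyC0 subr0.
have sR := ring_at_subring irr; have [r Rr E] := Hat _ irr.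
have [_ _ nY _] := uniformizer_at irr; apply: nY.
have [[_ RX RXi] [_ RX1 RX1i] RY] := ring_at_coords irr.
have [m Em] : exists m, (2 ^ n = m.+1)%N.
  by exists (2 ^ n).-1; rewrite prednK // expn_gt0.
have Rden1 : ringat 'X den.
  by apply: (subringM sR) => //; apply: (subringX sR); exact: (subringM sR).
have E1 : - 1 = r * (den ^+ m * (X * (X - 1)) ^+ 3) * Y.
  have E0 : - 1 = s / h ^+ (2 ^ n) by apply/esym/eqP; rewrite -addr_eq0 -Eq q0.
  have Ed : den = (X * (X - 1)) ^+ 3 * Y by [].
  by rewrite [LHS]E0 E Em; exact: pow_factor.
have -> : (tofrac 'X)^-1 = - (r * (den ^+ m * (X * (X - 1)) ^+ 3)).
  exact: inv_of_mulN1 Y0 E1.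
apply: (subringN sR); apply: (subringM sR Rr); apply: (subringM sR); first exact: (subringX sR).
by apply: (subringX sR); exact: (subringM sR).
Qed.

End Final.

Theorem theorem4p1 (k : fieldType) (char2 : 2%N \in [pchar k])
  (perfect_k : bijective (pFrobenius_aut char2))
  (l : 'rV[k]_3) (l_neq0 : l != 0)
  (J : injective_resolution
         (WO (pcharf_prime char2) (fun x : point (blowup_P2 k) => - divisor_B l x))) :
  exists t : tensorZ (sheaf_H1 J) rat, t != 0.
Proof.
set p_pr := pcharf_prime char2 in J *.
set E := fun x : point (blowup_P2 k) => - divisor_B l x in J *.
(* Verschiebung of the Teichmueller representative of the rational section of O(2B) *)
pose w0 : witt p_pr (P2_field k) := Witt p_pr (fun i => if i == 1%N then cocycle_fun l else 0).
(* enough poles for w0 to be a global section *)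
pose E' x := `|E x| + `|ord (stalk x) (cocycle_fun l)|.
have le_EE' x : E x <= E' x.
  by apply: le_trans (ler_norm _) _; rewrite lerDl.
have [x0 [x0near x0off]] := generic_in_opens k.
have w0_near : w0 \in @WO_pred _ p_pr _ _ E' (open_near k).
  apply/asboolP; split=> [near0|x _ _ i]; first by move: x0near; rewrite near0.
  rewrite /w0 /=; case: (eqVneq i 1%N) => [->|_]; last by rewrite eqxx.
  by move=> _; rewrite /E'; move: (ord _ _) (E x) => u v; lia.
have w0_both : w0 \in @WO_pred _ p_pr _ _ E
    (Opens (openI (oset_open (open_near k)) (oset_open (open_off k)))).
  apply/asboolP; split=> [U0|x [near off] dx i].
    by exfalso; have : (set0 : set (point (blowup_P2 k))) x0 by rewrite -U0.
  rewrite /w0 /=; case: (eqVneq i 1%N) => [->|_]; last by rewrite eqxx.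
  move=> _; rewrite /E.
  have nearP : [/\ stalk x (hcoord k 2), stalk x (hcoord k 2 / hcoord k 1) &
                   stalk x (hcoord k 2 / (hcoord k 1 - 1))] by case: near => -[].
  have offP : [\/ stalk x (hcoord k 2)^-1, stalk x (hcoord k 1 / hcoord k 2) |
                   stalk x ((hcoord k 1 - 1) / hcoord k 2)].
    by case: off => [[]|]; [constructor 1|constructor 2|constructor 3].
  have := transition_bound l_neq0 dx nearP offP.
  by move: (ord _ _) (divisor_B l x) => u v; lia.
have [m mP] := WO_H1_class J le_EE' (@open_cover k) x0near x0off w0_near w0_both.
apply: (tensor_rat_neq0 (m := m)) => N N_gt0; apply/eqP => /mP[w [w_off s_near]].
have char2K : 2%N \in [pchar P2_field k].
  apply: mem_pchar => //; rewrite -kcst_nat (pcharf0 char2); exact: kcst0.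
have low0 i : (i < 1)%N -> w0 i = 0 by case: i.
have [n [lowN leadN]] := witt_mulrn_lead char2K N_gt0 low0.
have [_ lead] := wadd_lead p_pr (w - w0 *+ N) lowN.
have Ew : wcoord w n.+1 = wcoord (w - w0 *+ N) n.+1 + cocycle_fun l ^+ (2 ^ n).
  have Ew' : wadd 2 (w - w0 *+ N) (w0 *+ N) = wcoord w.
    by rewrite -[LHS]/(wcoord (w - w0 *+ N + w0 *+ N)) subrK.
  rewrite -{1}Ew'; apply: etrans lead _; congr (_ + _); exact: leadN.
apply: (no_global_section l_neq0 _ _ Ew) => x Ux dx.
  by have /asboolP[_ H] := w_off; exact: H x Ux dx n.+1.
by have /asboolP[_ H] := s_near; exact: H x Ux dx n.+1.
Qed.
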